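(* Let $\alpha,\beta\in(0,2\wedge d)$. Let $f,g:\mathbb{R}^d\times[0,\infty)\to[0,\infty)$ be continuous functions with $f(\cdot,0)=g(\cdot,0)=0$ such that, for every fixed $x$, $f(x,\cdot)$ and $g(x,\cdot)$ are non-decreasing. Suppose that for some $p,q>0$ and some measurable $U,V:\mathbb{R}^d\to(0,\infty)$ we have $$\liminf_{t\to0+}\inf_{x\in\mathbb{R}^d}\frac{f(x,t)}{U(x)t^p}>0,\qquad \liminf_{t\to0+}\inf_{x\in\mathbb{R}^d}\frac{g(x,t)}{V(x)t^q}>0.$$ Consider the system $$(-\Delta)^{\alpha/2}u\ge f(x,v)\ \text{ in } B^c,\qquad (-\Delta)^{\beta/2}v\ge g(x,u)\ \text{ in } B^c,\qquad u,v\ge0\ \text{ in }\mathbb{R}^d. \quad (\ast)$$ Suppose that $$\lim_{r\to\infty}\max\left\{\frac{r^{d-\alpha}}{\Phi_U(r)},\frac{r^{d-\beta}}{\Phi_V(r)}\right\}=0,$$ and that at least one of the following two conditions holds: $$\lim_{r\to\infty}\frac{1}{r^{(q+1)d-\beta-\alpha q}}(\Phi_U(r))^{1/p}\,\Phi_V(r)=\infty,\qquad\text{or}\qquad \lim_{r\to\infty}\frac{1}{r^{(p+1)d-\beta p-\alpha}}\Phi_U(r)\,(\Phi_V(r))^{1/q}=\infty.$$ Then $(\ast)$ has no (classical) solution other than $u=v=0$. In particular, if $pq\le1$ and there is a constant $c_1$ with $0<c_1\le\min\{U(x),V(x)\}$ for all $x\in B^c$, then $(\ast)$ has only the trivial solution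 $u=v=0$.
   Context: $d\ge1$; $B=\overline{B(0,1)}$ is the closed unit ball of $\mathbb{R}^d$, $B^c$ its (open) complement, and $B(x,r)$ is the ball of radius $r$ centered at $x$. For $\alpha\in(0,2)$, $(-\Delta)^{\alpha/2}u(x)=c_{d,\alpha}\,\mathrm{P.V.}\int_{\mathbb{R}^d}\frac{u(x)-u(y)}{|x-y|^{d+\alpha}}\,dy$ is the fractional Laplacian, with the usual normalizing constant $c_{d,\alpha}>0$. For $U,V:\mathbb{R}^d\to(0,\infty)$ define $$\Phi_U(r)=\inf_{\frac r2\le|x|\le\frac{3r}2}\int_{B(x,r/4)}U(y)\,dy,\qquad \Phi_V(r)=\inf_{\frac r2\le|x|\le\frac{3r}2}\int_{B(x,r/4)}V(y)\,dy.$$ Solutions (super-solutions) are classical: $u\in\mathcal{C}^{\alpha+}(B^c)\cap\mathcal{C}(\mathbb{R}^d)\cap L^1(\mathbb{R}^d,\omega_\alpha)$ and $v\in\mathcal{C}^{\beta+}(B^c)\cap\mathcal{C}(\mathbb{R}^d)\cap L^1(\mathbb{R}^d,\omega_\beta)$, with the inequalities holding pointwise. Here $h\in\mathcal{C}^{\alpha+}(D)$ means that for every compact $K\Subset D$ there is $\gamma>0$ with $h\in\mathcal{C}^{\alpha+\gamma}(K)$, and $L^1(\mathbb{R}^d,\omega_\alpha)$ is the class of functions integrable with respect to the weight $\omega_\alpha(x)=\frac{1}{1+|x|^{d+\alpha}}$. *)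

(* Defs.v *)
From HB Require Import structures.
From mathcomp Require Import all_boot all_order all_algebra.
From mathcomp Require Import all_classical all_reals all_analysis.

Set Implicit Arguments.
Unset Strict Implicit.
Unset Printing Implicit Defensive.

Import Order.TTheory GRing.Theory Num.Theory.
Import numFieldNormedType.Exports.

Local Open Scope classical_set_scope.
Local Open Scope ring_scope.

(* R^d is ['rV[R]_d]. Its library topology is the usual one, but the library
   norm [`|x|] on it is the sup norm, hence [enorm] below. *)

(* The sigma-algebra on ['rV[R]_n] generated by the coordinates, as the library
   does for tuples; since n is finite it is the Borel sigma-algebra. *)

Definition rV_display : measure_display -> measure_display.
Proof. exact. Qed.

Section rV_measurable.
Context {R : realType} (n : nat).

Let coord : 'I_n -> 'rV[R]_n -> R := fun i x => x 0 i.

Let rV_set0 : g_sigma_preimage coord set0.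
Proof. exact: sigma_algebra0. Qed.

Let rV_setC A : g_sigma_preimage coord A -> g_sigma_preimage coord (~` A).
Proof. exact: sigma_algebraC. Qed.

Let rV_bigcup (F : (set 'rV[R]_n)^nat) :
  (forall i, g_sigma_preimage coord (F i)) ->
  g_sigma_preimage coord (\bigcup_i (F i)).
Proof. exact: sigma_algebra_bigcup. Qed.

HB.instance Definition _ := @isMeasurable.Build (rV_display default_measure_display)
  'rV[R]_n (g_sigma_preimage coord) rV_set0 rV_setC rV_bigcup.

End rV_measurable.

Section rV_measurable_theory.
Context {R : realType}.

Lemma measurable_rV_coord n (i : 'I_n) :
  measurable_fun [set: 'rV[R]_n] (fun x => x 0 i).
Proof.
move=> _ Y mY; rewrite setTI; apply: sub_sigma_algebra => /=.
rewrite -bigcup_seq/=; exists i => /=; first by rewrite mem_index_enum.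
by exists Y => //; rewrite setTI.
Qed.

Lemma measurable_fun_rV d (T : measurableType d) n (f : T -> 'rV[R]_n) :
  (forall i, measurable_fun [set: T] (fun t => f t 0 i)) ->
  measurable_fun [set: T] f.
Proof.
move=> mf; apply: (@measurability _ _ _ _ _ _
  (\big[setU/set0]_(i < n)
    preimage_set_system setT (fun x : 'rV[R]_n => x 0 i) measurable)).
  by [].
move=> _ [A + <-]; rewrite setTI -bigcup_seq => -[i _ [B mB <-]].
by rewrite setTI -[X in measurable X]setTI; exact: mf.
Qed.

Definition cons_rV n (x : R * 'rV[R]_n) : 'rV[R]_n.+1 :=
  \row_i oapp (x.2 0) x.1 (unlift 0 i).

Definition uncons_rV n (x : 'rV[R]_n.+1) : R * 'rV[R]_n :=
  (x 0 0, \row_i x 0 (lift 0 i)).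

Lemma cons_rV0 n (x : R * 'rV[R]_n) : cons_rV x 0 0 = x.1.
Proof. by rewrite mxE unlift_none. Qed.

Lemma cons_rVS n (x : R * 'rV[R]_n) i : cons_rV x 0 (lift 0 i) = x.2 0 i.
Proof. by rewrite mxE liftK. Qed.

Lemma cons_rVK n : cancel (@cons_rV n) (@uncons_rV n).
Proof.
move=> [a x]; rewrite /uncons_rV cons_rV0; congr pair.
by apply/rowP => i; rewrite mxE cons_rVS.
Qed.

Lemma uncons_rVK n : cancel (@uncons_rV n) (@cons_rV n).
Proof.
move=> x; apply/rowP => i; case: (unliftP 0 i) => [j|] ->.
  by rewrite cons_rVS mxE.
by rewrite cons_rV0.
Qed.

Lemma measurable_cons_rV n : measurable_fun setT (@cons_rV n).
Proof.
apply: measurable_fun_rV => i; case: (unliftP 0 i) => [j|] ->.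
  under eq_fun do rewrite cons_rVS.
  by apply: (measurableT_comp (measurable_rV_coord j)); exact: measurable_snd.
by under eq_fun do rewrite cons_rV0; exact: measurable_fst.
Qed.

Lemma measurable_uncons_rV n : measurable_fun setT (@uncons_rV n).
Proof.
apply: measurable_fun_pair.
  exact: measurable_rV_coord.
apply: measurable_fun_rV => i /=.
by under eq_fun do rewrite mxE; exact: measurable_rV_coord.
Qed.

End rV_measurable_theory.

Section lebesgue_step.
Local Open Scope ereal_scope.
Context {R : realType} (n : nat) (m : {sigma_finite_measure set 'rV[R]_n -> \bar R}).

Definition lebesgue_rV_step : set 'rV[R]_n.+1 -> \bar R :=
  pushforward (lebesgue_measure \x m) (@cons_rV R n).

Let step0 : lebesgue_rV_step set0 = 0.
Proof. by rewrite /lebesgue_rV_step /pushforward preimage_set0 measure0. Qed.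

Let step_ge0 A : 0 <= lebesgue_rV_step A.
Proof. by rewrite /lebesgue_rV_step /pushforward; exact: measure_ge0. Qed.

Let step_semi_sigma_additive : semi_sigma_additive lebesgue_rV_step.
Proof.
have mcons A : measurable A -> measurable (@cons_rV R n @^-1` A).
  by move=> mA; rewrite -[X in measurable X]setTI; exact: measurable_cons_rV.
move=> F mF tF mUF; rewrite /lebesgue_rV_step /pushforward preimage_bigcup.
apply: measure_semi_sigma_additive.
- by move=> k; exact: mcons.
- apply/trivIsetP => /= i j _ _ ij; rewrite -preimage_setI.
  by move/trivIsetP : tF => /(_ _ _ _ _ ij) ->//; rewrite preimage_set0.
- by rewrite -preimage_bigcup; exact: mcons.
Qed.

HB.instance Definition _ := isMeasure.Build _ _ _ lebesgue_rV_step
  step0 step_ge0 step_semi_sigma_additive.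

Let step_sigma_finite : sigma_finite setT lebesgue_rV_step.
Proof.
have /sigma_finiteP[F [TF ndF Foo]] := sigma_finiteT (@lebesgue_measure R).
have /sigma_finiteP[G [TG ndG Goo]] := sigma_finiteT m.
exists (fun k => @uncons_rV R n @^-1` (F k `*` G k)).
  apply/seteqP; split => // x _.
  have [i _ Fi] : (\bigcup_i F i) (uncons_rV x).1 by rewrite -TF.
  have [j _ Gj] : (\bigcup_i G i) (uncons_rV x).2 by rewrite -TG.
  exists (maxn i j) => //; split.
    by move: Fi; exact/subsetPset/ndF/leq_maxl.
  by move: Gj; exact/subsetPset/ndG/leq_maxr.
move=> k; have [mF Fk] := Foo k; have [mG Gk] := Goo k; split.
  rewrite -[X in measurable X]setTI; apply: measurable_uncons_rV => //.
  exact: measurableX.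
rewrite /lebesgue_rV_step /pushforward -comp_preimage.
rewrite (_ : _ \o _ = id); last by apply/funext => x /=; rewrite cons_rVK.
by rewrite preimage_id product_measure1E// lte_mul_pinfty// ge0_fin_numE.
Qed.

HB.instance Definition _ := Measure_isSigmaFinite.Build _ _ _ lebesgue_rV_step
  step_sigma_finite.

End lebesgue_step.

(* The n-fold product of one-dimensional Lebesgue measure; see
   [lebesgue_rV_box]. *)
Fixpoint lebesgue_rV (R : realType) (n : nat) :
    {sigma_finite_measure set 'rV[R]_n -> \bar R} :=
  match n with
  | 0%N => @dirac _ 'rV[R]_0 0 R
  | k.+1 => lebesgue_rV_step (lebesgue_rV R k)
  end.

Lemma lebesgue_rV_box (R : realType) n (A : 'I_n -> set R) :
  (forall i, measurable (A i)) ->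
  lebesgue_rV R n [set x | forall i, A i (x 0 i)] =
  (\prod_(i < n) lebesgue_measure (A i))%E.
Proof.
elim: n A => [|n ih] A mA.
  rewrite big_ord0 /= diracE mem_set//; by case.
rewrite big_ord_recl -ih//= /lebesgue_rV_step /pushforward.
rewrite -product_measure1E//.
  congr product_measure1; apply/seteqP; split => x /=.
    move=> h; split; first by have := h 0; rewrite cons_rV0.
    by move=> i; have := h (lift 0 i); rewrite cons_rVS.
  move=> [h0 h] i; case: (unliftP 0 i) => [j|] ->; last by rewrite cons_rV0.
  by rewrite cons_rVS.
- exact: mA.
rewrite [X in measurable X](_ : _ =
    \bigcap_(i in [set: 'I_n]) ((fun x : 'rV[R]_n => x 0 i) @^-1` A (lift 0 i))).
  apply: fin_bigcap_measurable => // i _.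
  by rewrite -[X in measurable X]setTI; exact: measurable_rV_coord.
by apply/seteqP; split => x /= h i; [move=> _|]; exact: h.
Qed.

Section euclidean.
Context {R : realType} {d : nat}.
Implicit Types x y : 'rV[R]_d.

Definition enorm x : R := Num.sqrt (\sum_(i < d) x 0 i ^+ 2).

Definition eball x (r : R) : set 'rV[R]_d := [set y | enorm (y - x) < r].

Definition Bc : set 'rV[R]_d := [set x | 1 < enorm x].

(* Lebesgue measurability: equality almost everywhere to a Borel function. The
   library integral of a nonnegative function is a supremum over the Borel
   simple functions below it, so it has the expected value for these too. *)
Definition lebesgue_measurable (U : 'rV[R]_d -> R) :=
  exists2 U' : 'rV[R]_d -> R, measurable_fun setT U' &
    {ae lebesgue_rV R d, forall x, U x = U' x}.

(* U need not be locally integrable, so Phi U r is an extended real. *)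
Definition Phi (U : 'rV[R]_d -> R) (r : R) : \bar R :=
  ereal_inf [set (\int[lebesgue_rV R d]_(y in eball x (r / 4)) (U y)%:E)%E
            | x in [set x | r / 2 <= enorm x <= 3 * r / 2]].

End euclidean.

Section holder.
Context {R : realType} {d : nat}.
Implicit Types (h : 'rV[R]_d -> R) (K : set 'rV[R]_d).

(* C^{k,theta}(K) for 0 <= theta < 1: the partial derivatives of h of order at
   most k exist and are continuous on K, and those of order k are
   theta-Hoelder on K (for theta = 0 and K compact this is just C^k(K)). The
   derivatives at points of K are those of h on R^d; K will lie in the open set
   where h is regular. For real s >= 0, C^s(K) takes k the integer part of s. *)
Fixpoint Ck_holder (k : nat) (theta : R) K h : Prop :=
  {within K, continuous h} /\
  match k with
  | 0%N => exists C : R, forall x y, K x -> K y ->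
      `|h x - h y| <= C * enorm (x - y) `^ theta
  | j.+1 => forall i : 'I_d,
      (forall x, K x -> derivable h x (delta_mx 0 i)) /\
      Ck_holder j theta K ('D_(delta_mx 0 i) h)
  end.

Definition Cs (s : R) K h : Prop :=
  Ck_holder (Num.truncn s) (s - (Num.truncn s)%:R) K h.

Definition C_plus (alpha : R) (D : set 'rV[R]_d) h : Prop :=
  forall K, compact K -> K `<=` D ->
    exists2 gamma : R, 0 < gamma & Cs (alpha + gamma) K h.

Definition L1_omega (alpha : R) h : Prop :=
  (lebesgue_rV R d).-integrable setT
    (fun x => (h x * (1 / (1 + enorm x `^ (d%:R + alpha))))%:E).

End holder.

Section fractional_laplacian.
Context {R : realType}.

Definition Gamma (s : R) : R :=
  \int[lebesgue_measure]_(t in `]0, +oo[) (t `^ (s - 1) * expR (- t)).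

(* The usual constant 2^a Gamma((d+a)/2) / (pi^(d/2) |Gamma(-a/2)|), where
   |Gamma(-a/2)| = Gamma(1 - a/2) / (a/2) since 0 < a < 2. *)
Definition fraclap_cst (d : nat) (alpha : R) : R :=
  2 `^ alpha * Gamma ((d%:R + alpha) / 2) /
  (pi `^ (d%:R / 2) * (Gamma (1 - alpha / 2) / (alpha / 2))).

(* [fraclap alpha u] is (-Delta)^(alpha/2) u. The limit and the integrals are
   total in the library; they are genuine when u is in C^{alpha+} near x and in
   L^1(R^d, omega_alpha). *)
Definition fraclap d (alpha : R) (u : 'rV[R]_d -> R) (x : 'rV[R]_d) : R :=
  fraclap_cst d alpha *
  lim ((\int[lebesgue_rV R d]_(y in [set y | eps < enorm (x - y)])
          ((u x - u y) / enorm (x - y) `^ (d%:R + alpha)))%R @[eps --> 0^'+]).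

End fractional_laplacian.

Section system.
Context {R : realType} {d : nat}.
Implicit Types (f g : 'rV[R]_d -> R -> R) (u v U : 'rV[R]_d -> R).

(* f : R^d x [0, oo) -> [0, oo); its values at t < 0 are irrelevant *)
Definition nonlinearity f : Prop :=
  [/\ {within [set z : 'rV[R]_d * R | 0 <= z.2],
        continuous (fun z : 'rV[R]_d * R => f z.1 z.2)},
      forall x t, 0 <= t -> 0 <= f x t,
      forall x, f x 0 = 0
    & forall x s t, 0 <= s -> s <= t -> f x s <= f x t].

Definition liminf_ratio f U (p : R) : \bar R :=
  limf_einf (fun t : R =>
    ereal_inf [set (f x t / (U x * t `^ p))%:E | x in [set: 'rV[R]_d]]) 0^'+.

Definition classical (alpha : R) u : Prop :=
  [/\ C_plus alpha Bc u, continuous u & L1_omega alpha u].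

Definition solution (alpha beta : R) f g u v : Prop :=
  [/\ classical alpha u,
      classical beta v,
      forall x, Bc x -> f x (v x) <= fraclap alpha u x,
      forall x, Bc x -> g x (u x) <= fraclap beta v x
    & forall x, 0 <= u x /\ 0 <= v x].

Definition only_trivial_solution (alpha beta : R) f g : Prop :=
  forall u v, solution alpha beta f g u v <-> (forall x, u x = 0 /\ v x = 0).

End system.

(* Main.v *)
(* For a positive supersolution u, write m_u(r) for the minimum of u over the
   annulus r/4 <= |x| <= 2r. The operator (-Delta)^(alpha/2) maps the bubble
   (mu + |x - y|^2)^(-(d - alpha)/2) to a positive constant times
   mu^(alpha/2) (mu + |x - y|^2)^(-(d + alpha)/2). Hence a bubble minus half of a
   wider one is a barrier: it is comparable with the bubble, and its fractional
   Laplacian is at most C l^(-d) in B(y, l) and nonpositive elsewhere. Comparing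
   u with sums of such barriers over a fine grid of balls shows that m_u is
   bounded, that u >= c |x|^(alpha - d), and that m_u(r) is at least
   c r^(alpha - d) times the integral of f(., v) over B(z, r/4), |z| = r; so
     m_u(r) >= c r^(alpha - d) Phi_U(r) min(m_v(r), t)^p,
   and symmetrically for m_v. As r^(alpha - d) Phi_U and r^(beta - d) Phi_V tend
   to infinity, m_u and m_v tend to 0 and the two inequalities combine to
     m_u^(1 - pq) >= c (r^(alpha - d) Phi_U) (r^(beta - d) Phi_V)^p,
   which contradicts the boundedness of m_u if pq <= 1, and the lower bound on u
   together with the growth condition if pq > 1. Positivity of u and v comes from
   the strong maximum principle: at a zero of u in B^c the C^(alpha+) regularity
   makes the principal value converge, to a negative number unless u = 0. *)

Require Import Defs.
From HB Require Import structures.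
From mathcomp Require Import all_boot all_order all_algebra.
From mathcomp Require Import all_classical all_reals all_analysis.
From mathcomp Require Import measurable_realfun ring lra.

Set Implicit Arguments.
Unset Strict Implicit.
Unset Printing Implicit Defensive.
Import Order.TTheory GRing.Theory Num.Theory.
Import numFieldNormedType.Exports.

Local Open Scope classical_set_scope.
Local Open Scope ring_scope.

(** The operator is given as a total [lim] of truncated integrals, so its value is meaningful only
    where convergence is known. A positive value forces convergence, and outside B it is positive
    because f(x, v) > 0 there. Comparison must evaluate u and finite sums of bubbles at the same
    points. Both are therefore tested against the smoothed kernel (nu + |x - y|^2)^(-(d + alpha)/2)
    with nu = 1/(n + 1): on bubbles this is an explicit convolution of Gamma integrals of Gaussians,
    and on u its limit is that of the truncated integrals. No Green function enters. The lower bound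
    by the integral of f(., v) comes from finitely many barriers whose images are positive only on
    disjoint small balls, a Riemann sum for the continuous function f(., v). U need be neither Borel
    nor locally integrable, so only upper bounds for its integral by step functions are taken, and
    finiteness of Phi is an outcome of the estimate. Exponents are halved throughout, since bubbles
    are powers of |x|^2: D = d/2, a = alpha/2, b = D + a, m = D - a. *)

Lemma ge0_integral_pushforward_prod d1 d2 d3 (T1 : measurableType d1)
    (T2 : measurableType d2) (Y : measurableType d3) (R : realType)
    (m1 : {sigma_finite_measure set T1 -> \bar R})
    (m2 : {sigma_finite_measure set T2 -> \bar R})
    (phi : T1 * T2 -> Y) (mphi : measurable_fun setT phi)
    (m : {measure set Y -> \bar R}) (F : Y -> \bar R) :
  (forall A, measurable A -> m A = pushforward (m1 \x m2)%E phi A) ->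
  measurable_fun setT F -> (forall x, 0 <= F x)%E ->
  (\int[m]_x F x = \int[m1]_t \int[m2]_y F (phi (t, y)))%E.
Proof.
move=> mE mF F0.
rewrite (eq_measure_integral (pushforward (m1 \x m2)%E phi)); last first.
  by move=> A mA _; exact: mE.
rewrite ge0_integral_pushforward// preimage_setT fubini_tonelli1//.
- exact: measurableT_comp.
- by move=> x; exact: F0.
Qed.

(** * Gaussian and Gamma integrals *)

Section rV_integral.
Context {R : realType}.
Local Open Scope ereal_scope.
Local Notation leb := (@lebesgue_measure R).

Lemma ge0_integral_rVS n (F : 'rV[R]_n.+1 -> \bar R) :
  measurable_fun [set: 'rV[R]_n.+1] F -> (forall x, 0 <= F x) ->
  \int[lebesgue_rV R n.+1]_x F x =
  \int[leb]_t \int[lebesgue_rV R n]_y F (cons_rV (t, y)).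
Proof.
move=> mF F0.
apply: (@ge0_integral_pushforward_prod _ _ _ _ _ _ R leb (lebesgue_rV R n) _ (measurable_cons_rV (n:=n)) (lebesgue_rV R n.+1)) => //.
Qed.

Lemma measurable_prod_rV n (h : 'I_n -> R -> R) :
  (forall i, measurable_fun setT (h i)) ->
  measurable_fun [set: 'rV[R]_n] (fun x => \prod_(i < n) h i (x ord0 i))%R.
Proof.
move=> mh; apply: measurable_prod => i _.
by apply: measurableT_comp; [exact: mh|exact: measurable_rV_coord].
Qed.

Lemma integral_rV_prod n (h : 'I_n -> R -> R) :
  (forall i, measurable_fun setT (h i)) -> (forall i x, 0 <= h i x)%R ->
  \int[lebesgue_rV R n]_x (\prod_(i < n) h i (x ord0 i))%R%:E =
  \prod_(i < n) \int[leb]_t (h i t)%:E.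
Proof.
elim: n h => [|n IH] h mh h0.
  under eq_integral do rewrite big_ord0.
  by rewrite big_ord0 integral_cst//= diracT mule1.
have p0 (x : 'rV[R]_n.+1) : (0 <= \prod_(i < n.+1) h i (x ord0 i))%R by exact: prodr_ge0.
rewrite ge0_integral_rVS//; last first.
  by apply/measurable_EFinP; exact: measurable_prod_rV.
rewrite big_ord_recl -(IH (fun i => h (lift ord0 i)))//.
rewrite -ge0_integralZr//; last 3 first.
- by apply/measurable_EFinP; exact: mh.
- by move=> x _; rewrite lee_fin.
- by apply: integral_ge0 => x _; rewrite lee_fin; exact: prodr_ge0.
apply: eq_integral => t _.
rewrite -ge0_integralZl//; last 3 first.
- by apply/measurable_EFinP; exact: (@measurable_prod_rV _ (fun i => h (lift ord0 i))).
- by move=> x _; rewrite lee_fin; exact: prodr_ge0.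
- by rewrite lee_fin.
apply: eq_integral => y _; rewrite big_ord_recl cons_rV0/= EFinM; congr (_ * _%:E).
by apply: eq_bigr => i _; rewrite cons_rVS.
Qed.

Local Open Scope ring_scope.

(** The integrand is sqrt(pi / l) times the normal density of mean [x] and variance 1 / (2 l), which
    integrates to 1. *)
Lemma integral_gauss (l x : R) : 0 < l ->
  (\int[leb]_z (expR (- (l * (z - x) ^+ 2)))%:E = (Num.sqrt (pi / l))%:E)%E.
Proof.
move=> l0; pose s := Num.sqrt (2 * l)^-1.
have s2 : s ^+ 2 = (2 * l)^-1 by rewrite sqr_sqrtr// invr_ge0 mulr_ge0// ltW.
have s0 : s != 0 by rewrite gt_eqF// sqrtr_gt0 invr_gt0 mulr_gt0.
have E z : (expR (- (l * (z - x) ^+ 2)) = Num.sqrt (pi / l) * normal_pdf x s z)%R.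
  rewrite normal_pdfE//= /normal_peak /normal_fun s2.
  have -> : (2 * l)^-1 * pi *+ 2 = pi / l by rewrite -mulr_natr; field; rewrite gt_eqF.
  rewrite [RHS]mulrA divff ?mul1r; last by rewrite gt_eqF// sqrtr_gt0 divr_gt0// pi_gt0.
  by congr expR; rewrite -mulr_natr; field; rewrite gt_eqF.
under eq_integral do rewrite E EFinM.
rewrite integralZl//= ?integral_normal_pdf ?mule1//.
exact: integrable_normal_pdf.
Qed.

Lemma integral_gauss2 (l k x y : R) : 0 < l -> 0 < k ->
  (\int[leb]_z (expR (- (l * (x - z) ^+ 2)) * expR (- (k * (z - y) ^+ 2)))%:E =
   (Num.sqrt (pi / (l + k)) * expR (- (l * k / (l + k) * (x - y) ^+ 2)))%:E)%E.
Proof.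
move=> l0 k0; have lk0 : 0 < l + k by rewrite addr_gt0.
(* Completing the square: the product is a Gaussian centred at the weighted mean [c], times a factor
   with the reduced coefficient l k / (l + k). *)
pose c := (l * x + k * y) / (l + k).
have E z : expR (- (l * (x - z) ^+ 2)) * expR (- (k * (z - y) ^+ 2)) =
    expR (- (l * k / (l + k) * (x - y) ^+ 2)) * expR (- ((l + k) * (z - c) ^+ 2)).
  by rewrite -!expRD; congr expR; rewrite /c; field; rewrite gt_eqF.
under eq_integral do rewrite E EFinM.
rewrite ge0_integralZl//=; last first.
  apply/measurable_EFinP; apply: measurableT_comp => //.
  apply: measurableT_comp => //; apply: measurable_funM => //.
  by apply: measurable_funX; apply: measurable_funB.
by rewrite integral_gauss// -EFinM mulrC.
Qed.

Definition enorm2 d (x : 'rV[R]_d) : R := \sum_(i < d) x ord0 i ^+ 2.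

Lemma enorm2_ge0 d (x : 'rV[R]_d) : 0 <= enorm2 x.
Proof. by apply: sumr_ge0 => i _; exact: sqr_ge0. Qed.

Lemma enormE d (x : 'rV[R]_d) : enorm x = Num.sqrt (enorm2 x).
Proof. by []. Qed.

Lemma expR_enorm2 d (x : 'rV[R]_d) (l : R) :
  expR (- (l * enorm2 x)) = \prod_(i < d) expR (- (l * x ord0 i ^+ 2)).
Proof. by rewrite -expR_sum sumrN mulr_sumr. Qed.

Lemma measurable_enorm2 d : measurable_fun [set: 'rV[R]_d] (@enorm2 d).
Proof.
apply: measurable_sum => i.
by apply: measurable_funX; exact: measurable_rV_coord.
Qed.

Lemma measurable_enorm2B d (x : 'rV[R]_d) :
  measurable_fun [set: 'rV[R]_d] (fun y => enorm2 (x - y)).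
Proof.
rewrite /enorm2; under eq_fun do under eq_bigr do rewrite !mxE.
apply: measurable_sum => i; apply: measurable_funX; apply: measurable_funB => //.
exact: measurable_rV_coord.
Qed.

Lemma integral_gauss_rV d (l : R) (x : 'rV[R]_d) : 0 < l ->
  (\int[lebesgue_rV R d]_z (expR (- (l * enorm2 (x - z))))%:E =
   ((pi / l) `^ (d%:R / 2))%:E)%E.
Proof.
move=> l0; pose h (i : 'I_d) z := expR (- (l * (z - x ord0 i) ^+ 2)).
transitivity (\int[lebesgue_rV R d]_z (\prod_(i < d) h i (z ord0 i))%R%:E)%E.
  apply: eq_integral => z _; rewrite expR_enorm2; congr (_%:E).
  by apply: eq_bigr => i _; rewrite /h !mxE -[in RHS]sqrrN opprB.
rewrite integral_rV_prod; last 2 first.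
- move=> i; apply: measurableT_comp => //.
  apply: measurableT_comp => //; apply: measurable_funM => //.
  by apply: measurable_funX; apply: measurable_funB.
- by move=> i z; exact: expR_ge0.
under eq_bigr do rewrite integral_gauss//.
rewrite prodEFin prodr_const card_ord -powR12_sqrt; last first.
  by rewrite divr_ge0// ?pi_ge0// ltW.
by rewrite -powR_mulrn ?powR_ge0// -powRrM [2^-1 * _]mulrC.
Qed.

Lemma integral_gauss2_rV d (l k : R) (x y : 'rV[R]_d) : 0 < l -> 0 < k ->
  (\int[lebesgue_rV R d]_z
     (expR (- (l * enorm2 (x - z))) * expR (- (k * enorm2 (z - y))))%:E =
   ((pi / (l + k)) `^ (d%:R / 2) * expR (- (l * k / (l + k) * enorm2 (x - y))))%:E)%E.
Proof.
move=> l0 k0.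
pose h (i : 'I_d) z := expR (- (l * (x ord0 i - z) ^+ 2)) * expR (- (k * (z - y ord0 i) ^+ 2)).
transitivity (\int[lebesgue_rV R d]_z (\prod_(i < d) h i (z ord0 i))%R%:E)%E.
  apply: eq_integral => z _; rewrite !expR_enorm2 -big_split/=; congr (_%:E).
  by apply: eq_bigr => i _; rewrite /h !mxE.
have mE (f : R -> R) (c : R) : measurable_fun setT f ->
    measurable_fun setT (fun z => expR (- (c * f z ^+ 2))).
  move=> mf; apply: measurableT_comp => //.
  apply: measurableT_comp => //; apply: measurable_funM => //.
  exact: measurable_funX.
rewrite integral_rV_prod; last 2 first.
- by move=> i; apply: measurable_funM; apply: mE; apply: measurable_funB.
- by move=> i z; rewrite mulr_ge0// expR_ge0.
under eq_bigr do rewrite integral_gauss2//.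
rewrite prodEFin big_split/= prodr_const card_ord -powR12_sqrt; last first.
  by rewrite divr_ge0// ?pi_ge0// ltW// addr_gt0.
rewrite -powR_mulrn ?powR_ge0// -powRrM [2^-1 * _]mulrC expR_enorm2.
by congr (_ * _)%:E; apply: eq_bigr => i _; rewrite !mxE.
Qed.

(** Lebesgue measure and [c] times its image under dilation by [c] agree on the intervals ]a, b],
    hence everywhere by uniqueness; what remains is integration against an image measure. *)
Lemma ge0_integral_scale (c : R) (f : R -> \bar R) : 0 < c ->
  measurable_fun [set: R] f -> (forall x, 0 <= f x)%E ->
  (\int[leb]_(x in `]0%R, +oo[) f x = c%:E * \int[leb]_(x in `]0%R, +oo[) f (c * x)%R)%E.
Proof.
move=> c0 mf f0.
have mc : measurable_fun [set: R] (fun x : R => c * x) by exact: measurable_funM.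
pose sc : R -> measurableTypeR R := fun x => c * x.
have msc : measurable_fun [set: R] sc by exact: mc.
pose nu := mscale (NngNum (ltW c0)) (pushforward leb sc).
have nuE A : measurable A -> leb A = nu msc A.
  move=> mA; apply: lebesgue_measure_unique => //= _ [[a b]] _ <-.
  rewrite /nu /mscale/= /pushforward.
  rewrite (_ : sc @^-1` _ = `]a / c, b / c]%classic); last first.
    apply/seteqP; split => x /=; rewrite !in_itv/= ltr_pdivrMr// ler_pdivlMr//.
      by rewrite ![x * _]mulrC.
    by rewrite ![x * _]mulrC.
  rewrite !lebesgue_measure_itv/= !lte_fin ltr_pM2r ?invr_gt0//.
  case: ifPn => ab; last by rewrite mule0.
  by rewrite -!EFinB -EFinM -mulrBl mulrC divfK// gt_eqF.
rewrite (eq_measure_integral (nu msc)); last by move=> A mA _; exact: nuE.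
rewrite ge0_integral_mscale//=; last exact: measurable_funTS.
congr (_ * _)%E.
rewrite ge0_integral_pushforward//=; last exact: measurable_funTS.
by congr (integral _ _ _); apply/seteqP; split => x /=; rewrite !in_itv/= !andbT pmulr_rgt0.
Qed.

End rV_integral.

Lemma measurable_powR_comp d (T : measurableType d) (R : realType) (f : T -> R) (p : R) :
  measurable_fun setT f -> measurable_fun setT (fun x => f x `^ p).
Proof. by move=> mf; exact: (@measurableT_comp _ _ _ _ _ _ (@powR R ^~ p)). Qed.

Lemma measurable_expR_comp d (T : measurableType d) (R : realType) (f : T -> R) :
  measurable_fun setT f -> measurable_fun setT (fun x => expR (- f x)).
Proof. by move=> mf; apply: measurableT_comp => //; exact: measurableT_comp. Qed.

Section Gamma_facts.
Context {R : realType}.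
Implicit Types b y : R.
Local Notation leb := (@lebesgue_measure R).
Local Open Scope ring_scope.

(** For b < 1 the integrand is singular at 0, so the fundamental theorem of calculus is applied on
    [1/(n + 2), 1] and the bound passes to the increasing union. *)
Lemma integral_powR01 b : 0 < b ->
  (\int[leb]_(t in `]0%R, 1%R]) (t `^ (b - 1))%:E <= (b^-1)%:E)%E.
Proof.
move=> b0; pose x n : R := n.+2%:R^-1.
have x0 n : 0 < x n by rewrite invr_gt0.
have x1 n : x n < 1 by rewrite invf_lt1 ?ltr1n.
have E : `]0, 1]%classic = \bigcup_n `[x n, 1]%classic.
  apply/seteqP; split=> t /=.
    rewrite in_itv/= => /andP[t0 t1].
    exists (Num.truncn t^-1) => //=; rewrite in_itv/= t1 andbT /x.
    rewrite invf_ple ?posrE//; apply/ltW; apply: lt_trans (truncnS_gt _) _.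
    by rewrite ltr_nat.
  by move=> [n _] /=; rewrite !in_itv/= => /andP[xt ->]; rewrite (lt_le_trans (x0 n)).
have mf : measurable_fun [set: R] (fun t : R => (t `^ (b - 1))%:E).
  by apply/measurable_EFinP; exact: measurable_powR.
have key n : (\int[leb]_(t in `[x n, 1%R]) (t `^ (b - 1))%:E <= b^-1%:E)%E.
  rewrite (@continuous_FTC2 _ _ (fun t => b^-1 * t `^ b))//.
  - rewrite powR1 mulr1 -EFinB lee_fin lerBlDr lerDl.
    by rewrite mulr_ge0 ?powR_ge0// invr_ge0 ltW.
  - apply: continuous_in_subspaceT => t; rewrite inE/= in_itv/= => /andP[xt _].
    have t0 : 0 < t by exact: lt_le_trans xt.
    by apply/differentiable_continuous/derivable1_diffP; apply: derivable_powR; rewrite in_itv/= t0.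
  - have D t : 0 < t -> derivable (fun t => b^-1 * t `^ b) t 1.
      by move=> t0; apply: derivableM => //; apply: derivable_powR; rewrite in_itv/= t0.
    have C t : 0 < t -> {for t, continuous (fun t => b^-1 * t `^ b)}.
      by move=> t0; apply/differentiable_continuous/derivable1_diffP/D.
    split.
    + by move=> t; rewrite in_itv/= => /andP[xt _]; apply: D; exact: lt_trans xt.
    + by apply: cvg_at_right_filter; exact: C.
    + by apply: cvg_at_left_filter; exact: C.
  - move=> t; rewrite in_itv/= => /andP[xt _].
    have t0 : 0 < t by exact: lt_trans xt.
    rewrite derive1E deriveZ//=; last by apply: derivable_powR; rewrite in_itv/= t0.
    by rewrite (@derive_val _ _ _ _ _ _ _ (is_derive1_powR b t0)) /GRing.scale/= mulrA mulVf ?mul1r// gt_eqF.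
rewrite E; apply: (cvge_to_le (@ge0_nondecreasing_set_cvg_integral _
  (measurableTypeR R) R (fun n => `[x n, 1]%classic) _ leb _ _ _ _)).
- move=> n m nm; apply/subsetPset => t /=; rewrite !in_itv/= => /andP[xt ->].
  by rewrite (le_trans _ xt)// lef_pV2 ?posrE// ler_nat.
- by move=> i; exact: measurable_itv.
- by move=> i; exact: measurable_funTS.
- by move=> i t _; rewrite lee_fin powR_ge0.
- by apply: nearW => n; exact: key.
Qed.

(** [Gamma] is the [fine] part of this integral, so the computations start in the extended reals,
    before finiteness is known. *)
Definition GammaE b : \bar R :=
  (\int[leb]_(t in `]0%R, +oo[) (t `^ (b - 1) * expR (- t))%:E)%E.

Lemma measurable_Gamma_fun b y : measurable_fun [set: R]
  (fun t : R => (t `^ (b - 1) * expR (- (t * y)))).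
Proof.
apply: measurable_funM; first exact: measurable_powR.
by apply: measurableT_comp => //; apply: measurableT_comp => //; exact: measurable_funM.
Qed.

(** Half of the exponential pays for the power: with n + 1 > b, the Taylor term (t/2)^(n+1) / (n+1)!
    of exp(t/2) dominates t^(b-1) on [1, +oo[ up to a constant. *)
Lemma powR_expR_bound b : exists C : R, 0 <= C /\
  forall t, 1 <= t -> t `^ (b - 1) * expR (- t) <= C * expR (- (t / 2)).
Proof.
pose n := Num.truncn b; exists (2 ^+ n.+1 * n.+1`!%:R); split.
  by rewrite mulr_ge0.
move=> t t1; have t0 : 0 < t by exact: lt_le_trans t1.
have -> : expR (- (t / 2)) = expR (t / 2) * expR (- t).
  by rewrite -expRD; congr expR; lra.
rewrite mulrA ler_wpM2r ?expR_ge0//.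
have h : t `^ (b - 1) <= t ^+ n.+1.
  rewrite -(@powR_mulrn _ t n.+1 (ltW t0)); apply: ler_powR => //.
  by rewrite lerBlDr; apply: le_trans (ltW (truncnS_gt b)) _; rewrite lerDl.
apply: le_trans (_ : t ^+ n.+1 <= _) => //.
have t20 : 0 <= t / 2 by lra.
have h2 := @expR_ge1Dxn _ (t / 2) n t20.
have : (t / 2) ^+ n.+1 / n.+1`!%:R <= expR (t / 2) by apply: le_trans h2; rewrite lerDr.
rewrite ler_pdivrMr ?ltr0n ?fact_gt0// expr_div_n ler_pdivrMr ?exprn_gt0//.
by rewrite mulrC [expR _ * _]mulrC mulrA.
Qed.

(** Up to 1 the power alone is integrable; beyond 1 the integrand is at most a multiple of the
    exponential density of rate 1/2. *)
Lemma GammaE_lty b : 0 < b -> (GammaE b < +oo)%E.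
Proof.
move=> b0; have [C [C0 hC]] := powR_expR_bound b.
have mf : measurable_fun [set: R] (fun t : R => (t `^ (b - 1) * expR (- t))%:E).
  apply/measurable_EFinP; under eq_fun do rewrite -[X in expR (- X)]mulr1.
  exact: measurable_Gamma_fun.
have f0 t : 0 <= t `^ (b - 1) * expR (- t) by rewrite mulr_ge0 ?powR_ge0 ?expR_ge0.
have half0 : 0 < 2^-1 :> R by [].
rewrite /GammaE (_ : `]0, +oo[%classic = `]0, 1] `|` `]1, +oo[); last first.
  apply/seteqP; split => t /=; rewrite !in_itv/= !andbT.
    by move=> t0; case: (leP t 1) => t1; [left|right] => //; rewrite t0.
  by case=> [/andP[]//|]; apply: lt_trans.
rewrite ge0_integral_setU//=; last 3 first.
- exact: measurable_funTS.
- by move=> t _; rewrite lee_fin.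
- apply/disj_set2P; rewrite -subset0 => t /= []; rewrite !in_itv/= andbT => /andP[_ +].
  by move/le_lt_trans => /[apply]; rewrite ltxx.
apply: lte_add_pinfty.
- apply: le_lt_trans (ltry b^-1).
  apply: le_trans (integral_powR01 b0); apply: ge0_le_integral => //.
  + by move=> t _; rewrite lee_fin.
  + exact: measurable_funTS.
  + by apply: measurable_funTS; apply/measurable_EFinP; exact: measurable_powR.
  + move=> t; rewrite /= in_itv/= => /andP[t0 _].
    by rewrite lee_fin ler_piMr ?powR_ge0// -expR0 ler_expR oppr_le0 ltW.
- apply: (@le_lt_trans _ _ (\int[leb]_(t in `]1%R, +oo[)
     ((2 * C)%:E * (exponential_pdf 2^-1 t)%:E)))%E.
    apply: ge0_le_integral => //.
    + by move=> t _; rewrite lee_fin.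
    + exact: measurable_funTS.
    + apply: measurable_funTS; apply: emeasurable_funM => //.
      by apply/measurable_EFinP; exact: measurable_exponential_pdf.
    + move=> t; rewrite /= in_itv/= andbT => t1; rewrite -EFinM lee_fin.
      apply: le_trans (hC _ (ltW t1)) _.
      have t0 : (0 : R) <= t by apply: ltW; exact: lt_trans t1.
      rewrite exponential_pdfE// (_ : - 2^-1 * t = - (t / 2)); last by lra.
      by rewrite (_ : 2 * C * (2^-1 * _) = C * expR (- (t / 2)))//; field.
  rewrite ge0_integralZl//=; last 3 first.
  + by apply: measurable_funTS; apply/measurable_EFinP; exact: measurable_exponential_pdf.
  + by move=> t _; rewrite lee_fin exponential_pdf_ge0// ltW.
  + by rewrite lee_fin mulr_ge0.
  apply: (@le_lt_trans _ _ ((2 * C)%:E * 1)%E); last by rewrite mule1 ltry.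
  apply: lee_pmul => //.
  + by rewrite lee_fin mulr_ge0.
  + by apply: integral_ge0 => t _; rewrite lee_fin exponential_pdf_ge0// ltW.
  rewrite -(@integral_exponential_pdf R 2^-1)//.
  apply: ge0_subset_integral => //.
  + by apply/measurable_EFinP; exact: measurable_exponential_pdf.
  + by move=> t _; rewrite lee_fin exponential_pdf_ge0// ltW.
Qed.

Lemma GammaE_ge0 b : (0 <= GammaE b)%E.
Proof.
by apply: integral_ge0 => t _; rewrite lee_fin mulr_ge0 ?powR_ge0 ?expR_ge0.
Qed.

Lemma Gamma_EFin b : 0 < b -> (Gamma b)%:E = GammaE b.
Proof.
move=> b0; rewrite /Gamma /Rintegral fineK//.
by rewrite ge0_fin_numE ?GammaE_ge0// GammaE_lty.
Qed.

Lemma Gamma_gt0 b : 0 < b -> 0 < Gamma b.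
Proof.
move=> b0; rewrite -lte_fin Gamma_EFin// /GammaE.
(* On [1, 2] the power t^(b-1) is monotone in one direction or the other, hence at least the smaller
   of its two end values. *)
pose c : R := Num.min (2 `^ (b - 1)) 1 * expR (- 2).
have c0 : 0 < c by rewrite mulr_gt0 ?expR_gt0// lt_min ltr01 powR_gt0.
apply: (@lt_le_trans _ _ (\int[leb]_(t in `[1%R, 2%R]) c%:E)%E).
  rewrite integral_cst//= lebesgue_measure_itv/= lte_fin ltr1n -EFinB -EFinM lte_fin.
  by rewrite mulr_gt0//; lra.
have mf : measurable_fun [set: R] (fun t : R => (t `^ (b - 1) * expR (- t))%:E).
  apply/measurable_EFinP; under eq_fun do rewrite -[X in expR (- X)]mulr1.
  exact: measurable_Gamma_fun.
apply: (@le_trans _ _ (\int[leb]_(t in `[1%R, 2%R]) (t `^ (b - 1) * expR (- t))%:E)%E).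
  apply: ge0_le_integral => //.
  - by move=> t _; rewrite lee_fin ltW.
  - exact: measurable_funTS.
  - move=> t; rewrite /= in_itv/= => /andP[t1 t2]; rewrite lee_fin /c.
    apply: ler_pM; rewrite ?expR_ge0//.
    + rewrite ge_min; have [b1|b1] := leP 1 b.
        by apply/orP; right; rewrite -[leLHS](powRr0 t) ler_powR// subr_ge0.
      apply/orP; left; have -> : b - 1 = - (1 - b) by rewrite opprB.
      rewrite !powRN lef_pV2 ?posrE ?powR_gt0//; last by lra.
      by apply: ge0_ler_powR; rewrite ?nnegrE//; lra.
    + by rewrite ler_expR lerN2.
apply: ge0_subset_integral => //.
- exact: measurable_funTS.
- by move=> t _; rewrite lee_fin mulr_ge0 ?powR_ge0 ?expR_ge0.
- move=> t; rewrite /= !in_itv/= andbT => /andP[t1 _]; lra.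
Qed.

Lemma integral_Gamma b y : 0 < b -> 0 < y ->
  (\int[leb]_(t in `]0%R, +oo[) (t `^ (b - 1) * expR (- (t * y)))%:E =
   (Gamma b * y `^ (- b))%:E)%E.
Proof.
move=> b0 y0.
have := @ge0_integral_scale _ y (fun t : R => (t `^ (b - 1) * expR (- t))%:E) y0.
have mf : measurable_fun [set: R] (fun t : R => (t `^ (b - 1) * expR (- t))%:E).
  apply/measurable_EFinP; under eq_fun do rewrite -[X in expR (- X)]mulr1.
  exact: measurable_Gamma_fun.
have f0 t : 0 <= t `^ (b - 1) * expR (- t) by rewrite mulr_ge0 ?powR_ge0 ?expR_ge0.
move=> /(_ mf (fun x => f0 x)).
rewrite -/(GammaE b) -Gamma_EFin// => E.
rewrite EFinM E muleAC -EFinM.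
rewrite -ge0_integralZl//=; last 3 first.
- apply: measurable_funTS; apply/measurable_EFinP.
  under eq_fun do rewrite [y * _]mulrC.
  apply: measurable_funM; last first.
    by apply: measurableT_comp => //; apply: measurableT_comp => //; exact: measurable_funM.
  by apply: measurable_powR_comp; exact: measurable_funM.
- by move=> t _; rewrite lee_fin mulr_ge0 ?powR_ge0 ?expR_ge0.
- by rewrite lee_fin mulr_ge0 ?powR_ge0// ltW.
apply: eq_integral => t; rewrite inE/= in_itv/= andbT => t0.
rewrite -EFinM; congr (_%:E).
have Ey : y * y `^ (- b) * y `^ (b - 1) = 1.
  have yn : y != 0 by rewrite gt_eqF.
  rewrite -{1}[y](powRr1 (ltW y0)) -!powRD ?yn ?implybT//.
  by rewrite (_ : 1 - b + (b - 1) = 0) ?powRr0//; ring.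
by rewrite (powRM _ (ltW y0) (ltW t0)) [y * t]mulrC !mulrA Ey mul1r.
Qed.

End Gamma_facts.

Lemma measurable_enorm2_comp dT (T : measurableType dT) (R : realType) d
    (f g : T -> 'rV[R]_d) :
  measurable_fun setT f -> measurable_fun setT g ->
  measurable_fun setT (fun t => enorm2 (f t - g t)).
Proof.
move=> mf mg; rewrite /enorm2; under eq_fun do under eq_bigr do rewrite !mxE.
apply: measurable_sum => i; apply: measurable_funX; apply: measurable_funB.
- by apply: (measurableT_comp (measurable_rV_coord i)).
- by apply: (measurableT_comp (measurable_rV_coord i)).
Qed.

Lemma measurable_fun2_comp d1 d2 d3 d4 (T : measurableType d1) (T1 : measurableType d2)
    (T2 : measurableType d3) (T3 : measurableType d4)
    (f : T1 -> T2 -> T3) (g : T -> T1) (h : T -> T2) :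
  measurable_fun setT (fun p => f p.1 p.2) ->
  measurable_fun setT g -> measurable_fun setT h ->
  measurable_fun setT (fun t => f (g t) (h t)).
Proof.
move=> mf mg mh; apply: (measurableT_comp (f := fun p => f p.1 p.2) (g := fun t => (g t, h t))) => //.
exact: measurable_fun_pair.
Qed.

Lemma tonelliR d1 d2 (T1 : measurableType d1) (T2 : measurableType d2) (R : realType)
    (m1 : {sigma_finite_measure set T1 -> \bar R})
    (m2 : {sigma_finite_measure set T2 -> \bar R}) (f : T1 -> T2 -> R) :
  measurable_fun setT (fun p => f p.1 p.2) -> (forall x y, 0 <= f x y) ->
  (\int[m1]_x \int[m2]_y (f x y)%:E = \int[m2]_y \int[m1]_x (f x y)%:E)%E.
Proof.
move=> mf f0; apply: (@fubini_tonelli _ _ _ _ _ m1 m2 (fun p => (f p.1 p.2)%:E)).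
- by apply/measurable_EFinP.
- by move=> x; rewrite lee_fin.
Qed.

Lemma ge0_integralZR d (T : measurableType d) (R : realType) (m : {measure set T -> \bar R})
    (c : R) (f : T -> R) : 0 <= c -> measurable_fun setT f -> (forall x, 0 <= f x) ->
  (\int[m]_x (c * f x)%:E = c%:E * \int[m]_x (f x)%:E)%E.
Proof.
move=> c0 mf f0; under eq_integral do rewrite EFinM.
rewrite ge0_integralZl//; first exact/measurable_EFinP.
by move=> x _; rewrite lee_fin.
Qed.

Local Opaque Gamma powR expR.

(** * Bubbles *)

Section bubble.
Context {R : realType}.
Implicit Types b y s t : R.
Local Notation leb := (@lebesgue_measure R).
Local Open Scope ring_scope.

(* Extended by 0 to the whole line, so that Tonelli applies on R. *)
Definition pg s t : R := (0 < t)%R%:R * t `^ (s - 1).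

Lemma pg_ge0 s t : 0 <= pg s t.
Proof. by rewrite mulr_ge0 ?ler0n ?powR_ge0. Qed.

Lemma pgE s t : 0 < t -> pg s t = t `^ (s - 1).
Proof. by move=> t0; rewrite /pg t0 mul1r. Qed.

Lemma pg0 s t : t <= 0 -> pg s t = 0.
Proof. by move=> t0; rewrite /pg ltNge t0 mul0r. Qed.

Lemma measurable_pg_comp dT (T : measurableType dT) (f : T -> R) s :
  measurable_fun setT f -> measurable_fun setT (fun x => pg s (f x)).
Proof.
move=> mf; apply: (@measurableT_comp _ _ _ _ _ _ (pg s)) => //.
apply: measurable_funM; last exact: measurable_powR.
rewrite (_ : (fun x : R => _) = \1_(`]0, +oo[%classic : set R)).
  exact: measurable_indic.
apply/funext => t; rewrite indicE; congr (nat_of_bool _)%:R.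
by apply/idP/idP; rewrite inE/= in_itv/= andbT.
Qed.

Lemma integral_pg (f : R -> R) s :
  (\int[leb]_t (pg s t * f t)%:E = \int[leb]_(t in `]0%R, +oo[) (t `^ (s - 1) * f t)%:E)%E.
Proof.
rewrite [RHS]integral_mkcond; apply: eq_integral => t _.
rewrite patchE mem_setE in_itv/= andbT /pg; case: (ltP 0 t) => _.
  by rewrite mul1r.
by rewrite !mul0r.
Qed.

Lemma integral_pg_Gamma s y : 0 < s -> 0 < y ->
  (\int[leb]_t (pg s t * expR (- (t * y)))%:E = (Gamma s * y `^ (- s))%:E)%E.
Proof. by move=> s0 y0; rewrite integral_pg integral_Gamma. Qed.

(** Homogeneity of degree [s] of the measure t^(s-1) dt on the half-line; this is the substitution
    rule used below. *)
Lemma integral_pg_scale s c (f : R -> R) : 0 < c ->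
  measurable_fun [set: R] f -> (forall x, 0 <= f x) ->
  (\int[leb]_t (pg s t * f t)%:E = \int[leb]_t (c `^ s * (pg s t * f (c * t)))%:E)%E.
Proof.
move=> c0 mf f0.
rewrite integral_pg (@ge0_integral_scale _ c)//; last 2 first.
- by apply/measurable_EFinP; apply: measurable_funM => //; exact: measurable_powR.
- by move=> x; rewrite lee_fin mulr_ge0 ?powR_ge0.
rewrite ge0_integralZR ?powR_ge0//; last 2 first.
- apply: measurable_funM; first exact: measurable_pg_comp.
  by apply: measurableT_comp => //; exact: measurable_funM.
- by move=> x; rewrite mulr_ge0 ?pg_ge0.
rewrite (integral_pg (fun t => f (c * t))).
have mfc : measurable_fun [set: R] (fun t => f (c * t)).
  by apply: measurableT_comp => //; exact: measurable_funM.
have -> : (\int[leb]_(x in `]0%R, +oo[) ((c * x) `^ (s - 1) * f (c * x))%:E =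
    \int[leb]_(x in `]0%R, +oo[) ((c `^ (s - 1))%:E * (x `^ (s - 1) * f (c * x))%:E))%E.
  apply: eq_integral => t; rewrite inE/= in_itv/= andbT => t0.
  by rewrite -EFinM (powRM _ (ltW c0) (ltW t0)) mulrA.
rewrite ge0_integralZl//=; last 3 first.
- apply: measurable_funTS; apply/measurable_EFinP; exact: measurable_funM.
- by move=> t _; rewrite lee_fin mulr_ge0 ?powR_ge0.
- by rewrite lee_fin powR_ge0.
rewrite muleA -EFinM; congr (_%:E * _)%E.
have cn : c != 0 by rewrite gt_eqF.
by rewrite powRB ?cn ?implybT// (powRr1 (ltW c0)) mulrCA divff ?mulr1.
Qed.

(* For [nu = 0] this is |x|^(-2s), with the value 0 at [x = 0] when [s] is nonzero. *)
Definition bub d s (nu : R) (x : 'rV[R]_d) : R := (nu + enorm2 x) `^ (- s).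

Lemma bub_ge0 d s nu (x : 'rV[R]_d) : 0 <= bub s nu x.
Proof. exact: powR_ge0. Qed.

Lemma integral_pg_bub d s nu (x : 'rV[R]_d) : 0 < s -> 0 < nu ->
  (\int[leb]_t (pg s t * expR (- (t * (nu + enorm2 x))))%:E = (Gamma s * bub s nu x)%:E)%E.
Proof. by move=> s0 nu0; rewrite integral_pg_Gamma// ltr_wpDr ?enorm2_ge0. Qed.

Lemma enorm2C d (x y : 'rV[R]_d) : enorm2 (x - y) = enorm2 (y - x).
Proof.
by apply: eq_bigr => i _; rewrite !mxE -sqrrN opprB.
Qed.

Lemma measurable_bub_comp dT (T : measurableType dT) d s nu (f g : T -> 'rV[R]_d) :
  measurable_fun setT f -> measurable_fun setT g ->
  measurable_fun setT (fun w => bub s nu (f w - g w)).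
Proof.
move=> mf mg; apply: measurable_powR_comp; apply: measurable_funD => //.
exact: measurable_enorm2_comp.
Qed.

Lemma measurable_bub d s nu (x : 'rV[R]_d) :
  measurable_fun [set: 'rV[R]_d] (fun z => bub s nu (x - z)).
Proof. exact: measurable_bub_comp. Qed.

Lemma measurable_bub' d s nu (x : 'rV[R]_d) :
  measurable_fun [set: 'rV[R]_d] (fun z => bub s nu (z - x)).
Proof. exact: measurable_bub_comp. Qed.

(* Both factors are Gamma integrals of Gaussians, whose convolution is explicit. *)
Lemma integral_bub_conv d (b m nu mu : R) (x y : 'rV[R]_d) :
  0 < b -> 0 < m -> 0 < nu -> 0 < mu ->
  (\int[lebesgue_rV R d]_z (Gamma b * bub b nu (x - z) * (Gamma m * bub m mu (z - y)))%:E =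
   \int[leb]_n \int[leb]_l (pg m n * pg b l * expR (- (n * mu + l * nu)) *
     ((pi / (l + n)) `^ (d%:R / 2) * expR (- (l * n / (l + n) * enorm2 (x - y)))))%:E)%E.
Proof.
move=> b0 m0 nu0 mu0.
have Gb := ltW (Gamma_gt0 b0); have Gm := ltW (Gamma_gt0 m0).
pose h1 z n := pg m n * expR (- (n * (mu + enorm2 (z - y)))).
pose h2 z l := pg b l * expR (- (l * (nu + enorm2 (x - z)))).
have h10 z n : 0 <= h1 z n by rewrite mulr_ge0 ?pg_ge0 ?expR_ge0.
have h20 z l : 0 <= h2 z l by rewrite mulr_ge0 ?pg_ge0 ?expR_ge0.
have mh1 : measurable_fun setT (fun p : 'rV[R]_d * R => h1 p.1 p.2).
  apply: measurable_funM; first exact: measurable_pg_comp.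
  apply: measurable_expR_comp; apply: measurable_funM => //.
  by apply: measurable_funD => //; exact: measurable_enorm2_comp.
have mh2 : measurable_fun setT (fun p : 'rV[R]_d * R => h2 p.1 p.2).
  apply: measurable_funM; first exact: measurable_pg_comp.
  apply: measurable_expR_comp; apply: measurable_funM => //.
  by apply: measurable_funD => //; exact: measurable_enorm2_comp.
have mh2z z : measurable_fun setT (h2 z).
  by apply: (measurable_fun2_comp mh2).
have mh1z z : measurable_fun setT (h1 z).
  by apply: (measurable_fun2_comp mh1).
have mbub : measurable_fun [set: 'rV[R]_d] (fun z => Gamma b * bub b nu (x - z)).
  by apply: measurable_funM => //; exact: measurable_bub.
transitivity (\int[lebesgue_rV R d]_z \int[leb]_n (Gamma b * bub b nu (x - z) * h1 z n)%:E)%E.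
  apply: eq_integral => z _; rewrite ge0_integralZR//.
  - by rewrite integral_pg_bub// -EFinM.
  - by rewrite mulr_ge0// bub_ge0.
  - exact: mh1z.
rewrite tonelliR; last 2 first.
- apply: measurable_funM => //.
  by apply: (measurableT_comp mbub).
- by move=> z n; apply: mulr_ge0 => //; apply: mulr_ge0 => //; exact: bub_ge0.
apply: eq_integral => n _.
transitivity (\int[lebesgue_rV R d]_z \int[leb]_l (h1 z n * h2 z l)%:E)%E.
  apply: eq_integral => z _; rewrite ge0_integralZR//; last exact: mh2z.
  by rewrite integral_pg_bub// -EFinM mulrC.
rewrite tonelliR; last 2 first.
- apply: measurable_funM => //.
  exact: (measurable_fun2_comp mh1).
- by move=> z l; rewrite mulr_ge0.
apply: eq_integral => l _.
have [l0|l0] := leP l 0.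
  by rewrite /h2 (pg0 _ l0) !(mulr0, mul0r) integral0_eq// => z _; rewrite mul0r mulr0.
have [n0|n0] := leP n 0.
  by rewrite /h1 (pg0 _ n0) !(mulr0, mul0r) integral0_eq// => z _; rewrite mul0r mul0r.
transitivity (\int[lebesgue_rV R d]_z (pg m n * pg b l * expR (- (n * mu + l * nu)) *
   (expR (- (l * enorm2 (x - z))) * expR (- (n * enorm2 (z - y)))))%:E)%E.
  apply: eq_integral => z _; congr (_%:E); rewrite /h1 /h2.
  by rewrite !mulrDr !opprD !expRD; ring.
rewrite ge0_integralZR//; last 2 first.
- by apply: mulr_ge0; [apply: mulr_ge0; exact: pg_ge0|exact: expR_ge0].
- apply: measurable_funM; apply: measurable_expR_comp; apply: measurable_funM => //.
  + exact: measurable_enorm2_comp.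
  + exact: measurable_enorm2_comp.
by rewrite integral_gauss2_rV// -EFinM.
Qed.

Lemma powR_addE t u r s : 0 < t -> u = r + s -> t `^ u = t `^ r * t `^ s.
Proof. by move=> t0 ->; rewrite powRD// (gt_eqF t0)/= implybT. Qed.

(* After the substitution [l = w * n] the two exponents, which add up to d, leave a
   Gamma integral in [n]. *)
Lemma integral_bub_conv_half d (a nu mu : R) (x y : 'rV[R]_d) (D : R := d%:R / 2) :
  0 < a -> a < D -> 0 < nu -> 0 < mu ->
  ((Gamma (D + a) * Gamma (D - a))%:E *
    \int[lebesgue_rV R d]_z (bub (D + a) nu (x - z) * bub (D - a) mu (z - y))%:E =
   (pi `^ D * Gamma D)%:E * \int[leb]_w (pg a w *
     (mu + enorm2 (x - y) + nu * w + (nu + mu * w `^ (-1))) `^ (- D))%:E)%E.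
Proof.
move=> a0 aD nu0 mu0; set rho := enorm2 (x - y).
have rho0 : 0 <= rho by exact: enorm2_ge0.
have D0 : 0 < D by exact: lt_trans aD.
have b0 : 0 < D + a by rewrite addr_gt0.
have m0 : 0 < D - a by rewrite subr_gt0.
have Gb := Gamma_gt0 b0; have Gm := Gamma_gt0 m0; have GD := Gamma_gt0 D0.
have pi0 : 0 <= pi :> R by exact: pi_ge0.
rewrite -ge0_integralZR; last 3 first.
- by apply: mulr_ge0; [exact: (ltW Gb)|exact: (ltW Gm)].
- by apply: measurable_funM; [exact: measurable_bub|exact: measurable_bub'].
- by move=> z; rewrite mulr_ge0// bub_ge0.
have := integral_bub_conv x y b0 m0 nu0 mu0.
rewrite -/rho -/D.
under eq_integral do rewrite mulrACA.
move=> ->.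
(* [n * Y w] is the exponent after l = w n: the terms n mu + l nu, plus [rho] times the reduced
   coefficient l n / (l + n) = n w / (1 + w). *)
pose Y w := mu + w * nu + rho * (w * (1 + w) `^ (-1)).
have mY : measurable_fun [set: R] Y.
  apply: measurable_funD; first by apply: measurable_funD => //; exact: measurable_funM.
  apply: measurable_funM => //; apply: measurable_funM => //.
  by apply: measurable_powR_comp; exact: measurable_funD.
transitivity (\int[leb]_n \int[leb]_w (pi `^ D * (pg (D + a) w * (1 + w) `^ (- D)) *
    (pg D n * expR (- (n * Y w))))%:E)%E.
  apply: eq_integral => n _.
  have [n0|n0] := leP n 0.
    by rewrite !integral0_eq// => w _; rewrite (pg0 _ n0) ?(mul0r, mulr0).
  pose f l := pg (D - a) n * expR (- (n * mu + l * nu)) *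
         ((pi * (l + n) `^ (-1)) `^ D * expR (- (l * n * (l + n) `^ (-1) * rho))).
  have mV : measurable_fun [set: R] (fun l => (l + n) `^ (-1)).
    by apply: measurable_powR_comp; exact: measurable_funD.
  have mf : measurable_fun [set: R] f.
    apply: measurable_funM.
      apply: measurable_funM => //; apply: measurable_expR_comp.
      by apply: measurable_funD => //; exact: measurable_funM.
    apply: measurable_funM.
      by apply: measurable_powR_comp; exact: measurable_funM.
    apply: measurable_expR_comp; apply: measurable_funM => //.
    by apply: measurable_funM => //; exact: measurable_funM.
  have f0 l : 0 <= f l.
    apply: mulr_ge0; first by apply: mulr_ge0; [exact: pg_ge0|exact: expR_ge0].
    by apply: mulr_ge0; [exact: powR_ge0|exact: expR_ge0].
  transitivity (\int[leb]_l (pg (D + a) l * f l)%:E)%E.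
    apply: eq_integral => l _; congr (_%:E); rewrite /f.
    have [l0|l0] := leP l 0; first by rewrite (pg0 _ l0) !(mul0r, mulr0).
    rewrite powR_inv1; last by apply: addr_ge0; exact: ltW.
    by ring.
  rewrite (integral_pg_scale _ n0 mf f0); apply: eq_integral => w _; congr (_%:E).
  have [w0|w0] := leP w 0; first by rewrite (pg0 _ w0) !(mul0r, mulr0).
  have w10 : 0 < 1 + w by apply: addr_gt0.
  have nn : n != 0 by rewrite gt_eqF.
  rewrite /f /Y !pgE//.
  have -> : n * w + n = n * (1 + w) by ring.
  rewrite !powR_inv1 ?ltW ?mulr_gt0//.
  have -> : (pi / (n * (1 + w))) `^ D = pi `^ D * (n `^ (- D) * (1 + w) `^ (- D)).
    rewrite -powRM; [|exact: ltW|exact: ltW].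
    have nw : 0 <= n * (1 + w) by apply: mulr_ge0; exact: ltW.
    by rewrite powRM ?invr_ge0// -(powR_inv1 nw) -powRrM mulN1r.
  have -> : n `^ (D - 1) = n `^ (D + a) * n `^ (D - a - 1) * n `^ (- D).
    rewrite -(powR_addE n0 (u := D + a + (D - a - 1)) erefl).
    by apply: (powR_addE n0); ring.
  have -> : - (n * (mu + w * nu + rho * (w / (1 + w)))) =
     - (n * mu + n * w * nu) + - (n * w * n / (n * (1 + w)) * rho).
    by field; rewrite nn gt_eqF.
  rewrite expRD; ring.
rewrite tonelliR; last 2 first.
- apply: measurable_funM; last first.
    apply: measurable_funM; first exact: measurable_pg_comp.
    apply: measurable_expR_comp; apply: measurable_funM => //.
    exact: (measurableT_comp mY).
  apply: measurable_funM => //; apply: measurable_funM; first exact: measurable_pg_comp.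
  by apply: measurable_powR_comp; exact: measurable_funD.
- move=> n w; apply: mulr_ge0; apply: mulr_ge0.
  + exact: powR_ge0.
  + by apply: mulr_ge0; [exact: pg_ge0|exact: powR_ge0].
  + exact: pg_ge0.
  + exact: expR_ge0.
rewrite -ge0_integralZR; last 3 first.
- by apply: mulr_ge0; [exact: powR_ge0|exact: (ltW GD)].
- apply: measurable_funM; first exact: measurable_pg_comp.
  apply: measurable_powR_comp; apply: measurable_funD; last first.
    apply: measurable_funD => //; apply: measurable_funM => //; exact: measurable_powR_comp.
  by apply: measurable_funD => //; exact: measurable_funM.
- by move=> w; apply: mulr_ge0; [exact: pg_ge0|exact: powR_ge0].
apply: eq_integral => w _.
have [w0|w0] := leP w 0.
  rewrite (pg0 a w0) mul0r mulr0 integral0_eq// => n _.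
  by rewrite (pg0 _ w0) !(mul0r, mulr0).
have w10 : 0 < 1 + w by apply: addr_gt0.
have Y0 : 0 < Y w.
  rewrite /Y -addrA ltr_wpDr//; apply: addr_ge0; first by apply: mulr_ge0; exact: ltW.
  by apply: mulr_ge0 => //; apply: mulr_ge0; [exact: ltW|exact: powR_ge0].
rewrite ge0_integralZR; last 3 first.
- by apply: mulr_ge0; [exact: powR_ge0|apply: mulr_ge0; [exact: pg_ge0|exact: powR_ge0]].
- apply: measurable_funM; first exact: measurable_pg_comp.
  by apply: measurable_expR_comp; exact: measurable_funM.
- by move=> n; apply: mulr_ge0; [exact: pg_ge0|exact: expR_ge0].
rewrite (integral_pg_Gamma D0 Y0) -EFinM; apply: (congr1 EFin).
rewrite (pgE _ w0) (pgE _ w0).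
have wn : w != 0 by rewrite gt_eqF.
set Z := mu + rho + _ + _.
have Z0 : 0 < Z.
  have h1 := mulr_ge0 (ltW mu0) (powR_ge0 w (-1)).
  have h2 := mulr_gt0 nu0 w0.
  by exact: addr_gt0 (addr_gt0 (ltr_wpDr rho0 mu0) h2) (ltr_wpDr h1 nu0).
(* Clearing denominators, (1 + w) Y(w) = w Z; the factor w^(-D) then lowers the exponent of [w] from
   D + a - 1 to a - 1. *)
have E : (1 + w) `^ (- D) * Y w `^ (- D) = w `^ (- D) * Z `^ (- D).
  rewrite -(powRM _ (ltW w10) (ltW Y0)) -(powRM _ (ltW w0) (ltW Z0)).
  apply: (congr1 (fun t => t `^ (- D))).
  rewrite /Y /Z (powR_inv1 (ltW w10)) (powR_inv1 (ltW w0)).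
  by field; rewrite wn gt_eqF.
have -> : w `^ (a - 1) = w `^ (D + a - 1) * w `^ (- D).
  by apply: (powR_addE w0); rewrite [RHS]addrAC [D + a]addrC addrK.
transitivity (pi `^ D * Gamma D * (w `^ (D + a - 1) * ((1 + w) `^ (- D) * Y w `^ (- D)))).
  by ring.
by rewrite E; ring.
Qed.

End bubble.

Local Opaque Gamma powR expR.

(** * The operator on a bubble, as a limit of smoothed integrals *)

Section bubble_limit.
Context {R : realType}.
Local Notation leb := (@lebesgue_measure R).

Lemma pg_split (s r : R) t : pg s t * (t `^ (- r)) = pg (s - r) t.
Proof.
have [t0|t0] := leP t 0; first by rewrite !pg0// mul0r.
by rewrite (pgE _ t0) (pgE _ t0) -(powR_addE t0 erefl); congr (_ `^ _); ring.
Qed.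

(** Total mass of the smoothed kernel. It blows up like nu^(-a), so the two halves of [Jsm] diverge
    separately and must be subtracted under one integral sign. *)
Lemma integral_bub d (a nu : R) (x : 'rV[R]_d) (D : R := d%:R / 2) :
  0 < a -> 0 < nu ->
  ((Gamma (D + a))%:E * \int[lebesgue_rV R d]_z (bub (D + a) nu (x - z))%:E =
   (pi `^ D * (Gamma a * nu `^ (- a)))%:E)%E.
Proof.
move=> a0 nu0; have D0 : 0 <= D by exact: divr_ge0.
have b0 : 0 < D + a by exact: ltr_wpDl.
have Gb := Gamma_gt0 b0.
pose h z l := pg (D + a) l * expR (- (l * (nu + enorm2 (x - z)))).
have mh : measurable_fun setT (fun p : 'rV[R]_d * R => h p.1 p.2).
  apply: measurable_funM; first exact: measurable_pg_comp.
  apply: measurable_expR_comp; apply: measurable_funM => //.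
  by apply: measurable_funD => //; exact: measurable_enorm2_comp.
rewrite -ge0_integralZR; [|exact: (ltW Gb)|exact: measurable_bub|by move=> z; exact: bub_ge0].
transitivity (\int[lebesgue_rV R d]_z \int[leb]_l (h z l)%:E)%E.
  by apply: eq_integral => z _; rewrite integral_pg_bub.
rewrite tonelliR; [|exact: mh|]; last first.
  by move=> z l; apply: mulr_ge0; [exact: pg_ge0|exact: expR_ge0].
transitivity (\int[leb]_l (pi `^ D * (pg a l * expR (- (l * nu))))%:E)%E.
  apply: eq_integral => l _; rewrite /h.
  have [l0|l0] := leP l 0.
    rewrite (pg0 a l0) mul0r mulr0 integral0_eq// => z _.
    by rewrite (pg0 _ l0) mul0r.
  under eq_integral do rewrite mulrDr opprD expRD mulrA.
  rewrite ge0_integralZR; last 3 first.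
  - by apply: mulr_ge0; [exact: pg_ge0|exact: expR_ge0].
  - apply: measurable_expR_comp; apply: measurable_funM => //.
    exact: measurable_enorm2_comp.
  - by move=> z; exact: expR_ge0.
  rewrite (integral_gauss_rV _ l0) -EFinM; apply: (congr1 EFin).
  rewrite -/D (powRM _ (pi_ge0 R)) ?invr_ge0 ?(ltW l0)//.
  rewrite -(powR_inv1 (ltW l0)) -powRrM mulN1r.
  rewrite (_ : pg a l = pg (D + a) l * l `^ (- D)); first by ring.
  by rewrite pg_split addrC addKr.
rewrite ge0_integralZR; last 3 first.
- exact: powR_ge0.
- apply: measurable_funM; first exact: measurable_pg_comp.
  by apply: measurable_expR_comp; exact: measurable_funM.
- by move=> l; apply: mulr_ge0; [exact: pg_ge0|exact: expR_ge0].
by rewrite (integral_pg_Gamma a0 nu0) -EFinM.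
Qed.

(** A beta integral, in the shape produced by [integral_bub_conv_half]. With s = d/2 and T = mu + |x
    - y|^2, the power of [T] on the right is the value of the bubble at [x] and the power of [nu] is
    that of the kernel mass, so the two diverging terms of [Jsm] become integrals over the same
    variable [w]. *)
Lemma integral_pg_beta (a s nu T : R) : 0 < a -> a < s -> 0 < nu -> 0 < T ->
  ((Gamma s)%:E * \int[leb]_w (pg a w * (T + nu * w) `^ (- s))%:E =
   (Gamma a * nu `^ (- a) * (Gamma (s - a) * T `^ (- (s - a))))%:E)%E.
Proof.
move=> a0 as0 nu0 T0; have s0 := lt_trans a0 as0.
have Gs := Gamma_gt0 s0; have Ga := Gamma_gt0 a0.
pose h w n := pg a w * (pg s n * expR (- (n * (T + nu * w)))).
have mh : measurable_fun setT (fun p : R * R => h p.1 p.2).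
  apply: measurable_funM; first exact: measurable_pg_comp.
  apply: measurable_funM; first exact: measurable_pg_comp.
  apply: measurable_expR_comp; apply: measurable_funM => //.
  by apply: measurable_funD => //; exact: measurable_funM.
have h0 w n : 0 <= h w n.
  by apply: mulr_ge0; [|apply: mulr_ge0]; [exact: pg_ge0|exact: pg_ge0|exact: expR_ge0].
have mpe (c : R) s' : measurable_fun [set: R] (fun n => pg s' n * expR (- (n * c))).
  apply: measurable_funM; first exact: measurable_pg_comp.
  by apply: measurable_expR_comp; exact: measurable_funM.
have pe0 c s' n : 0 <= pg s' n * expR (- (n * c)).
  by apply: mulr_ge0; [exact: pg_ge0|exact: expR_ge0].
rewrite -ge0_integralZR; last 3 first.
- exact: (ltW Gs).
- apply: measurable_funM; first exact: measurable_pg_comp.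
  by apply: measurable_powR_comp; apply: measurable_funD => //; exact: measurable_funM.
- by move=> w; apply: mulr_ge0; [exact: pg_ge0|exact: powR_ge0].
transitivity (\int[leb]_w \int[leb]_n (h w n)%:E)%E.
  apply: eq_integral => w _; rewrite ge0_integralZR; last 3 first.
  - exact: pg_ge0.
  - exact: mpe.
  - by move=> n; exact: pe0.
  have [w0|w0] := leP w 0; first by rewrite (pg0 _ w0) mul0r mulr0 mul0e.
  rewrite (integral_pg_Gamma s0) -?EFinM; last by apply: addr_gt0 => //; exact: mulr_gt0.
  by apply: (congr1 EFin); ring.
rewrite tonelliR; [|exact: mh|exact: h0].
transitivity (\int[leb]_n (Gamma a * nu `^ (- a) * (pg (s - a) n * expR (- (n * T))))%:E)%E.
  apply: eq_integral => n _; rewrite /h.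
  have [n0|n0] := leP n 0.
    rewrite (pg0 (s - a) n0) mul0r mulr0 integral0_eq// => w _.
    by rewrite (pg0 s n0) mul0r mulr0.
  transitivity (\int[leb]_w (pg s n * expR (- (n * T)) * (pg a w * expR (- (w * (n * nu)))))%:E)%E.
    apply: eq_integral => w _; apply: (congr1 EFin).
    rewrite mulrDr opprD expRD (_ : n * (nu * w) = w * (n * nu)); last by ring.
    by ring.
  rewrite ge0_integralZR; last 3 first.
  - exact: pe0.
  - exact: mpe.
  - by move=> w; exact: pe0.
  rewrite (integral_pg_Gamma a0) -?EFinM; last exact: mulr_gt0.
  apply: (congr1 EFin); rewrite -pg_split (powRM _ (ltW n0) (ltW nu0)); ring.
rewrite ge0_integralZR; last 3 first.
- by apply: mulr_ge0; [exact: (ltW Ga)|exact: powR_ge0].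
- exact: mpe.
- by move=> n; exact: pe0.
by rewrite integral_pg_Gamma// ?subr_gt0// -EFinM.
Qed.

Lemma powR_diff_ge0 (D X e : R) : 0 < D -> 0 < X -> 0 <= e ->
  0 <= X `^ (- D) - (X + e) `^ (- D).
Proof.
move=> D0 X0 e0; rewrite subr_ge0 !powRN lef_pV2 ?posrE; last 2 first.
- by apply: powR_gt0; exact: ltr_wpDr.
- exact: powR_gt0.
have X1 : 0 <= X by exact: ltW.
by apply: ge0_ler_powR; rewrite ?nnegrE ?lerDl ?addr_ge0// ltW.
Qed.

(** Tangent bound: (1 + t)^(-D) = exp(-D ln(1 + t)) >= 1 - D t with t = e / X. *)
Lemma powR_diff_le (D X e : R) : 0 < D -> 0 < X -> 0 <= e ->
  X `^ (- D) - (X + e) `^ (- D) <= X `^ (- D) * (D * (e / X)).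
Proof.
move=> D0 X0 e0.
have eX : 0 <= e / X by apply: divr_ge0 => //; exact: ltW.
have -> : X + e = X * (1 + e / X) by field; rewrite gt_eqF.
have e1 : 0 < 1 + e / X by exact: ltr_wpDr.
rewrite (powRM _ (ltW X0) (ltW e1)) -{1}[X `^ (- D)]mulr1 -mulrBr.
rewrite ler_pM2l ?powR_gt0// lerBlDr addrC -lerBlDr.
have -> : (1 + e / X) `^ (- D) = expR (- D * ln (1 + e / X)).
  by rewrite [- D * _]mulrC expRM lnK.
apply: le_trans (expR_ge1Dx _); rewrite lerD2l mulNr lerN2 ler_pM2l//.
by apply: le_ln1Dx; rewrite (lt_le_trans _ eX)//; lra.
Qed.

(** The majorant is free of [nu], as dominated convergence for nu -> 0 requires. For w <= 1 the
    difference is at most T^(-D); for w > 1 the tangent bound gives decay in 1/w, because nu w + mu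
    <= (1 + mu / T) (T + nu w). Against [pg a] it is integrable when a < 1. *)
Lemma pg_diff_bound (D T mu nu w : R) : 0 < D -> 0 < T -> 0 < mu -> 0 <= nu -> 0 < w ->
  0 <= (T + nu * w) `^ (- D) - (T + nu * w + (nu + mu * w `^ (-1))) `^ (- D) <=
  2 * T `^ (- D) * (1 + D * (1 + mu / T)) * (1 + 1 * w) `^ (-1).
Proof.
move=> D0 T0 mu0 nu0 w0; set X := T + nu * w; set e := nu + _.
have nw : 0 <= nu * w by apply: mulr_ge0 => //; exact: ltW.
have TX : T <= X by rewrite lerDl.
have X0 : 0 < X by exact: lt_le_trans TX.
have wi : w `^ (-1) = w^-1 by rewrite powR_inv1// ltW.
have e0 : 0 <= e by apply: addr_ge0 => //; apply: mulr_ge0; [exact: ltW|exact: powR_ge0].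
rewrite powR_diff_ge0//=.
have TD : 0 < T `^ (- D) by exact: powR_gt0.
have XT : X `^ (- D) <= T `^ (- D).
  rewrite !powRN lef_pV2 ?posrE ?powR_gt0//.
  by apply: ge0_ler_powR; rewrite ?nnegrE ?(ltW D0) ?(ltW T0) ?(ltW X0).
have muT : 0 < mu / T by exact: divr_gt0.
rewrite mul1r powR_inv1; last by rewrite addr_ge0// ltW.
have w10 : 0 < 1 + w by exact: addr_gt0.
rewrite ler_pdivlMr//.
have [w1|w1] := leP w 1.
  apply: (@le_trans _ _ (T `^ (- D) * 2)).
    apply: ler_pM; [exact: powR_diff_ge0|exact: ltW| |lra].
    by apply: le_trans XT; rewrite gerBl powR_ge0.
  rewrite [_ * 2]mulrC -[leLHS]mulr1 ler_pM2l ?mulr_gt0// lerDl.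
  by rewrite mulr_ge0 ?(ltW D0)//; lra.
have h : D * (e / X) <= D * ((1 + mu / T) / w).
  rewrite ler_pM2l// ler_pdivrMr// /e wi mulrAC ler_pdivlMr//.
  rewrite mulrDl divfK ?gt_eqF//.
  have h1 : 0 <= mu / T * (nu * w) by rewrite mulr_ge0// ltW.
  have h2 : mu / T * T = mu by rewrite divfK// gt_eqF.
  by rewrite /X mulrDl mul1r mulrDr h2; lra.
have h3 : 0 < D * (1 + mu / T) by apply: mulr_gt0 => //; lra.
apply: (@le_trans _ _ (T `^ (- D) * (D * ((1 + mu / T) / w)) * (w + w))).
  apply: ler_pM; [exact: powR_diff_ge0|exact: ltW| |lra].
  apply: le_trans (powR_diff_le D0 X0 e0) _.
  apply: ler_pM => //; first exact: powR_ge0.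
  by rewrite mulr_ge0 ?(ltW D0)// divr_ge0// ltW.
rewrite [leLHS](_ : _ = 2 * T `^ (- D) * (D * (1 + mu / T))); last first.
  by field; rewrite !gt_eqF.
by rewrite ler_pM2l ?mulr_gt0// lerDr.
Qed.

Lemma ge0_integrable dT (X : measurableType dT) (m : {measure set X -> \bar R}) (f : X -> R) :
  measurable_fun setT f -> (forall x, 0 <= f x) -> (\int[m]_x (f x)%:E < +oo)%E ->
  m.-integrable setT (fun x => (f x)%:E).
Proof.
move=> mf f0 If; apply/integrableP; split; first exact/measurable_EFinP.
by under eq_integral do rewrite gee0_abs ?lee_fin//.
Qed.

Lemma mule_fin_lty (c : R) (I : \bar R) r : 0 < c -> (c%:E * I = r%:E)%E -> (I < +oo)%E.
Proof.
move=> c0; case: I => [s|/=|//]; first by rewrite ltry.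
by rewrite gt0_muley ?lte_fin.
Qed.

Lemma integrable_bub d (a nu : R) (x : 'rV[R]_d) (D : R := d%:R / 2) :
  0 < a -> 0 < nu ->
  (lebesgue_rV R d).-integrable setT (fun z => (bub (D + a) nu (x - z))%:E).
Proof.
move=> a0 nu0; apply: ge0_integrable.
- exact: measurable_bub.
- by move=> z; exact: bub_ge0.
- apply: mule_fin_lty (integral_bub x a0 nu0); apply: Gamma_gt0.
  by apply: ltr_wpDl => //; exact: divr_ge0.
Qed.

Lemma integrable_pg_beta (a s nu T : R) : 0 < a -> a < s -> 0 < nu -> 0 < T ->
  leb.-integrable setT (fun w => (pg a w * (T + nu * w) `^ (- s))%:E).
Proof.
move=> a0 as0 nu0 T0; apply: ge0_integrable.
- apply: measurable_funM; first exact: measurable_pg_comp.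
  by apply: measurable_powR_comp; apply: measurable_funD => //; exact: measurable_funM.
- by move=> w; apply: mulr_ge0; [exact: pg_ge0|exact: powR_ge0].
- apply: mule_fin_lty (integral_pg_beta a0 as0 nu0 T0); apply: Gamma_gt0.
  exact: lt_trans as0.
Qed.

(** By [Jsm_bub], its integral over [w] is [Jsm] of a bubble up to a constant factor. At nu = 0 it
    stays integrable and gives the operator itself. *)
Definition bub_diff (a D T mu nu w : R) : R :=
  pg a w * ((T + nu * w) `^ (- D) - (T + nu * w + (nu + mu * w `^ (-1))) `^ (- D)).

Lemma measurable_bub_diff a D T mu nu : measurable_fun [set: R] (bub_diff a D T mu nu).
Proof.
have m1 : measurable_fun [set: R] (fun w => T + nu * w).
  by apply: measurable_funD => //; exact: measurable_funM.
apply: measurable_funM; first exact: measurable_pg_comp.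
apply: measurable_funB; apply: measurable_powR_comp => //.
apply: measurable_funD => //; apply: measurable_funD => //.
by apply: measurable_funM => //; exact: measurable_powR_comp.
Qed.

Lemma bub_diff_bound (a D T mu nu w : R) : 0 < D -> 0 < T -> 0 < mu -> 0 <= nu ->
  0 <= bub_diff a D T mu nu w <=
  2 * T `^ (- D) * (1 + D * (1 + mu / T)) * (pg a w * (1 + 1 * w) `^ (- 1)).
Proof.
move=> D0 T0 mu0 nu0; rewrite /bub_diff.
have [w0|w0] := leP w 0; first by rewrite pg0// !(mul0r, mulr0) lexx.
have /andP[h1 h2] := pg_diff_bound D0 T0 mu0 nu0 w0.
apply/andP; split; first by apply: mulr_ge0 => //; exact: pg_ge0.
by rewrite mulrCA ler_wpM2l ?pg_ge0.
Qed.

Lemma integrable_bub_diff (a D T mu nu : R) :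
  0 < a -> a < 1 -> 0 < D -> 0 < T -> 0 < mu -> 0 <= nu ->
  leb.-integrable setT (fun w => (bub_diff a D T mu nu w)%:E).
Proof.
move=> a0 a1 D0 T0 mu0 nu0.
apply: (le_integrable measurableT _ _
  (integrableZl measurableT (2 * T `^ (- D) * (1 + D * (1 + mu / T)))
  (integrable_pg_beta a0 a1 (@ltr01 R) (@ltr01 R)))).
- by apply/measurable_EFinP; exact: measurable_bub_diff.
- move=> w _; have /andP[h1 h2] := @bub_diff_bound a D T mu nu w D0 T0 mu0 nu0.
  rewrite -EFinM !abse_EFin lee_fin (ger0_norm h1) (le_trans h2)//.
  exact: ler_norm.
Qed.

Lemma cvg_powR (s : R) (u : R^nat) (l : R) : 0 < l -> u @ \oo --> l ->
  (fun n => u n `^ s) @ \oo --> l `^ s.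
Proof.
move=> l0 ul.
have cl : {for l, continuous (fun t : R => t `^ s)}.
  apply/differentiable_continuous/derivable1_diffP; apply: derivable_powR.
  by rewrite in_itv/= l0.
exact: (cvg_comp u (fun t : R => t `^ s) ul cl).
Qed.

Lemma cvg_bub_diff (a D T mu : R) :
  0 < a -> a < 1 -> 0 < D -> 0 < T -> 0 < mu ->
  (\int[leb]_w (bub_diff a D T mu n.+1%:R^-1 w)%:E)%E @[n --> \oo] -->
  (\int[leb]_w (bub_diff a D T mu 0 w)%:E)%E.
Proof.
move=> a0 a1 D0 T0 mu0.
apply: (@dominated_cvg _ (measurableTypeR R) R leb setT measurableT
  (fun n w => (bub_diff a D T mu n.+1%:R^-1 w)%:E) (fun w => (bub_diff a D T mu 0 w)%:E)
  (fun w => (2 * T `^ (- D) * (1 + D * (1 + mu / T)))%:E * (pg a w * (1 + 1 * w) `^ (- 1))%:E)%E).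
- by move=> n; apply/measurable_EFinP; exact: measurable_bub_diff.
- move=> w _; apply/fine_cvgP; split; first by apply: nearW.
  rewrite /bub_diff/=; have [w0|w0] := leP w 0.
    by rewrite (pg0 _ w0) mul0r; under eq_fun do rewrite mul0r; exact: cvg_cst.
  apply: cvgM; first exact: cvg_cst.
  have h1 : (fun n : nat => T + n.+1%:R^-1 * w) @ \oo --> T + 0 * w.
    apply: cvgD; first exact: cvg_cst.
    by apply: cvgM; [exact: cvg_harmonic|exact: cvg_cst].
  have h2 : (fun n : nat => n.+1%:R^-1 + mu * w `^ (-1)) @ \oo --> 0 + mu * w `^ (-1).
    by apply: cvgD; [exact: cvg_harmonic|exact: cvg_cst].
  apply: cvgB; apply: cvg_powR => //.
  + by rewrite mul0r addr0.
  + rewrite mul0r addr0 add0r ltr_wpDr//; apply: mulr_ge0; [exact: ltW|exact: powR_ge0].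
  + exact: cvgD.
- by move=> w _.
- exact: (integrableZl measurableT _ (integrable_pg_beta a0 a1 (@ltr01 R) (@ltr01 R))).
- move=> n w _; have nu0 : 0 <= n.+1%:R^-1 :> R by [].
  have /andP[h1 h2] := @bub_diff_bound a D T mu _ w D0 T0 mu0 nu0.
  by rewrite -EFinM abse_EFin lee_fin (ger0_norm h1).
Qed.

(** The integral for nu = 0 at T = mu = 1, to which scaling reduces all other values of [T] and
    [mu]. *)
Definition Theta (a D : R) : R := \int[leb]_w bub_diff a D 1 1 0 w.

Lemma Theta_EFin (a D : R) : 0 < a -> a < 1 -> 0 < D ->
  (Theta a D)%:E = (\int[leb]_w (bub_diff a D 1 1 0 w)%:E)%E.
Proof.
move=> a0 a1 D0; rewrite /Theta /Rintegral fineK//.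
exact: (integrable_fin_num measurableT (integrable_bub_diff a0 a1 D0 ltr01 ltr01 (lexx 0))).
Qed.

Lemma Theta_gt0 (a D : R) : 0 < a -> a < 1 -> 0 < D -> 0 < Theta a D.
Proof.
move=> a0 a1 D0; rewrite -lte_fin Theta_EFin//.
have E1 : 1 `^ D = 1 :> R by rewrite powR1.
(* For 1 <= w <= 2 one has w^(a-1) >= 1/w >= 1/2 and 1 + 1/w >= 3/2. *)
pose c : R := 2^-1 * (1 - (3 / 2) `^ (- D)).
have c0 : 0 < c.
  rewrite mulr_gt0// subr_gt0 powRN invf_lt1 ?powR_gt0//.
  by rewrite -[X in X < _]E1 gt0_ltr_powR ?nnegrE//; lra.
apply: (@lt_le_trans _ _ (\int[leb]_(t in `[1%R, 2%R]) c%:E)%E).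
  rewrite integral_cst//= lebesgue_measure_itv/= lte_fin ltr1n -EFinB -EFinM lte_fin.
  by rewrite mulr_gt0//; lra.
have mf : measurable_fun [set: R] (fun w : R => (bub_diff a D 1 1 0 w)%:E).
  by apply/measurable_EFinP; exact: measurable_bub_diff.
have f0 w : 0 <= bub_diff a D 1 1 0 w.
  by have /andP[] := @bub_diff_bound a D 1 1 0 w D0 ltr01 ltr01 (lexx 0).
apply: (@le_trans _ _ (\int[leb]_(w in `[1%R, 2%R]) (bub_diff a D 1 1 0 w)%:E)%E).
  apply: ge0_le_integral => //.
  - by move=> t _; rewrite lee_fin ltW.
  - exact: measurable_funTS.
  - move=> w; rewrite /= in_itv/= => /andP[w1 w2]; rewrite lee_fin /c /bub_diff.
    have w0 : 0 < w by exact: lt_le_trans w1.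
    rewrite (pgE _ w0) mul0r mul1r addr0 add0r powR1 (powR_inv1 (ltW w0)).
    have iw : 2^-1 <= w^-1 by rewrite lef_pV2 ?posrE.
    apply: ler_pM => //.
    + rewrite subr_ge0 powRN invf_le1 ?powR_gt0//.
      by rewrite -[X in X <= _]E1 ge0_ler_powR ?nnegrE//; lra.
    + apply: le_trans iw _; rewrite -(powR_inv1 (ltW w0)).
      by apply: ler_powR => //; rewrite lerBrDr; lra.
    + rewrite lerD2l lerN2 !powRN lef_pV2 ?posrE ?powR_gt0//; try lra.
      by apply: ge0_ler_powR; rewrite ?nnegrE//; lra.
apply: ge0_subset_integral => //.
by move=> t _; rewrite lee_fin.
Qed.

(** The dilation of [w] by mu / T extracts all dependence on [mu] and [T]. Here the exponent D - a
    of the bubble turns into D + a. *)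
Lemma integral_bub_diff0 (a D T mu : R) : 0 < a -> a < 1 -> 0 < D -> 0 < T -> 0 < mu ->
  (\int[leb]_w (bub_diff a D T mu 0 w)%:E = (mu `^ a * T `^ (- (D + a)) * Theta a D)%:E)%E.
Proof.
move=> a0 a1 D0 T0 mu0; have c0 : 0 < mu / T by exact: divr_gt0.
pose f w := (T + 0 * w) `^ (- D) - (T + 0 * w + (0 + mu * w `^ (-1))) `^ (- D).
have mf : measurable_fun [set: R] f.
  have m1 : measurable_fun [set: R] (fun w => T + 0 * w).
    by apply: measurable_funD => //; exact: measurable_funM.
  apply: measurable_funB; apply: measurable_powR_comp => //.
  apply: measurable_funD => //; apply: measurable_funD => //.
  by apply: measurable_funM => //; exact: measurable_powR_comp.
have f0 w : 0 <= f w.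
  apply: powR_diff_ge0 => //; first by rewrite mul0r addr0.
  by rewrite add0r; apply: mulr_ge0; [exact: ltW|exact: powR_ge0].
rewrite (integral_pg_scale a c0 mf f0) EFinM Theta_EFin// -ge0_integralZR; last 3 first.
- by apply: mulr_ge0; exact: powR_ge0.
- exact: measurable_bub_diff.
- by move=> w; have /andP[] := @bub_diff_bound a D 1 1 0 w D0 ltr01 ltr01 (lexx 0).
apply: eq_integral => w _; apply: (congr1 EFin); rewrite /f /bub_diff.
have mul00 (t t' v v' : R) : t * (0 * v) = t' * (0 * v') by rewrite !mul0r !mulr0.
have [w0|w0] := leP w 0; first by rewrite (pg0 _ w0); exact: mul00.
rewrite !mul0r !addr0 !add0r (powRM _ (ltW c0) (ltW w0)) !mul1r.
have wi : 0 < 1 + w `^ (-1) by apply: ltr_wpDr => //; exact: powR_ge0.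
have -> : T + mu * ((mu / T) `^ (-1) * w `^ (-1)) = T * (1 + w `^ (-1)).
  by rewrite (powR_inv1 (ltW c0)); field; rewrite !gt_eqF.
rewrite (powRM _ (ltW T0) (ltW wi)) powR1.
have -> : (mu / T) `^ a = mu `^ a * T `^ (- a).
  rewrite powRM ?invr_ge0 ?(ltW T0) ?(ltW mu0)//.
  by rewrite -(powR_inv1 (ltW T0)) -powRrM mulN1r.
rewrite (powR_addE T0 (u := - (D + a)) (r := - a) (s := - D)); first by ring.
by rewrite opprD addrC.
Qed.

(* The principal value of the integral of (u x - u z) |x - z|^(-2b), regularized by
   smoothing the kernel instead of removing a ball. *)
Definition Jsm d (b : R) (u : 'rV[R]_d -> R) (x : 'rV[R]_d) (nu : R) : R :=
  \int[lebesgue_rV R d]_z ((u x - u z) * bub b nu (x - z)).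

Lemma bub_le d (m mu : R) (x : 'rV[R]_d) : 0 <= m -> 0 < mu -> bub m mu x <= mu `^ (- m).
Proof.
move=> m0 mu0; have e0 := enorm2_ge0 x.
rewrite /bub !powRN lef_pV2 ?posrE ?powR_gt0//; last by rewrite ltr_wpDr.
by apply: ge0_ler_powR; rewrite ?nnegrE ?(ltW mu0) ?lerDl ?addr_ge0 ?(ltW mu0).
Qed.

Lemma integrable_bub2 d (a nu m mu : R) (x y : 'rV[R]_d) (D : R := d%:R / 2) :
  0 < a -> 0 < nu -> 0 <= m -> 0 < mu ->
  (lebesgue_rV R d).-integrable setT (fun z => (bub m mu (z - y) * bub (D + a) nu (x - z))%:E).
Proof.
move=> a0 nu0 m0 mu0.
apply: (le_integrable measurableT _ _ (integrableZl measurableT (mu `^ (- m))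
  (integrable_bub x a0 nu0))).
- by apply/measurable_EFinP; apply: measurable_funM; [exact: measurable_bub'|exact: measurable_bub].
- move=> z _; rewrite -EFinM !abse_EFin lee_fin !ger0_norm; last 2 first.
  + by apply: mulr_ge0; [exact: powR_ge0|exact: bub_ge0].
  + by apply: mulr_ge0; exact: bub_ge0.
  by apply: ler_wpM2r; [exact: bub_ge0|exact: bub_le].
Qed.

(** For nu > 0 the integral splits into the bubble at [x] times the kernel mass, minus a
    convolution. [integral_bub] and [integral_pg_beta] treat the first part,
    [integral_bub_conv_half] the second, and both carry the prefactor pi^D Gamma(D). *)
Lemma Jsm_bub d (a nu mu : R) (x y : 'rV[R]_d) (D : R := d%:R / 2) :
  0 < a -> a < 1 -> a < D -> 0 < nu -> 0 < mu ->
  (Gamma (D + a) * Gamma (D - a)) * Jsm (D + a) (fun z => bub (D - a) mu (z - y)) x nu =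
  pi `^ D * Gamma D * \int[leb]_w bub_diff a D (mu + enorm2 (x - y)) mu nu w.
Proof.
move=> a0 a1 aD nu0 mu0; set T := mu + _.
have D0 : 0 < D by exact: lt_trans aD.
have b0 : 0 < D + a by rewrite addr_gt0.
have m0 : 0 < D - a by rewrite subr_gt0.
have T0 : 0 < T by rewrite ltr_wpDr ?enorm2_ge0.
have Gb := Gamma_gt0 b0; have Gm := Gamma_gt0 m0; have GD := Gamma_gt0 D0.
have pD : 0 < pi `^ D :> R by rewrite powR_gt0 ?pi_gt0.
pose k z := bub (D - a) mu (z - y).
have i1 := integrableZl measurableT (k x) (integrable_bub x a0 nu0).
have i2 := integrable_bub2 x y a0 nu0 (ltW m0) mu0.
have j1 := integrable_pg_beta a0 aD nu0 T0.
pose g2 w := pg a w * (T + nu * w + (nu + mu * w `^ (-1))) `^ (- D).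
have mg2 : measurable_fun setT g2.
  apply: measurable_funM; first exact: measurable_pg_comp.
  apply: measurable_powR_comp; apply: measurable_funD; last first.
    by apply: measurable_funD => //; apply: measurable_funM => //; exact: measurable_powR_comp.
  by apply: measurable_funD => //; exact: measurable_funM.
have g20 w : 0 <= g2 w by apply: mulr_ge0; [exact: pg_ge0|exact: powR_ge0].
have j2 : leb.-integrable setT (fun w => (g2 w)%:E).
  apply: (le_integrable measurableT _ _ j1); first exact/measurable_EFinP.
  move=> w _; rewrite !abse_EFin lee_fin !ger0_norm//; last first.
    by apply: mulr_ge0; [exact: pg_ge0|exact: powR_ge0].
  have /andP[+ _] := @bub_diff_bound a D T mu nu w D0 T0 mu0 (ltW nu0).
  by rewrite /bub_diff mulrBr subr_ge0.
have R1 : Jsm (D + a) k x nu = \int[lebesgue_rV R d]_z (k x * bub (D + a) nu (x - z)) -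
    \int[lebesgue_rV R d]_z (k z * bub (D + a) nu (x - z)).
  rewrite -RintegralB//.
  by rewrite /Jsm; apply: eq_Rintegral => z _; rewrite mulrBl.
have R2 : \int[leb]_w bub_diff a D T mu nu w =
   \int[leb]_w (pg a w * (T + nu * w) `^ (- D)) - \int[leb]_w g2 w.
  by rewrite -RintegralB//; apply: eq_Rintegral => w _; rewrite /bub_diff mulrBr.
rewrite R1 R2 !mulrBr; congr (_ - _).
- have E1 := integral_bub x a0 nu0; have E2 := integral_pg_beta a0 aD nu0 T0.
  rewrite RintegralZl//; last exact: (integrable_bub x a0 nu0).
  have F1 := integrable_fin_num measurableT (integrable_bub x a0 nu0).
  have F2 := integrable_fin_num measurableT j1.
  move: E1 E2; rewrite -(fineK F1) -(fineK F2) -!EFinM => -[E1] [E2].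
  rewrite /Rintegral; set I1 := fine _ in E1 *; set I2 := fine _ in E2 *.
  have alg (g m k' i : R) : g * m * (k' * i) = g * i * (m * k') by ring.
  by rewrite alg E1 -[RHS]mulrA E2 -[LHS]mulrA.
- have E := integral_bub_conv_half x y a0 aD nu0 mu0.
  have F1 := integrable_fin_num measurableT i2.
  have F2 := integrable_fin_num measurableT j2.
  have F1' : (\int[lebesgue_rV R d]_z (bub (D + a) nu (x - z) * bub (D - a) mu (z - y))%:E =
     \int[lebesgue_rV R d]_z (bub (D - a) mu (z - y) * bub (D + a) nu (x - z))%:E)%E.
    by apply: eq_integral => z _; rewrite mulrC.
  move: E; rewrite F1' -/T -(fineK F1) -(fineK F2) -!EFinM => -[E].
  exact: E.
Qed.

Lemma cvg_Jsm_bub d (a mu : R) (x y : 'rV[R]_d) (D : R := d%:R / 2) :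
  0 < a -> a < 1 -> a < D -> 0 < mu ->
  Jsm (D + a) (fun z => bub (D - a) mu (z - y)) x n.+1%:R^-1 @[n --> \oo] -->
  pi `^ D * Gamma D / (Gamma (D + a) * Gamma (D - a)) * Theta a D *
    (mu `^ a * bub (D + a) mu (x - y)).
Proof.
move=> a0 a1 aD mu0.
have D0 : 0 < D by exact: lt_trans aD.
have Gb : 0 < Gamma (D + a) by apply: Gamma_gt0; exact: addr_gt0.
have Gm : 0 < Gamma (D - a) by apply: Gamma_gt0; rewrite subr_gt0.
set T := mu + enorm2 (x - y).
have T0 : 0 < T by rewrite ltr_wpDr ?enorm2_ge0.
have E n : Jsm (D + a) (fun z => bub (D - a) mu (z - y)) x n.+1%:R^-1 =
   pi `^ D * Gamma D / (Gamma (D + a) * Gamma (D - a)) *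
   \int[leb]_w bub_diff a D T mu n.+1%:R^-1 w.
  have n0 : 0 < n.+1%:R^-1 :> R by [].
  have := Jsm_bub x y a0 a1 aD n0 mu0; rewrite -/D -/T => h.
  have GG : Gamma (D + a) * Gamma (D - a) != 0 by rewrite gt_eqF// mulr_gt0.
  by rewrite mulrAC -h mulrAC (divff GG) mul1r.
under eq_fun do rewrite E.
rewrite -mulrA; apply: cvgM; first exact: cvg_cst.
have := cvg_bub_diff a0 a1 D0 T0 mu0.
rewrite (integral_bub_diff0 a0 a1 D0 T0 mu0) mulrC => /fine_cvgP[_].
exact.
Qed.

End bubble_limit.

(** * Principal values and comparison *)

Section kernel_bounds.
Context {R : realType} {d : nat}.
Implicit Types x y z : 'rV[R]_d.

Lemma enorm2D_le x y : enorm2 (x + y) <= 2 * enorm2 x + 2 * enorm2 y.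
Proof.
rewrite /enorm2 !mulr_sumr -big_split; apply: ler_sum => i _; rewrite !mxE/=.
by have := sqr_ge0 (x ord0 i - y ord0 i); nra.
Qed.

Lemma enorm_ge0 x : 0 <= enorm x.
Proof. exact: sqrtr_ge0. Qed.

Lemma sqr_enorm x : enorm x ^+ 2 = enorm2 x.
Proof. by rewrite sqr_sqrtr// enorm2_ge0. Qed.

Lemma lt_enorm (e : R) x : 0 <= e -> (e < enorm x) = (e ^+ 2 < enorm2 x).
Proof.
by move=> e0; rewrite -sqr_enorm ltr_sqr ?nnegrE ?enorm_ge0.
Qed.

Lemma le_enorm (e : R) x : 0 <= e -> (e <= enorm x) = (e ^+ 2 <= enorm2 x).
Proof.
by move=> e0; rewrite -sqr_enorm ler_sqr ?nnegrE ?enorm_ge0.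
Qed.

Lemma bub_le_scale (b c nu mu : R) x y : 0 <= b -> 0 < c ->
  0 < nu + enorm2 x -> nu + enorm2 x <= c * (mu + enorm2 y) ->
  bub b mu y <= c `^ b * bub b nu x.
Proof.
move=> b0 c0 p0 h.
have q0 : 0 < mu + enorm2 y.
  by have := lt_le_trans p0 h; rewrite pmulr_rgt0.
rewrite /bub !powRN -ler_pdivrMl ?powR_gt0// -invfM lef_pV2 ?posrE ?powR_gt0 ?mulr_gt0 ?powR_gt0//.
rewrite -(powRM _ (ltW c0) (ltW q0)).
by apply: ge0_ler_powR => //; rewrite nnegrE ?(ltW p0) ?mulr_ge0 ?(ltW c0) ?(ltW q0).
Qed.

Lemma bub_decay (b nu : R) x : 0 <= b -> 0 < nu ->
  exists C : R, 0 < C /\ forall y, bub b nu (x - y) <= C * bub b 1 y.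
Proof.
(* [c] is chosen so that 1 + |y|^2 <= c (nu + |x - y|^2), starting from |y|^2 <= 2 |x|^2 + 2 |x -
   y|^2. *)
move=> b0 nu0; pose c : R := 2 + (1 + 2 * enorm2 x) / nu.
have e0 := enorm2_ge0 x.
have c0 : 0 < c by rewrite ltr_pwDl// divr_ge0 ?(ltW nu0)//; lra.
exists (c `^ b); split; first exact: powR_gt0.
move=> y; apply: bub_le_scale => //; first by rewrite ltr_wpDr ?enorm2_ge0.
have h : enorm2 y <= 2 * enorm2 x + 2 * enorm2 (x - y).
  rewrite -{1}[y](subKr x); apply: le_trans (enorm2D_le _ _) _.
  by rewrite lerD2l [enorm2 (- _)](_ : _ = enorm2 (x - y))// -(enorm2C y x)  opprB.
have e1 := enorm2_ge0 (x - y).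
have h2 : (1 + 2 * enorm2 x) / nu * nu = 1 + 2 * enorm2 x by rewrite divfK// gt_eqF.
have h3 : 0 <= (1 + 2 * enorm2 x) / nu * enorm2 (x - y).
  by rewrite mulr_ge0// divr_ge0 ?(ltW nu0)//; lra.
by rewrite /c mulrDl mulrDr [_ / nu * (_ + _)]mulrDr h2; lra.
Qed.

Lemma enorm2_eq0 x : enorm2 x = 0 -> x = 0.
Proof.
move=> /eqP; rewrite psumr_eq0 => [/allP h|i _]; last exact: sqr_ge0.
apply/rowP => i; rewrite mxE; apply/eqP; rewrite -sqrf_eq0.
by have /implyP := h i (mem_index_enum i); exact.
Qed.

End kernel_bounds.

(** * From truncated to smoothed singular integrals *)

Section smoothing.
Context {R : realType} {d : nat}.
Local Notation leb := (@lebesgue_measure R).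
Local Notation mu := (lebesgue_rV R d).
Variables (b : R) (u : 'rV[R]_d -> R) (x : 'rV[R]_d).
Hypothesis b0 : 0 < b.
Hypothesis mu_ : measurable_fun [set: 'rV[R]_d] u.
Hypothesis iu : forall nu, 0 < nu ->
  mu.-integrable setT (fun y => ((u x - u y) * bub b nu (x - y))%:E).

Let Uk y := (u x - u y) * bub b 0 (x - y).

Definition Itr (eta : R) : R := \int[mu]_(y in [set y | eta < enorm (x - y)]) Uk y.

Let mUk : measurable_fun [set: 'rV[R]_d] Uk.
Proof.
by apply: measurable_funM; [exact: measurable_funB|exact: measurable_bub].
Qed.

Lemma measurable_far eta : 0 <= eta -> measurable [set y : 'rV[R]_d | eta < enorm (x - y)].
Proof.
move=> e0; rewrite (_ : [set _ | _] = (fun y => enorm2 (x - y)) @^-1` `]eta ^+ 2, +oo[).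
  rewrite -[X in measurable X]setTI.
  exact: (measurable_enorm2B x measurableT (measurable_itv _)).
by apply/seteqP; split => y /=; rewrite in_itv/= andbT lt_enorm.
Qed.

Lemma integrable_far eta : 0 < eta ->
  mu.-integrable [set y | eta < enorm (x - y)] (fun y => (Uk y)%:E).
Proof.
move=> e0; have mf := measurable_far (ltW e0); have e20 : 0 < eta ^+ 2 by exact: exprn_gt0.
apply: (le_integrable mf _ _ (integrableS measurableT mf (@subsetT _ _)
  (integrableZl measurableT (2 `^ b) (iu e20)))).
- by apply: measurable_funTS; apply/measurable_EFinP; exact: mUk.
- move=> y ey; rewrite -EFinM !abse_EFin lee_fin !normrM mulrCA.
  apply: ler_wpM2l => //.
  rewrite (ger0_norm (bub_ge0 _ _ _)) (ger0_norm (powR_ge0 _ _)) (ger0_norm (bub_ge0 _ _ _)).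
  move: ey => /=; rewrite lt_enorm ?(ltW e0)// => ey.
  apply: bub_le_scale => //; [exact: ltW|by apply: addr_gt0 => //; exact: lt_trans ey|].
  by rewrite add0r mulr_natl mulr2n lerD2r ltW.
Qed.

Let rho nu y := (enorm2 (x - y) * (nu + enorm2 (x - y)) `^ (-1)) `^ b.
Let g nu y (l : R) : R := if (0 < l) && (l < rho nu y) then 1 else 0.
Let q (l : R) := l `^ b^-1.
(** The radius at which [rho] reaches the level [l]: with q = l^(1/b) and t = |x - y|^2, t / (nu +
    t) > q means t > nu q / (1 - q). For fixed [l] it tends to 0 with [nu]. *)
Let Eta nu (l : R) : R := Num.sqrt (nu * (q l / (1 - q l))).
Let H nu (l : R) : R := if (0 < l) && (l < 1) then Itr (Eta nu l) else 0.

Let rho_ge0 nu y : 0 <= rho nu y. Proof. exact: powR_ge0. Qed.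

Let Uk_rho nu y : 0 < nu -> Uk y * rho nu y = (u x - u y) * bub b nu (x - y).
Proof.
move=> nu0; rewrite /Uk -mulrA; have t0 := enorm2_ge0 (x - y).
move: t0; rewrite le_eqVlt => /predU1P[/esym/enorm2_eq0/eqP|t0].
  by rewrite subr_eq0 => /eqP ->; rewrite subrr !mul0r.
congr (_ * _); have nt : 0 < nu + enorm2 (x - y) by exact: addr_gt0.
rewrite /rho /bub add0r powRM ?powR_ge0 ?(ltW t0)// -powRrM mulN1r mulrA.
by rewrite powRN mulVf ?mul1r// gt_eqF// powR_gt0.
Qed.

Let rho_le1 nu y : 0 < nu -> rho nu y <= 1.
Proof.
move=> nu0; have t0 := enorm2_ge0 (x - y).
have nt : 0 < nu + enorm2 (x - y) by exact: ltr_wpDr.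
have E1 : 1 `^ b = 1 :> R by rewrite powR1.
rewrite -E1 /rho; apply: ge0_ler_powR; rewrite ?nnegrE ?(ltW b0)//.
  by rewrite mulr_ge0// powR_ge0.
by rewrite (powR_inv1 (ltW nt)) ler_pdivrMr// mul1r lerDr ltW.
Qed.

Let int_g nu y : (\int[leb]_l (g nu y l)%:E = (rho nu y)%:E)%E.
Proof.
transitivity (\int[leb]_l (\1_(`]0, rho nu y[%classic : set R) l)%:E)%E.
  apply: eq_integral => l _; rewrite indicE mem_setE in_itv/= /g.
  by case: ifP.
rewrite integral_indic//= setIT lebesgue_measure_itv/= lte_fin.
case: ltP => r0; first by rewrite oppr0 adde0.
by apply: (congr1 EFin); apply: le_anti; rewrite r0 rho_ge0.
Qed.

Let q_bounds l : 0 < l < 1 -> 0 < q l < 1.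
Proof.
move=> /andP[l0 l1]; rewrite powR_gt0//=.
have E1 : 1 `^ b^-1 = 1 :> R by rewrite powR1.
by rewrite -E1; apply: gt0_ltr_powR; rewrite ?nnegrE ?invr_gt0// ltW.
Qed.

Let Eta_gt0 nu l : 0 < nu -> 0 < l < 1 -> 0 < Eta nu l.
Proof.
move=> nu0 /q_bounds/andP[q0 q1].
by rewrite sqrtr_gt0 mulr_gt0// divr_gt0// subr_gt0.
Qed.

Let rhoE nu y l : 0 < nu -> 0 < l < 1 -> (l < rho nu y) = (Eta nu l < enorm (x - y)).
Proof.
move=> nu0 l01; have /andP[q0 q1] := q_bounds l01; have /andP[l0 l1] := l01.
rewrite lt_enorm ?(ltW (Eta_gt0 nu0 l01))// sqr_sqrtr; last first.
  by rewrite mulr_ge0 ?(ltW nu0)// divr_ge0 ?(ltW q0)// subr_ge0 ltW.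
have t0 := enorm2_ge0 (x - y); set t := enorm2 (x - y) in t0 *.
have nt : 0 < nu + t by exact: ltr_wpDr.
rewrite mulrA ltr_pdivrMr ?subr_gt0//.
have El : q l `^ b = l by rewrite /q -powRrM mulVf ?gt_eqF// powRr1// ltW.
rewrite -{1}El.
rewrite /rho -/t (powR_inv1 (ltW nt)).
have tn : 0 <= t / (nu + t) by rewrite divr_ge0// ltW.
have -> : (q l `^ b < (t / (nu + t)) `^ b) = (q l < t / (nu + t)).
  apply/idP/idP; last by apply: gt0_ltr_powR; rewrite ?nnegrE// ltW.
  by apply: contraTT; rewrite -!leNgt; apply: ge0_ler_powR; rewrite ?nnegrE ?(ltW b0) ?(ltW q0).
by rewrite ltr_pdivlMr//; apply/idP/idP => ?; nra.
Qed.

Let f nu (p : 'rV[R]_d * R) : \bar R := (Uk p.1 * g nu p.1 p.2)%:E.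

Let mf nu : 0 < nu -> measurable_fun setT (f nu).
Proof.
move=> nu0; apply/measurable_EFinP; apply: measurable_funM.
  exact: (measurableT_comp mUk).
have mt : measurable_fun setT (fun p : 'rV[R]_d * R => enorm2 (x - p.1)).
  exact: measurable_enorm2_comp.
apply: measurable_fun_ifT => //; apply: measurable_and; apply: measurable_fun_ltr => //.
apply: measurable_powR_comp; apply: measurable_funM => //.
by apply: measurable_powR_comp; exact: measurable_funD.
Qed.

Let g_ge0 nu y l : 0 <= g nu y l. Proof. by rewrite /g; case: ifP. Qed.

Let mg nu y : measurable_fun [set: R] (g nu y).
Proof.
apply: measurable_fun_ifT => //; apply: measurable_and; apply: measurable_fun_ltr => //.
Qed.

Let if_ nu : 0 < nu -> (mu \x leb)%E.-integrable setT (f nu).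
Proof.
move=> nu0; apply/(integrable12ltyP mu leb (mf nu0)).
have inner y : (\int[leb]_l `|f nu (y, l)| = (`|Uk y| * rho nu y)%:E)%E.
  transitivity (\int[leb]_l (`|Uk y| * g nu y l)%:E)%E.
    by apply: eq_integral => l _; rewrite /f/= normrM (ger0_norm (g_ge0 _ _ _)).
  rewrite ge0_integralZR; last 3 first.
  - exact: normr_ge0.
  - exact: mg.
  - exact: g_ge0.
  by rewrite int_g -EFinM.
have /integrableP[_] := iu nu0; apply: le_lt_trans; apply: ge0_le_integral => //.
- by move=> y _; apply: integral_ge0.
- rewrite (_ : (fun y => _) = (fun y => (`|Uk y| * rho nu y)%:E)); last first.
    by apply/funext => y; exact: inner.
  apply/measurable_EFinP; apply: measurable_funM; first exact: measurableT_comp.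
  apply: measurable_powR_comp; apply: measurable_funM; first exact: measurable_enorm2B.
  apply: measurable_powR_comp; apply: measurable_funD => //; exact: measurable_enorm2B.
- by apply: measurableT_comp => //; case/integrableP: (iu nu0).
- move=> y _; rewrite inner -Uk_rho// abse_EFin lee_fin.
  by rewrite [leRHS]normrM (ger0_norm (rho_ge0 _ _)).
Qed.

Let H_int nu l : 0 < nu -> (\int[mu]_y f nu (y, l) = (H nu l)%:E)%E.
Proof.
move=> nu0; rewrite /H; case: ifPn => [l01|l01]; last first.
  rewrite integral0_eq// => y _; rewrite /f /g/=; case: ifPn; last by rewrite mulr0.
  move=> /andP[l0 lr]; move: l01; rewrite l0/= -leNgt => l1.
  by have := rho_le1 y nu0; rewrite leNgt (le_lt_trans l1 lr).
have E0 := Eta_gt0 nu0 l01.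
rewrite /Itr /Rintegral fineK; last first.
  exact: (integrable_fin_num (measurable_far (ltW E0)) (integrable_far E0)).
rewrite [RHS]integral_mkcond; apply: eq_integral => y _; rewrite patchE /f /g/=.
have /andP[-> _] := l01; rewrite rhoE//=.
by case: ifPn => h; [rewrite mem_set// mulr1|rewrite memNset ?mulr0//; exact/negP].
Qed.

Let Jsm_H nu : 0 < nu -> (Jsm b u x nu)%:E = (\int[leb]_l (H nu l)%:E)%E.
Proof.
move=> nu0; rewrite /Jsm /Rintegral fineK; last first.
  exact: (integrable_fin_num measurableT (iu nu0)).
transitivity (\int[mu]_y \int[leb]_l f nu (y, l))%E.
  apply: eq_integral => y _; rewrite /f/= -Uk_rho//.
  transitivity ((Uk y)%:E * (rho nu y)%:E)%E; first by rewrite -EFinM.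
  rewrite -(int_g nu y) -integralZl//.
  apply: ge0_integrable; [exact: mg|exact: g_ge0|].
  by have := ltry (rho nu y); rewrite -int_g.
rewrite (Fubini (if_ nu0)); apply: eq_integral => l _; exact: H_int.
Qed.

(* The ratio [rho] of the smoothed and the singular kernel is a function of |x - y|
   with values in [0, 1], so by its layer-cake formula [Jsm] is an average of
   truncated integrals [Itr]. *)
Lemma cvg_Jsm_of_Itr (L : R) : Itr e @[e --> 0^'+] --> L ->
  Jsm b u x n.+1%:R^-1 @[n --> \oo] --> L.
Proof.
move=> IL.
have nu0 n : 0 < n.+1%:R^-1 :> R by [].
(* The dominating constant: below [e0] the truncated integrals lie within 1 of [L], and from [e0] on
   they are bounded by the absolute integral outside radius e0 / 2. *)
have [M HM] : exists M, forall e, 0 < e -> `|Itr e| <= M.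
  have [e0 /= e00 He] : exists2 e0 : R, 0 < e0 & forall e, 0 < e -> e < e0 -> `|Itr e - L| < 1.
    have /cvgrPdist_lt /(_ 1 ltr01) [e0 /= e00 He] := IL.
    exists e0 => // e e1 e2; rewrite distrC; apply: He => //=.
    by rewrite sub0r normrN gtr0_norm.
  pose e1 := e0 / 2; have e10 : 0 < e1 by rewrite divr_gt0.
  pose M1 : R := \int[mu]_(y in [set y | e1 < enorm (x - y)]) `|Uk y|.
  have i1 := integrable_norm (integrable_far e10).
  exists (Num.max (`|L| + 1) M1) => e ep; rewrite le_max.
  have [ee|ee] := ltP e e0; apply/orP; [left|right].
    have := ler_normD L (Itr e - L); rewrite addrC subrK => /le_trans; apply.
    by rewrite lerD2l; apply/ltW/He.
  have ee1 : e1 <= e by apply: le_trans ee; rewrite /e1; lra.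
  have me := measurable_far (ltW ep); have me1 := measurable_far (ltW e10).
  apply: (@le_trans _ _ (\int[mu]_(y in [set y | e < enorm (x - y)]) `|Uk y|)).
    by apply: le_normr_Rintegral => //; exact: integrable_far.
  rewrite /M1 -lee_fin /Rintegral !fineK; last 2 first.
  - exact: (integrable_fin_num me1 i1).
  - exact: (integrable_fin_num me (integrable_norm (integrable_far ep))).
  apply: ge0_subset_integral => //.
  - by apply: measurable_funTS; apply/measurable_EFinP; apply: measurableT_comp => //; exact: mUk.
  - by move=> y /=; apply: le_lt_trans.
pose c01 (l : R) : R := \1_(`]0, 1[%classic : set R) l.
have c01E l : c01 l = if (0 < l) && (l < 1) then 1 else 0.
  by rewrite /c01 indicE mem_setE in_itv/=; case: ifP.
have int01 (c : R) : (\int[leb]_l ((c * c01 l)%:E) = c%:E)%E.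
  rewrite -(_ : \int[leb]_(l in `]0%R, 1%R[) c%:E = c%:E)%E; last first.
    by rewrite integral_cst//= lebesgue_measure_itv/= lte_fin ltr01 oppr0 adde0 mule1.
  rewrite [RHS]integral_mkcond; apply: eq_integral => l _; rewrite patchE /c01 indicE.
  by case: ifP => _; rewrite ?mulr1// mulr0.
have M0 : 0 <= M by apply: le_trans (HM 1 ltr01); exact: normr_ge0.
have cv : (\int[leb]_l (H n.+1%:R^-1 l)%:E)%E @[n --> \oo] -->
    (\int[leb]_l (L * c01 l)%:E)%E.
  apply: (@dominated_cvg _ (measurableTypeR R) R leb setT measurableT
    (fun n l => (H n.+1%:R^-1 l)%:E) (fun l => (L * c01 l)%:E) (fun l => (M * c01 l)%:E)).
  - move=> n; have := measurable_fubini_G (if_ (nu0 n)).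
    congr (measurable_fun _ _); apply/funext => l; exact: H_int.
  - move=> l _; apply/fine_cvgP; split; first by apply: nearW.
    rewrite /= c01E /H; case: ifPn => l01; last first.
      by rewrite mulr0; exact: cvg_cst.
    rewrite mulr1; have /andP[q0 q1] := q_bounds l01.
    move/cvg_at_rightP : IL; apply; split; first by move=> n; exact: Eta_gt0.
    rewrite -sqrtr0; apply: (@continuous_cvg _ _ _ _ _ _ (@Num.sqrt R)).
      exact: sqrt_continuous.
    rewrite -(mul0r (q l / (1 - q l))).
    by apply: cvgM; [exact: cvg_harmonic|exact: cvg_cst].
  - by [].
  - apply: ge0_integrable.
    + by apply: measurable_funM => //; exact: measurable_indic.
    + by move=> l; rewrite mulr_ge0// c01E; case: ifP.
    + by have := ltry M; rewrite -{1}int01.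
  - move=> n l _; rewrite abse_EFin lee_fin /H c01E; case: ifPn => l01.
      by rewrite mulr1; apply: HM; exact: Eta_gt0.
    by rewrite normr0 mulr0.
move: cv; rewrite int01; under eq_fun do rewrite -Jsm_H//.
by move=> /fine_cvgP[_].
Qed.

End smoothing.

(** * Euclidean norm, sup norm and compactness *)

Section norms.
Context {R : realType} {d : nat}.
Implicit Types x y z : 'rV[R]_d.

Lemma coord_le_enorm x i : `|x ord0 i| <= enorm x.
Proof.
rewrite le_enorm// /enorm2 (bigD1 i)//= real_normK ?num_real// lerDl.
by apply: sumr_ge0 => j _; exact: sqr_ge0.
Qed.

Lemma norm_le_enorm x : `|x| <= enorm x.
Proof.
rewrite /Num.norm/= mx_normrE; apply: bigmax_le => [|[i j] _ /=]; first exact: enorm_ge0.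
by rewrite (ord1 i); exact: coord_le_enorm.
Qed.

Lemma coord_le_norm x i : `|x ord0 i| <= `|x|.
Proof.
rewrite [leRHS]/Num.norm/= mx_normrE.
exact: (@le_bigmax _ _ _ 0 (fun ij : 'I_1 * 'I_d => `|x ij.1 ij.2|) (ord0, i)).
Qed.

Lemma enorm_le_norm x : enorm x <= d%:R * `|x|.
Proof.
rewrite -[leRHS]ger0_norm ?mulr_ge0// -sqrtr_sqr ler_wsqrtr//.
have h : enorm2 x <= \sum_(i < d) `|x| ^+ 2.
  apply: ler_sum => i _; rewrite -[leLHS]real_normK ?num_real//.
  by apply: lerXn2r; rewrite ?nnegrE// coord_le_norm.
apply: le_trans h _; rewrite sumr_const card_ord exprMn -[leLHS]mulr_natl.
apply: ler_wpM2r; first exact: sqr_ge0.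
by rewrite -natrX ler_nat; case: (d) => // n; rewrite -[leqLHS]muln1 leq_mul2l.
Qed.

Lemma continuous_enorm2B y : continuous (fun z => enorm2 (z - y)).
Proof.
rewrite (_ : (fun _ => _) = fun x => \sum_(i < d) (x ord0 i - y ord0 i) ^+ 2); last first.
  by apply/funext => z; apply: eq_bigr => i _; rewrite !mxE.
apply: continuous_big => [|i _ x]; first exact: add_continuous.
have c : (fun z : 'rV[R]_d => z ord0 i - y ord0 i) @ x --> x ord0 i - y ord0 i.
  apply: (@cvgB _ R _ _ _ (fun z : 'rV[R]_d => z ord0 i) (cst (y ord0 i))).
    exact: nbhs_filter.
    exact: (@coord_continuous R 1 d ord0 i x).
  exact: (@cvg_cst _ _ _ _ (nbhs_filter x)).
exact: (cvg_comp _ (fun t : R => t ^+ 2) c (@exprn_continuous _ 2 _)).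
Qed.

Lemma continuous_enorm2 : continuous (@enorm2 R d).
Proof.
rewrite (_ : @enorm2 R d = fun x => enorm2 (x - 0)); first exact: continuous_enorm2B.
by apply/funext => x; rewrite subr0.
Qed.

Lemma continuous_enorm : continuous (@enorm R d).
Proof.
move=> x.
have -> : @enorm R d = Num.sqrt \o @enorm2 R d by [].
by apply: continuous_comp; [exact: continuous_enorm2|exact: sqrt_continuous].
Qed.

Lemma closed_enorm_itv (i : interval R) : closed [set` i] ->
  closed [set x : 'rV[R]_d | enorm x \in i].
Proof. by move=> ci; apply: (@preimage_closed _ _ (@enorm R d) [set` i]) => // x _; exact: continuous_enorm. Qed.

Lemma compact_enorm_itv (i : interval R) (r : R) : closed [set` i] ->
  (forall t, t \in i -> t <= r) -> compact [set x : 'rV[R]_d | enorm x \in i].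
Proof.
move=> ci ir; apply: bounded_closed_compact; last exact: closed_enorm_itv.
exists r; split; first exact: num_real.
move=> M rM x /= /ir xr; apply: le_trans (norm_le_enorm x) _.
by apply: le_trans xr _; exact: ltW.
Qed.

Lemma continuous_bub (m mu : R) y : 0 < mu -> continuous (fun x => bub m mu (x - y)).
Proof.
move=> mu0 x; rewrite /bub.
have c1 : (fun z => mu + enorm2 (z - y)) @ x --> mu + enorm2 (x - y).
  apply: (@cvgD _ R _ _ _ (cst mu) (fun z => enorm2 (z - y))); last exact: continuous_enorm2B.
    exact: nbhs_filter.
  exact: (@cvg_cst _ _ _ _ (nbhs_filter x)).
have c2 : {for mu + enorm2 (x - y), continuous (fun t : R => t `^ (- m))}.
  apply/differentiable_continuous/derivable1_diffP; apply: derivable_powR.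
  by rewrite in_itv/= andbT ltr_wpDr ?enorm2_ge0.
exact: (cvg_comp _ (fun t : R => t `^ (- m)) c1 c2).
Qed.

End norms.

(** * Values of the operator as limits, and the comparison principle *)

Section Jlim.
Context {R : realType} {d : nat}.
Local Notation mu := (lebesgue_rV R d).
Implicit Types (u w : 'rV[R]_d -> R) (x y : 'rV[R]_d).

Definition Jint b w x := forall nu : R, 0 < nu ->
  mu.-integrable setT (fun y => ((w x - w y) * bub b nu (x - y))%:E).

(** The value at [x] of the operator without its normalizing constant. It is a relation that
    includes integrability, because [Rintegral] is additive only on integrable functions; this makes
    it linear in [w]. *)
Definition Jlim b w x (l : R) := Jint b w x /\ Jsm b w x n.+1%:R^-1 @[n --> \oo] --> l.

Lemma JlimD b w1 w2 x l1 l2 : Jlim b w1 x l1 -> Jlim b w2 x l2 ->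
  Jlim b (w1 \+ w2) x (l1 + l2).
Proof.
move=> [i1 c1] [i2 c2].
have E nu z : ((w1 \+ w2) x - (w1 \+ w2) z) * bub b nu (x - z) =
    (w1 x - w1 z) * bub b nu (x - z) + (w2 x - w2 z) * bub b nu (x - z).
  by rewrite -mulrDl/=; congr (_ * _); ring.
split=> [nu nu0|].
  apply: eq_integrable (integrableD measurableT (i1 _ nu0) (i2 _ nu0)) => // z _.
  by rewrite E EFinD.
rewrite (_ : (fun n => _) = (fun n => Jsm b w1 x n.+1%:R^-1 + Jsm b w2 x n.+1%:R^-1)).
  exact: cvgD.
apply/funext => n; have nu0 : 0 < n.+1%:R^-1 :> R by [].
rewrite /Jsm -RintegralD//; [|exact: i1|exact: i2].
by apply: eq_Rintegral => z _; rewrite E.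
Qed.

Lemma JlimZ b c w x l : Jlim b w x l -> Jlim b (fun z => c * w z) x (c * l).
Proof.
move=> [i1 c1].
have E nu z : (c * w x - c * w z) * bub b nu (x - z) = c * ((w x - w z) * bub b nu (x - z)).
  by rewrite -mulrBr mulrA.
split=> [nu nu0|].
  apply: eq_integrable (integrableZl measurableT c (i1 _ nu0)) => // z _.
  by rewrite E EFinM.
rewrite (_ : (fun n => _) = (fun n => c * Jsm b w x n.+1%:R^-1)).
  by apply: cvgM => //; exact: cvg_cst.
apply/funext => n; have nu0 : 0 < n.+1%:R^-1 :> R by [].
rewrite /Jsm -RintegralZl//; last exact: i1.
by apply: eq_Rintegral => z _; rewrite E.
Qed.

Lemma Jlim0 b x : Jlim b (fun=> 0) x 0.
Proof.
split=> [nu nu0|].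
  rewrite (_ : (fun y => _) = cst 0%E); first exact: integrable0.
  by apply/funext => z; rewrite subrr mul0r.
rewrite (_ : (fun n => _) = (fun=> 0)); first exact: cvg_cst.
apply/funext => n; rewrite /Jsm; under eq_Rintegral do rewrite subrr mul0r.
by rewrite Rintegral_cst// mul0r.
Qed.

Lemma Jlim_sum b (I : Type) (r : seq I) (w : I -> 'rV[R]_d -> R) x (l : I -> R) :
  (forall i, Jlim b (w i) x (l i)) ->
  Jlim b (fun z => \sum_(i <- r) w i z) x (\sum_(i <- r) l i).
Proof.
move=> h; elim: r => [|i r IH].
  rewrite big_nil (_ : (fun z => _) = (fun=> 0)); first exact: Jlim0.
  by apply/funext => z; rewrite big_nil.
rewrite big_cons (_ : (fun z => _) = (w i \+ (fun z => \sum_(i <- r) w i z))).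
  exact: JlimD.
by apply/funext => z; rewrite big_cons.
Qed.

(** The hypothesis says that u - w is minimal at [x], and the smoothed kernel is nonnegative, so the
    inequality already holds for each [nu]. *)
Lemma Jlim_le b u w x lu lw : Jlim b u x lu -> Jlim b w x lw ->
  (forall y, u x - u y <= w x - w y) -> lu <= lw.
Proof.
move=> [iu cu] [iw cw] h.
apply: (ler_cvg_to cu cw); apply: nearW => n.
have nu0 : 0 < n.+1%:R^-1 :> R by [].
apply: le_Rintegral => //; [exact: iu|exact: iw|].
by move=> y _; apply: ler_wpM2r => //; exact: bub_ge0.
Qed.

(** If w > u at [x1], the decay of [w] confines the infimum of u - w to a compact ball, where it is
    attained at some [c] and is negative. On B this is excluded by w <= 0 <= u, so [c] lies outside,
    and minimality at [c] contradicts lw < lu. *)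
Lemma comparison b u w : (forall x, 0 <= u x) -> continuous u -> continuous w ->
  (forall x, enorm x <= 1 -> w x <= 0) ->
  (forall e, 0 < e -> exists r : R, forall x, r < enorm x -> w x <= e) ->
  (forall x, 1 < enorm x -> w x <= u x \/
     exists lw lu, [/\ Jlim b w x lw, Jlim b u x lu & lw < lu]) ->
  forall x, w x <= u x.
Proof.
move=> u0 cu cw wB winf h x1; rewrite leNgt; apply/negP => lt1.
pose e := w x1 - u x1; have e0 : 0 < e by rewrite subr_gt0.
have e20 : 0 < e / 2 by rewrite divr_gt0.
have [r hr] := winf (e / 2) e20.
pose A := [set x : 'rV[R]_d | enorm x \in `]-oo, Num.max r (enorm x1)]].
have cA : compact A.
  apply: (@compact_enorm_itv _ _ _ (Num.max r (enorm x1))); last by move=> t; rewrite in_itv.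
  by rewrite set_itvE; exact: closed_le.
have Ax1 : A x1 by rewrite /A/= in_itv/= le_max lexx orbT.
have cuw : {within A, continuous (u \- w)}.
  by apply: continuous_subspaceT => z; exact: (@continuousB _ R _ u w z (cu z) (cw z)).
have [c Ac hc] := EVT_min_rV (ex_intro _ x1 Ax1) cA cuw.
have ce : u c - w c <= - e.
  by apply: le_trans (hc x1 _) _; [rewrite inE|rewrite /= /e opprB].
have glob y : u c - w c <= u y - w y.
  have [yr|yr] := leP (enorm y) (Num.max r (enorm x1)).
    by apply: hc; rewrite inE /A/= in_itv.
  have ry : r < enorm y by apply: le_lt_trans yr; rewrite le_max lexx.
  by apply: le_trans ce _; have := hr _ ry; have := u0 y; rewrite /e in e0 *; lra.
have cB : 1 < enorm c.
  by rewrite ltNge; apply/negP => /wB wc; have := u0 c; lra.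
have [wu|[lw [lu [jw ju]]]] := h c cB; first by lra.
by rewrite ltNge (Jlim_le ju jw)// => y; have := glob y; lra.
Qed.

End Jlim.

(** * Barriers made of two bubbles *)

Section barrier.
Context {R : realType}.
Variables (d : nat) (a : R).
Hypotheses (a0 : 0 < a) (a1 : a < 1) (aD : a < d%:R / 2).
Implicit Types (x y z : 'rV[R]_d) (u w : 'rV[R]_d -> R).
Local Notation D := (d%:R / 2 : R).
Local Notation b := (D + a).
Local Notation m := (D - a).

Definition Kbub : R := pi `^ D * Gamma D / (Gamma b * Gamma m) * Theta a D.

Let D0 : 0 < D. Proof. exact: lt_trans aD. Qed.
Let b0 : 0 < b. Proof. exact: addr_gt0. Qed.
Let m0 : 0 < m. Proof. by rewrite subr_gt0. Qed.

Lemma Kbub_gt0 : 0 < Kbub.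
Proof.
apply: mulr_gt0; last exact: Theta_gt0.
apply: divr_gt0; apply: mulr_gt0; [|exact: Gamma_gt0|exact: Gamma_gt0|exact: Gamma_gt0].
by apply: powR_gt0; exact: pi_gt0.
Qed.

Lemma Jlim_bub (mu : R) x y : 0 < mu ->
  Jlim b (fun z => bub m mu (z - y)) x (Kbub * (mu `^ a * bub b mu (x - y))).
Proof.
move=> mu0; split; last exact: cvg_Jsm_bub.
move=> nu nu0.
have i1 := integrableZl measurableT (bub m mu (x - y)) (integrable_bub x a0 nu0).
have i2 := integrable_bub2 x y a0 nu0 (ltW m0) mu0.
apply: eq_integrable (integrableB measurableT i1 i2) => // z _.
by rewrite mulrBl EFinB EFinM.
Qed.

(** [mu1], [beta] and [kap] come from the sign condition away from the centre. Since the operator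
    brings out mu^a, mu1^a = 4 turns the weight -1/2 of the wide bubble into -2. The image is then
    nonpositive once mu1 tau + t <= 2^(1/b) (tau + t), with t the squared distance to the centre.
    For t >= l^2 and tau = kap l^2 it suffices that kap <= (beta - 1) / mu1; the cap by 1 keeps tau
    <= l^2. *)
Let mu1 : R := 4 `^ a^-1.
Let beta : R := 2 `^ b^-1.
Let kap : R := Num.min 1 ((beta - 1) / mu1).

Let mu1_gt0 : 0 < mu1. Proof. exact: powR_gt0. Qed.

Let beta_gt1 : 1 < beta.
Proof.
have E1 : 1 `^ b^-1 = 1 :> R by rewrite powR1.
by rewrite -E1; apply: gt0_ltr_powR; rewrite ?nnegrE ?invr_gt0//; lra.
Qed.

Let kap_gt0 : 0 < kap.
Proof. by rewrite lt_min ltr01 divr_gt0// subr_gt0. Qed.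

Let tau (l : R) := kap * l ^+ 2.
Let phi (l : R) y x := bub m (tau l) (x - y) + (- 2^-1) * bub m (mu1 * tau l) (x - y).

Let tau_gt0 l : 0 < l -> 0 < tau l.
Proof. by move=> l0; rewrite mulr_gt0// exprn_gt0. Qed.

Let mu1a : mu1 `^ a = 4.
Proof. by rewrite /mu1 -powRrM mulVf ?gt_eqF// powRr1. Qed.

Let Lphi l y x := Kbub * ((tau l) `^ a * (bub b (tau l) (x - y) - 2 * bub b (mu1 * tau l) (x - y))).

Let Jlim_phi l y x : 0 < l -> Jlim b (phi l y) x (Lphi l y x).
Proof.
move=> l0; have t0 := tau_gt0 l0.
have mt0 : 0 < mu1 * tau l by exact: mulr_gt0.
have := JlimD (Jlim_bub x y t0) (JlimZ (- 2^-1) (Jlim_bub x y mt0)).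
congr (Jlim _ _ _ _).
rewrite (powRM _ (ltW mu1_gt0) (ltW t0)) mu1a /Lphi.
set X := Kbub; set Y := tau l `^ a; set B1 := bub _ _ _; set B2 := bub _ _ _.
by field.
Qed.

Let bub_le1 (nu t : R) z : 0 < t -> t <= nu + enorm2 z -> bub m nu z <= t `^ (- m).
Proof.
move=> t0 h; have n0 := lt_le_trans t0 h.
rewrite /bub !powRN lef_pV2 ?posrE ?powR_gt0//.
by apply: ge0_ler_powR; rewrite ?nnegrE ?(ltW m0) ?(ltW t0) ?(ltW n0).
Qed.

Let bub_ge1 (nu t : R) z : 0 < nu -> nu + enorm2 z <= t -> t `^ (- m) <= bub m nu z.
Proof.
move=> nu0 h; have n0 : 0 < nu + enorm2 z by rewrite ltr_wpDr ?enorm2_ge0.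
have t0 := lt_le_trans n0 h.
rewrite /bub !powRN lef_pV2 ?posrE ?powR_gt0//.
by apply: ge0_ler_powR; rewrite ?nnegrE ?(ltW m0) ?(ltW t0) ?(ltW n0).
Qed.

Let phi_bounds l y x : 0 < l ->
  2^-1 * bub m (tau l) (x - y) <= phi l y x <= bub m (tau l) (x - y).
Proof.
move=> l0; have t0 := tau_gt0 l0.
have h1 : bub m (mu1 * tau l) (x - y) <= bub m (tau l) (x - y).
  apply: bub_le1; first by rewrite ltr_wpDr ?enorm2_ge0.
  rewrite lerD2r ler_peMl ?(ltW t0)//.
  have E1 : 1 `^ a^-1 = 1 :> R by rewrite powR1.
  by rewrite -E1; apply: ge0_ler_powR; rewrite ?nnegrE ?invr_ge0 ?(ltW a0)//; lra.
have h2 := bub_ge0 m (mu1 * tau l) (x - y).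
by rewrite /phi; lra.
Qed.

Let betab : beta `^ b = 2.
Proof. by rewrite /beta -powRrM mulVf ?gt_eqF// powRr1. Qed.

(* The second, wider bubble makes the operator nonpositive away from [y]. *)
Let Lphi_far l y x : 0 < l -> l <= enorm (x - y) -> Lphi l y x <= 0.
Proof.
move=> l0 lx; have t0 := tau_gt0 l0.
rewrite /Lphi pmulr_rle0 ?Kbub_gt0// pmulr_rle0 ?powR_gt0// subr_le0.
suff : bub b (tau l) (x - y) <= beta `^ b * bub b (mu1 * tau l) (x - y) by rewrite betab.
have mt0 : 0 < mu1 * tau l by exact: mulr_gt0.
have e0 := enorm2_ge0 (x - y).
apply: bub_le_scale; [exact: ltW|exact: lt_trans beta_gt1|by rewrite ltr_wpDr|].
have h1 : mu1 * tau l <= (beta - 1) * enorm2 (x - y).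
  move: lx; rewrite le_enorm ?(ltW l0)// => lx.
  apply: (@le_trans _ _ ((beta - 1) * l ^+ 2)).
    rewrite /tau mulrA ler_pM2r ?exprn_gt0// mulrC -ler_pdivlMr//.
    by rewrite /kap ge_min lexx orbT.
  by rewrite ler_pM2l ?subr_gt0.
have h2 : 0 <= beta * tau l by rewrite mulr_ge0 ?(ltW t0)// ltW// (lt_trans ltr01).
by rewrite mulrDr; lra.
Qed.

Let Lphi_le l y x : 0 < l -> Lphi l y x <= Kbub * (tau l) `^ (- D).
Proof.
move=> l0; have t0 := tau_gt0 l0; rewrite /Lphi ler_pM2l ?Kbub_gt0//.
have h2 := bub_ge0 b (mu1 * tau l) (x - y).
have h1 : bub b (tau l) (x - y) <= (tau l) `^ (- b) by apply: bub_le => //; exact: ltW.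
apply: (@le_trans _ _ (tau l `^ a * (tau l) `^ (- b))).
  by rewrite ler_pM2l ?powR_gt0//; lra.
by rewrite -(powR_addE t0 erefl) opprD addrC -addrA addNr addr0.
Qed.

(** Normalizes the barrier: s0 times the bound Kbub (kap l^2)^(-D) equals (l^2)^(-D) = l^(-d). *)
Let s0 : R := kap `^ D / Kbub.

Let s0_gt0 : 0 < s0. Proof. by rewrite divr_gt0 ?powR_gt0 ?Kbub_gt0. Qed.

Let kap_le1 : kap <= 1. Proof. by rewrite /kap ge_min lexx. Qed.

Let tau_le l : tau l <= l ^+ 2.
Proof. by rewrite ler_piMl// sqr_ge0. Qed.

Let Lphi_ind l y x : 0 < l ->
  s0 * Lphi l y x <= (l ^+ 2) `^ (- D) * (if enorm (x - y) < l then 1 else 0).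
Proof.
move=> l0; case: ltP => [_|lx]; last first.
  by rewrite mulr0 pmulr_rle0// Lphi_far.
rewrite mulr1; apply: (@le_trans _ _ (s0 * (Kbub * (tau l) `^ (- D)))).
  by rewrite ler_pM2l// Lphi_le.
rewrite /tau powRM ?(ltW kap_gt0) ?sqr_ge0// /s0 powRN.
rewrite le_eqVlt; apply/orP; left; apply/eqP.
have kn : kap `^ D != 0 by rewrite gt_eqF// powR_gt0.
have Kn : Kbub != 0 by rewrite gt_eqF// Kbub_gt0.
by move: (kap `^ D) kn Kbub Kn => p pn q qn; field; rewrite pn qn.
Qed.

(** For |x| and L at least [R0], the bubble subtracted at the origin costs at most half of the
    barrier sum. This amounts to 9 * 4^(1/m) (|x| + L)^2 <= L^2 |x|^2 / 128, which follows from
    [R0_sq] and R0 (|x| + L) <= 2 L |x|. *)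
Let R0 : R := 8 + 9 * (32 * (4 `^ m^-1)).

Let R0_ge8 : 8 <= R0.
Proof. by have := powR_ge0 (4 : R) m^-1; rewrite /R0; lra. Qed.

Let R0_sq : 9 * 4 `^ m^-1 <= R0 ^+ 2 / (8 * (8 * 8)).
Proof.
have h := powR_ge0 (4 : R) m^-1; rewrite /R0.
by move: (4 `^ m^-1) h => p p0; nra.
Qed.

Section one_barrier.
Variables (I : finType) (A : I -> R) (y : I -> 'rV[R]_d) (L l : R).
Hypotheses (RL : R0 <= L) (l0 : 0 < l) (lL : l <= L) (A0 : forall i, 0 <= A i).
Hypothesis yL : forall i, L ^+ 2 / 16 <= enorm2 (y i) <= 4 * L ^+ 2.

Let SA := \sum_i A i.
(** The size of the correction that makes [w] nonpositive on B: there |x - y_i|^2 >= L^2 / 64, while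
    the bubble at the origin is at least 2^(-m). *)
Let M : R := s0 * SA * (L ^+ 2 / 64) `^ (- m) * 2 `^ m.
Let w x := \sum_i (s0 * A i) * phi l (y i) x + (- M) * bub m 1 x.

Let SA0 : 0 <= SA. Proof. exact: sumr_ge0. Qed.

Let L8 : 8 <= L. Proof. exact: le_trans RL. Qed.

Let M0 : 0 <= M.
Proof.
rewrite /M -2!mulrA; apply: mulr_ge0; first exact: (ltW s0_gt0).
apply: mulr_ge0; first exact: SA0.
by apply: mulr_ge0; exact: powR_ge0.
Qed.

Let w_sum_le x t : 0 < t -> (forall i, t <= enorm2 (x - y i)) ->
  \sum_i (s0 * A i) * phi l (y i) x <= s0 * SA * t `^ (- m).
Proof.
move=> t0 h; rewrite /SA mulr_sumr mulr_suml; apply: ler_sum => i _.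
apply: ler_wpM2l; first by rewrite mulr_ge0// ltW.
have /andP[_ /le_trans] := phi_bounds (y i) x l0; apply.
by apply: bub_le1 => //; rewrite ler_wpDl// ltW// tau_gt0.
Qed.

Let continuous_w : continuous w.
Proof.
have cb (c : R) (mu : R) z : 0 < mu -> continuous (fun x => c * bub m mu (x - z)).
  move=> mu0 x.
  have c2 : {for x, continuous (fun x => bub m mu (x - z))} by exact: continuous_bub.
  have c1 : {for x, continuous (cst c : 'rV[R]_d -> R)} by exact: cst_continuous.
  exact: (continuousM c1 c2).
rewrite (_ : w = (fun x => \sum_i (s0 * A i * bub m (tau l) (x - y i)
   + s0 * A i * - 2^-1 * bub m (mu1 * tau l) (x - y i)) + (- M) * bub m 1 (x - 0))).
  have c1 i : continuous (fun x => s0 * A i * bub m (tau l) (x - y i)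
     + s0 * A i * - 2^-1 * bub m (mu1 * tau l) (x - y i)).
    have t0 := tau_gt0 l0; have mt0 := mulr_gt0 mu1_gt0 t0; move=> x.
    have d1 : {for x, continuous (fun x => s0 * A i * bub m (tau l) (x - y i))} by exact: cb.
    have d2 : {for x, continuous (fun x => s0 * A i * - 2^-1 * bub m (mu1 * tau l) (x - y i))}.
      exact: cb.
    exact: (continuousD d1 d2).
  move=> x.
  have d1 : {for x, continuous (fun x => \sum_i (s0 * A i * bub m (tau l) (x - y i)
     + s0 * A i * - 2^-1 * bub m (mu1 * tau l) (x - y i)))}.
    by apply: continuous_big => [|i _]; [exact: add_continuous|exact: c1].
  have d2 : {for x, continuous (fun x => (- M) * bub m 1 (x - 0))} by exact: cb.
  exact: (continuousD d1 d2).
apply/funext => x; rewrite /w subr0; congr (_ + _); apply: eq_bigr => i _.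
by rewrite /phi mulrDr mulrA.
Qed.

Let w_in x : enorm x <= 1 -> w x <= 0.
Proof.
move=> x1; have e1 : enorm2 x <= 1.
  by rewrite -sqr_enorm -[leRHS](expr1n _ 2) lerXn2r ?nnegrE ?enorm_ge0.
have L2 : 64 <= L ^+ 2 by have := L8; nra.
have t0 : 0 < L ^+ 2 / 64 by lra.
rewrite /w mulNr subr_le0; apply: (le_trans (w_sum_le (x := x) t0 _)).
  move=> i; have /andP[h1 _] := yL i.
  have := enorm2D_le x (y i - x); rewrite addrC subrK -enorm2C => h2; lra.
rewrite /M -[leRHS]mulrA; apply: ler_peMr.
  by apply: mulr_ge0; [apply: mulr_ge0; [exact: (ltW s0_gt0)|exact: SA0]|exact: powR_ge0].
have h : 2 `^ (- m) <= bub m 1 x by apply: bub_ge1 => //; lra.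
rewrite -(@ler_pM2l _ (2 `^ (- m))) ?powR_gt0// mulr1 mulrA.
have two0 : 0 < 2 :> R by [].
by rewrite -(powR_addE two0 erefl) addNr powRr0 mul1r.
Qed.

Let w_lim e : 0 < e -> exists r : R, forall x, r < enorm x -> w x <= e.
Proof.
move=> e0; pose t0 := (e / (s0 * SA + 1)) `^ (- m^-1).
have sS : 0 <= s0 * SA by rewrite mulr_ge0// ltW.
have sS1 : 0 < s0 * SA + 1 by rewrite ltr_wpDl.
have t00 : 0 < t0 by rewrite powR_gt0// divr_gt0.
(* Beyond this radius |x - y_i|^2 >= |x|^2 / 2 - |y_i|^2 >= t0, and [t0] makes the sum of bubbles at
   most [e]. The summand 1 gives |x| <= |x|^2. *)
exists (1 + 2 * t0 + 8 * L ^+ 2) => x hx.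
have L2 := sqr_ge0 L.
have hx2 : 2 * t0 + 8 * L ^+ 2 <= enorm2 x.
  rewrite -sqr_enorm; have := enorm_ge0 x; nra.
apply: (@le_trans _ _ (s0 * SA * t0 `^ (- m))); last first.
  rewrite /t0 -powRrM mulrNN mulVf ?gt_eqF// powRr1 ?divr_ge0 ?(ltW e0) ?(ltW sS1)//.
  rewrite mulrA ler_pdivrMr// mulrC ler_pM2l//; lra.
apply: (@le_trans _ _ (\sum_i (s0 * A i) * phi l (y i) x)).
  by rewrite /w gerDl mulNr oppr_le0 mulr_ge0// bub_ge0.
apply: w_sum_le => // i; have /andP[_ h1] := yL i.
have := enorm2D_le (x - y i) (y i); rewrite subrK; lra.
Qed.

Let w_lower x : R0 <= enorm x ->
  s0 / 4 * SA * (9 * (enorm x + L) ^+ 2) `^ (- m) <= w x.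
Proof.
move=> Rx; set r := enorm x; set T := (9 * (r + L) ^+ 2).
have r0 : 0 <= r by exact: enorm_ge0.
have T0 : 0 < T by rewrite /T; have := L8; nra.
have er : enorm2 x = r ^+ 2 by rewrite sqr_enorm.
(* At least half of each narrow bubble survives, and tau + |x - y_i|^2 <= L^2 + 2 |x|^2 + 8 L^2 is
   below T = 9 (|x| + L)^2. *)
have h1 : s0 / 2 * SA * T `^ (- m) <= \sum_i (s0 * A i) * phi l (y i) x.
  rewrite /SA mulr_sumr mulr_suml; apply: ler_sum => i _.
  have /andP[hp _] := phi_bounds (y i) x l0.
  have sA : 0 <= s0 * A i by rewrite mulr_ge0// ltW.
  apply: le_trans (ler_wpM2l sA hp).
  rewrite mulrA (_ : s0 * A i * 2^-1 = s0 / 2 * A i); last by ring.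
  apply: ler_wpM2l; first by rewrite mulr_ge0// divr_ge0// ltW.
  apply: bub_ge1; first exact: tau_gt0.
  have /andP[_ hy] := yL i.
  have h := enorm2D_le x (- y i).
  have en : enorm2 (- y i) = enorm2 (y i) by rewrite -{1}[y i]subr0 opprB enorm2C subr0.
  rewrite en in h.
  have l2 : tau l <= L ^+ 2.
    by apply: le_trans (tau_le l) _; rewrite lerXn2r ?nnegrE ?(ltW l0)// (le_trans _ L8).
  have rL : 0 <= r * L by rewrite mulr_ge0// (le_trans _ L8).
  have := sqr_ge0 r; rewrite /T sqrrD -er; have := sqr_ge0 r; rewrite -er.
  rewrite -mulr_natr; lra.
have h2 : M * bub m 1 x <= s0 / 4 * SA * T `^ (- m).
  rewrite /M -2!mulrA (_ : s0 / 4 * SA * T `^ (- m) = s0 * SA * (4^-1 * T `^ (- m))); last by ring.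
  apply: ler_wpM2l; first by rewrite mulr_ge0// ltW.
  have L20 : 0 < L ^+ 2 / 64 by have := L8; nra.
  have -> : (4^-1 : R) = (4 `^ m^-1) `^ (- m).
    by rewrite -powRrM mulrN mulVf ?gt_eqF// powR_inv1.
  have f0 : 0 < 4 `^ m^-1 :> R by rewrite powR_gt0.
  have -> : (2 : R) `^ m = (2^-1) `^ (- m).
    have inv (t e : R) : 0 < t -> t^-1 `^ (- e) = t `^ e.
      by move=> t0; rewrite -(powR_inv1 (ltW t0)) -powRrM mulN1r opprK.
    by rewrite inv.
  have e1 := enorm2_ge0 x.
  have pM (t e : R) : 0 <= t -> 0 <= e -> t `^ (- m) * e `^ (- m) = (t * e) `^ (- m).
    by move=> t0 e0; rewrite powRM.
  have anti (t e : R) : 0 < e -> e <= t -> t `^ (- m) <= e `^ (- m).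
    move=> e0 et; rewrite !powRN lef_pV2 ?posrE ?powR_gt0//; last exact: lt_le_trans et.
    by apply: ge0_ler_powR; rewrite ?nnegrE ?(ltW m0) ?(ltW e0)// (le_trans _ et)// ltW.
  have h12 : 0 <= 2^-1 :> R by [].
  have h1e : 0 <= 1 + enorm2 x by lra.
  rewrite /bub (pM _ _ h12 h1e) (pM _ _ (ltW L20) (mulr_ge0 h12 h1e)) (pM _ _ (ltW f0) (ltW T0)).
  have rl : R0 ^+ 2 * (r + L) ^+ 2 <= 4 * (L ^+ 2 * r ^+ 2).
    have hh : R0 * (r + L) <= 2 * (L * r).
      by have := RL; have := Rx; rewrite -/r => ? ?; have := R0_ge8; nra.
    have h0 : 0 <= R0 * (r + L).
      by apply: mulr_ge0; [have := R0_ge8|have := L8]; lra.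
    have : (R0 * (r + L)) ^+ 2 <= (2 * (L * r)) ^+ 2.
      by rewrite lerXn2r ?nnegrE// (le_trans h0 hh).
    rewrite !exprMn; have -> : (2 : R) ^+ 2 = 4 by ring.
    by [].
  have key : 4 `^ m^-1 * T <= L ^+ 2 / 64 * (2^-1 * (1 + enorm2 x)).
    rewrite er /T; have := R0_sq; have := sqr_ge0 (r + L); have := sqr_ge0 L.
    by move: rl; move: (R0 ^+ 2) (4 `^ m^-1) ((r + L) ^+ 2) (L ^+ 2) (r ^+ 2) => ?????????; nra.
  by apply: anti => //; exact: mulr_gt0.
rewrite /w mulNr; move: h1 h2; rewrite (_ : s0 / 2 = s0 / 4 + s0 / 4); last by field.
by rewrite !mulrDl; lra.
Qed.

(** At each exterior point there are two ways to satisfy [comparison]: u exceeds the peak of the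
    barrier sum, where tau^(-m) = kap^(-m) l^(-2m), or the operator on u strictly exceeds l^(-d)
    times the weights of the balls containing the point. *)
Lemma barrier_compare u : (forall x, 0 <= u x) -> continuous u ->
  (forall x, 1 < enorm x ->
     s0 * kap `^ (- m) * SA * (l ^+ 2) `^ (- m) <= u x \/
     exists lu, [/\ Jlim b u x lu, 0 < lu &
       (l ^+ 2) `^ (- D) * (\sum_i A i * (if enorm (x - y i) < l then 1 else 0)) < lu]) ->
  forall x, R0 <= enorm x -> s0 / 4 * SA * (9 * (enorm x + L) ^+ 2) `^ (- m) <= u x.
Proof.
move=> u0 cu h x Rx; apply: le_trans (w_lower Rx) _.
move: x {Rx}; apply: (@comparison R d b u w u0 cu continuous_w w_in w_lim) => x x1.
have [hl|[lu [ju lu0 hlu]]] := h x x1; [left|right].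
  apply: le_trans hl.
  apply: (@le_trans _ _ (\sum_i (s0 * A i) * phi l (y i) x)).
    by rewrite /w gerDl mulNr oppr_le0 mulr_ge0// bub_ge0.
  rewrite /SA mulr_sumr mulr_suml; apply: ler_sum => i _.
  have /andP[_ hp] := phi_bounds (y i) x l0.
  have sA : 0 <= s0 * A i by rewrite mulr_ge0// ltW.
  apply: le_trans (ler_wpM2l sA hp) _.
  rewrite (_ : s0 * kap `^ (- m) * A i * _ = s0 * A i * (kap `^ (- m) * (l ^+ 2) `^ (- m))); last by ring.
  apply: ler_wpM2l => //; rewrite -powRM ?sqr_ge0 ?(ltW kap_gt0)//.
  by apply: bub_le1; rewrite ?lerDl ?enorm2_ge0//; exact: tau_gt0.
exists (\sum_i (s0 * A i) * Lphi l (y i) x + (- M) * (Kbub * (1 `^ a * bub b 1 (x - 0)))), lu.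
split => //.
  have j2 := JlimZ (- M) (Jlim_bub x 0 ltr01).
  have j1 : Jlim b (fun z => \sum_i (s0 * A i) * phi l (y i) z) x
     (\sum_i (s0 * A i) * Lphi l (y i) x).
    by apply: Jlim_sum => i; apply: JlimZ; exact: Jlim_phi.
  rewrite (_ : w = ((fun z => \sum_i (s0 * A i) * phi l (y i) z) \+
    (fun z => (- M) * bub m 1 (z - 0)))); first exact: (JlimD j1 j2).
  by apply/funext => z; rewrite /w/= subr0.
apply: le_lt_trans hlu; rewrite mulNr; apply: (@le_trans _ _ (\sum_i (s0 * A i) * Lphi l (y i) x)).
  rewrite gerDl oppr_le0; apply: mulr_ge0 => //; apply: mulr_ge0; first exact: (ltW Kbub_gt0).
  by rewrite mulr_ge0 ?powR_ge0 ?bub_ge0.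
rewrite mulr_sumr; apply: ler_sum => i _.
rewrite [s0 * _]mulrC -mulrA [leRHS]mulrCA; apply: ler_wpM2l => //.
exact: Lphi_ind.
Qed.

End one_barrier.

(** The interface of the barriers, with the construction hidden behind constants: [A] gives the
    masses, [y] the centres at distance of order [L], and [l] the common radius. It is used with a
    single ball via the first alternative inside it, and with a grid via the second alternative
    everywhere. *)
Lemma supersolution_lower : exists c C r0 : R, [/\ 0 < c, 0 < C, 8 <= r0 &
  forall (I : finType) (A : I -> R) (y : I -> 'rV[R]_d) (L l : R) u,
    r0 <= L -> 0 < l -> l <= L -> (forall i, 0 <= A i) ->
    (forall i, L ^+ 2 / 16 <= enorm2 (y i) <= 4 * L ^+ 2) ->
    (forall x, 0 <= u x) -> continuous u ->
    (forall x, 1 < enorm x ->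
       C * (\sum_i A i) * (l ^+ 2) `^ (- m) <= u x \/
       exists lu, [/\ Jlim b u x lu, 0 < lu &
         (l ^+ 2) `^ (- D) * (\sum_i A i * (if enorm (x - y i) < l then 1 else 0)) < lu]) ->
    forall x, r0 <= enorm x -> c * (\sum_i A i) * ((enorm x + L) ^+ 2) `^ (- m) <= u x].
Proof.
exists (s0 / 4 * 9 `^ (- m)), (s0 * kap `^ (- m)), R0; split.
- by rewrite mulr_gt0 ?powR_gt0// divr_gt0.
- by rewrite mulr_gt0 ?powR_gt0.
- exact: R0_ge8.
move=> I A y L l u RL l0 lL A0 yL u0 cu h x Rx.
have := barrier_compare RL l0 lL A0 yL u0 cu h Rx.
rewrite powRM ?sqr_ge0// mulrA; congr (_ * _ <= _); by rewrite mulrAC.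
Qed.

End barrier.

(** * The fractional Laplacian in terms of truncated and smoothed integrals *)

Section fraclap_facts.
Context {R : realType}.
Variables (d : nat) (alpha : R).
Hypotheses (al0 : 0 < alpha) (al2 : alpha < 2).
Implicit Types (x y z : 'rV[R]_d) (u w : 'rV[R]_d -> R).
Local Notation mu := (lebesgue_rV R d).
Local Notation D := (d%:R / 2 : R).
Local Notation b := (D + alpha / 2).

Let D0 : 0 <= D. Proof. exact: divr_ge0. Qed.
Let a0 : 0 < alpha / 2. Proof. exact: divr_gt0. Qed.
Let b0 : 0 < b. Proof. exact: ltr_wpDl. Qed.

Lemma enorm_powR x : (enorm x `^ (d%:R + alpha))^-1 = bub b 0 x.
Proof.
rewrite /bub add0r -powRN enormE -powR12_sqrt ?enorm2_ge0// -powRrM; congr (_ `^ _).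
by field.
Qed.

Lemma fraclapE u x :
  fraclap alpha u x = fraclap_cst d alpha * lim (Itr b u x e @[e --> 0^'+]).
Proof.
rewrite /fraclap.
have E : (fun eps => \int[mu]_(y in [set y | eps < enorm (x - y)])
    ((u x - u y) / enorm (x - y) `^ (d%:R + alpha))) = Itr b u x.
  by apply/funext => e; apply: eq_Rintegral => y _; rewrite enorm_powR.
by rewrite E.
Qed.

Lemma fraclap_cst_gt0 : 0 < fraclap_cst d alpha.
Proof.
rewrite /fraclap_cst; apply: divr_gt0; apply: mulr_gt0.
- exact: powR_gt0.
- apply: Gamma_gt0; apply: divr_gt0 => //; exact: ltr_wpDl.
- by apply: powR_gt0; exact: pi_gt0.
- by apply: divr_gt0 => //; apply: Gamma_gt0; rewrite subr_gt0 ltr_pdivrMr// mul1r.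
Qed.

(* [lim] is 0 when the limit does not exist, so positivity forces convergence. *)
Lemma fraclap_gt0P u x : 0 < fraclap alpha u x ->
  exists2 L, 0 < L /\ fraclap alpha u x = fraclap_cst d alpha * L &
    Itr b u x e @[e --> 0^'+] --> L.
Proof.
rewrite fraclapE pmulr_rgt0 ?fraclap_cst_gt0// => h.
exists (lim (Itr b u x e @[e --> 0^'+])) => //.
have [//|ncv] := pselect (cvg (Itr b u x e @[e --> 0^'+])).
by move: h; rewrite (dvgP ncv)/= ltxx.
Qed.

(** Each of 1 and |y|^(d + alpha) is at most (1 + |y|^2)^b, whence the factor 2. *)
Lemma bub_omega y : bub b 1 y <= 2 * (1 / (1 + enorm y `^ (d%:R + alpha))).
Proof.
have e0 := enorm2_ge0 y.
have -> : enorm y `^ (d%:R + alpha) = enorm2 y `^ b.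
  by rewrite enormE -powR12_sqrt// -powRrM; congr (_ `^ _); field.
rewrite /bub powRN div1r.
have h : enorm2 y `^ b <= (1 + enorm2 y) `^ b.
  by apply: ge0_ler_powR; rewrite ?nnegrE ?(ltW b0) ?lerDr ?addr_ge0.
have E1 : 1 `^ b = 1 :> R by rewrite powR1.
have h1 : 1 <= (1 + enorm2 y) `^ b.
  by rewrite -[leLHS]E1; apply: ge0_ler_powR; rewrite ?nnegrE ?(ltW b0) ?lerDl ?addr_ge0.
have p0 := powR_ge0 (enorm2 y) b.
rewrite ler_pdivlMr; last lra.
by rewrite mulrC ler_pdivrMr; lra.
Qed.

Section L1.
Variable u : 'rV[R]_d -> R.
Hypothesis L1u : L1_omega alpha u.

(** Integrability makes the weighted function measurable, and the positive weight is multiplied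
    away. *)
Lemma L1_measurable : measurable_fun [set: 'rV[R]_d] u.
Proof.
have /measurable_int/measurable_EFinP m1 := L1u.
have men : measurable_fun [set: 'rV[R]_d] (fun x => 1 + enorm x `^ (d%:R + alpha)).
  rewrite (_ : (fun x => _) = (fun x => 1 + enorm2 x `^ b)).
    by apply: measurable_funD => //; apply: measurable_powR_comp; exact: measurable_enorm2.
  apply/funext => y; rewrite enormE -powR12_sqrt ?enorm2_ge0// -powRrM; congr (_ + _ `^ _).
  by field.
have := measurable_funM m1 men; congr (measurable_fun _ _); apply/funext => x /=.
have := powR_ge0 (enorm x) (d%:R + alpha) => h.
by rewrite div1r mulfVK// gt_eqF// ltr_pwDl.
Qed.

Lemma L1_bub nu x : 0 < nu -> mu.-integrable setT (fun y => (u y * bub b nu (x - y))%:E).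
Proof.
move=> nu0; have [C [C0 hC]] := bub_decay x (ltW b0) nu0.
apply: (le_integrable measurableT _ _ (integrableZl measurableT (C * 2) L1u)).
- apply/measurable_EFinP; apply: measurable_funM; first exact: L1_measurable.
  exact: measurable_bub.
- move=> y _; move: (bub_omega y); move: (1 / _) => om hom.
  rewrite -EFinM !abse_EFin lee_fin !normrM mulrCA ler_wpM2l//.
  rewrite (ger0_norm (bub_ge0 _ _ _)) (gtr0_norm C0) ger0_norm//.
  apply: le_trans (hC y) _; rewrite -mulrA ler_pM2l//.
  apply: le_trans hom _; rewrite ler_pM2l//; exact: ler_norm.
Qed.

Lemma L1_Jint x : Jint b u x.
Proof.
move=> nu nu0.
have i1 := integrableZl measurableT (u x) (integrable_bub x a0 nu0).
apply: eq_integrable (integrableB measurableT i1 (L1_bub x nu0)) => // y _.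
by rewrite mulrBl EFinB EFinM.
Qed.

Lemma L1_Jlim x (L : R) : Itr b u x e @[e --> 0^'+] --> L -> Jlim b u x L.
Proof.
by move=> h; split; [exact: L1_Jint|exact: cvg_Jsm_of_Itr b0 L1_measurable (L1_Jint x) _ h].
Qed.

End L1.

End fraclap_facts.

(** * Strong maximum principle *)

Section cubes.
Context {R : realType} {d : nat}.
Implicit Types x y : 'rV[R]_d.

(** Half-open, so that the cells of a grid are pairwise disjoint. *)
Definition cube x (s : R) : set 'rV[R]_d :=
  [set y | forall i, y ord0 i \in `[x ord0 i, x ord0 i + s[].

Lemma measurable_cube x s : measurable (cube x s).
Proof.
have -> : cube x s = \bigcap_(i in [set: 'I_d])
    (fun y : 'rV[R]_d => y ord0 i) @^-1` `[x ord0 i, x ord0 i + s[.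
  by apply/seteqP; split => y /= h i; [move=> _|]; exact: h.
apply: fin_bigcap_measurable => // i _.
by rewrite -[X in measurable X]setTI; exact: measurable_rV_coord.
Qed.

Lemma lebesgue_rV_cube x s : 0 < s -> lebesgue_rV R d (cube x s) = (s ^+ d)%:E.
Proof.
move=> s0; rewrite (@lebesgue_rV_box R d (fun i => `[x ord0 i, x ord0 i + s[%classic))//.
rewrite (eq_bigr (fun=> s%:E)) => [|i _].
  rewrite prodEFin big_const_ord; apply: (congr1 EFin).
  by rewrite -[RHS]mulr1; elim: (d) => [|n IH]; rewrite ?mul1r// iterS IH exprS mulrA.
rewrite lebesgue_measure_itv/= lte_fin ltrDl s0.
by rewrite -EFinB; apply: (congr1 EFin); rewrite addrAC subrr add0r.
Qed.

Lemma norm_le_coord x (r : R) : 0 <= r -> (forall i, `|x ord0 i| <= r) -> `|x| <= r.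
Proof.
move=> r0 h; rewrite /Num.norm/= mx_normrE; apply: bigmax_le => // -[i j] _ /=.
by rewrite (ord1 i).
Qed.

Lemma cube_norm x y s : 0 <= s -> cube x s y -> `|y - x| <= s.
Proof.
move=> s0 h; apply: norm_le_coord => // i; rewrite !mxE/=.
by have := h i; rewrite in_itv/= => /andP[h1 h2]; rewrite ger0_norm; lra.
Qed.

Lemma compact_box x (r : R) : compact [set y : 'rV[R]_d | `|y - x| <= r].
Proof.
apply: bounded_closed_compact.
  exists (`|x| + r); split; first exact: num_real.
  move=> M rM y /= yx; rewrite -(subrK x y); apply: le_trans (ler_normD _ _) _.
  by rewrite addrC; apply: le_trans (ltW rM); rewrite lerD2l.
apply: (@preimage_closed _ _ (fun y => `|y - x|) [set` `]-oo, r]]) => //.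
move=> y _; apply: (@continuous_comp _ _ _ (fun y => y - x) (fun y => `|y|)).
  have c1 : {for y, continuous (id : 'rV[R]_d -> 'rV[R]_d)} by exact: cvg_id.
  have c2 : {for y, continuous (cst x : 'rV[R]_d -> 'rV[R]_d)}.
    exact: (@cvg_cst _ _ _ _ (nbhs_filter y)).
  exact: (continuousB c1 c2).
exact: norm_continuous.
Qed.

End cubes.

Section mean_value.
Context {R : realType} {d : nat}.
Implicit Types (h : 'rV[R]_d -> R) (x y z e : 'rV[R]_d).

Lemma is_derive_line h z e (t : R) : derivable h (z + t *: e) e ->
  is_derive t 1 (fun s : R => h (z + s *: e)) ('D_e h (z + t *: e)).
Proof.
move=> dh.
have E : (fun k : R => k^-1 *: (((fun s : R => h (z + s *: e)) \o shift t) (k *: (1 : R^o)) - h (z + t *: e)))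
    = (fun k => k^-1 *: ((h \o shift (z + t *: e)) (k *: e) - h (z + t *: e))).
  apply/funext => k /=; rewrite [_ *: 1]mulr1 scalerDl.
  by rewrite addrCA addrA.
apply: DeriveDef; first by rewrite /derivable E.
by rewrite /derive E.
Qed.

(** The coordinates of [x] are replaced by those of [y] one at a time. Every move stays in the
    sup-norm ball and costs at most M r by the one-dimensional mean value theorem. *)
Lemma box_mean_value h x (r M : R) : 0 <= r ->
  (forall y, `|y - x| <= r -> forall i, derivable h y (delta_mx 0 i) /\
    `|'D_(delta_mx 0 i) h y| <= M) ->
  forall y, `|y - x| <= r -> `|h y - h x| <= d%:R * (M * r).
Proof.
move=> r0 dh y yx.
pose z k : 'rV[R]_d := \row_i (if (i < k)%N then y ord0 i else x ord0 i).
have ci i : `|y ord0 i - x ord0 i| <= r.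
  by have := coord_le_norm (y - x) i; rewrite !mxE => /le_trans; apply.
have step (k : 'I_d) : `|h (z k.+1) - h (z k)| <= M * r.
  pose e : 'rV[R]_d := delta_mx 0 k; pose s := y ord0 k - x ord0 k.
  have Ez : z k.+1 = z k + s *: e.
    apply/rowP => i; rewrite !mxE ltnS leq_eqVlt /=.
    have [->|ik] := eqVneq i k; first by rewrite eqxx ltnn mulr1 /s addrC subrK.
    by rewrite mulr0 addr0 val_eqE (negbTE ik).
  have inbox (t : R) : `|t| <= `|s| -> `|z k + t *: e - x| <= r.
    move=> ts; apply: norm_le_coord => // i; rewrite !mxE/=.
    have [->|ik] := eqVneq i k.
      by rewrite ltnn mulr1 addrC addKr; apply: le_trans ts _; exact: ci.
    by rewrite mulr0 addr0; case: ifP => _; rewrite ?subrr ?normr0.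
  have der (t : R) : `|t| <= `|s| ->
      is_derive t (1 : R) (fun s : R => h (z k + s *: e)) ('D_e h (z k + t *: e)).
    by move=> /inbox/dh/(_ k)[+ _]; exact: is_derive_line.
  have cont (t : R) : `|t| <= `|s| -> {for t, continuous (fun s : R => h (z k + s *: e))}.
    move=> /der[dt _]; apply/differentiable_continuous; exact/derivable1_diffP.
  have bnd (t : R) : `|t| <= `|s| -> `|'D_e h (z k + t *: e)| <= M.
    by move=> /inbox/dh/(_ k)[].
  have M0 : 0 <= M by apply: le_trans (bnd 0 _); rewrite ?normr0.
  have Ez0 : z k + 0 *: e = z k by rewrite scale0r addr0.
  rewrite Ez -[in X in _ - X]Ez0.
  have [s0|s0] := leP 0 s.
    have [||c] := @MVT_segment R (fun s : R => h (z k + s *: e))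
        (fun t => 'D_e h (z k + t *: e)) 0 s s0.
    - move=> t; rewrite in_itv/= => /andP[t0 ts]; apply: der.
      by rewrite !ger0_norm// ltW.
    - apply: continuous_in_subspaceT => t; rewrite inE/= in_itv/= => /andP[t0 ts].
      by apply: cont; rewrite !ger0_norm.
    rewrite in_itv/= subr0 => /andP[c0 cs] ->; rewrite normrM ler_pM//.
      by apply: bnd; rewrite !ger0_norm.
    exact: ci.
  have [||c] := @MVT_segment R (fun s : R => h (z k + s *: e))
      (fun t => 'D_e h (z k + t *: e)) s 0 (ltW s0).
  - move=> t; rewrite in_itv/= => /andP[t0 ts]; apply: der.
    by rewrite !ltr0_norm// lerN2 ltW.
  - apply: continuous_in_subspaceT => t; rewrite inE/= in_itv/= => /andP[t0 ts].
    by apply: cont; rewrite !ler0_norm// ?lerN2// ltW.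
  rewrite in_itv/= sub0r distrC => /andP[c0 cs] ->; rewrite normrM ler_pM//.
    by apply: bnd; rewrite !ler0_norm// ?lerN2// ltW.
  by rewrite normrN; exact: ci.
have main k : (k <= d)%N -> `|h (z k) - h x| <= k%:R * (M * r).
  elim: k => [_|k IH kd].
    rewrite (_ : z 0%N = x) ?subrr ?normr0 ?mul0r//.
    by apply/rowP => i; rewrite mxE.
  rewrite -natr1 mulrDl mul1r -(subrKA (h (z k))) addrC.
  apply: le_trans (ler_normD _ _) _; apply: lerD; first exact: IH (ltnW kd).
  exact: (step (Ordinal kd)).
rewrite -{1}(_ : z d = y); first exact: main.
by apply/rowP => i; rewrite mxE ltn_ord.
Qed.

Lemma derive_min0 h x (r : R) e : 0 < r ->
  (forall t : R, `|t| < r -> derivable h (x + t *: e) e) ->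
  (forall y, h x <= h y) -> 'D_e h x = 0.
Proof.
move=> r0 dh hm.
have := @derive1_at_min R (fun t : R => h (x + t *: e)) (- r) r 0.
case => //; first by lra.
- move=> t; rewrite in_itv/= -ltr_norml => /dh /is_derive_line[]; by [].
- by rewrite in_itv/= oppr_lt0 r0.
- by move=> t _; rewrite scale0r addr0.
move=> _ <-; have := dh 0; rewrite normr0 => /(_ r0)/is_derive_line[_].
by rewrite scale0r addr0 => ->.
Qed.

End mean_value.

Section growth.
Context {R : realType} {d : nat}.
Implicit Types (x y : 'rV[R]_d) (u h : 'rV[R]_d -> R).

Lemma Ck_holder_continuous k (theta : R) K h : Ck_holder k theta K h ->
  {within K, continuous h}.
Proof. by case: k => [|k] []. Qed.

Lemma continuous_box_bounded (K : set 'rV[R]_d) h : compact K ->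
  {within K, continuous h} -> exists2 M, 0 <= M & forall y, K y -> `|h y| <= M.
Proof.
move=> cK ch; have /compact_bounded[M [_ hM]] := continuous_compact ch cK.
exists (`|M| + 1) => [|y Ky]; first by rewrite addr_ge0.
apply: (hM (`|M| + 1)); last by exists y.
by apply: le_lt_trans (ler_norm _) _; rewrite ltrDl.
Qed.

Lemma finite_bound (I : finType) (P : I -> R -> Prop) :
  (forall i M N, M <= N -> P i M -> P i N) -> (forall i, exists M, P i M) ->
  exists2 M, 0 <= M & forall i, P i M.
Proof.
move=> Pm /choice[F hF]; exists (\sum_i `|F i|); first by apply: sumr_ge0 => i _.
move=> i; apply: Pm (hF i); rewrite (bigD1 i)//=.
apply: le_trans (ler_norm _) _; rewrite lerDl; exact: sumr_ge0.
Qed.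

Lemma open_Bc : open (@Bc R d).
Proof.
rewrite /Bc (_ : [set x | _] = (@enorm R d) @^-1` [set t | 1 < t]) //.
apply: open_comp; last exact: open_gt.
by move=> x _; exact: continuous_enorm.
Qed.

Lemma Bc_box x : Bc x -> exists2 r : R, 0 < r <= 1 & [set y | `|y - x| <= r] `<=` Bc.
Proof.
move=> Bx; have /nbhs_ballP[e /= e0 he] : nbhs x Bc by apply: open_nbhs_nbhs; split => //; exact: open_Bc.
exists (Num.min (e / 2) 1).
  by rewrite lt_min ltr01 divr_gt0//= ge_min lexx orbT.
move=> y /= yx; apply: he; rewrite -ball_normE /= distrC.
by apply: le_lt_trans yx _; rewrite gt_min; apply/orP; left; lra.
Qed.

(** A zero of u >= 0 is a minimum, so the gradient vanishes there whenever it exists, and the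
    regularity beyond alpha becomes a rate of vanishing. The three cases are the integer part of
    alpha + gamma: 0 (Hoelder bound on u), 1 (Hoelder bound on the gradient), at least 2 (bounded
    second derivatives, rate 2 > alpha). *)
Lemma C_plus_growth (alpha : R) u x : 0 < alpha -> alpha < 2 -> C_plus alpha Bc u ->
  Bc x -> (forall y, 0 <= u y) -> u x = 0 ->
  exists s C r : R, [/\ alpha < s, 0 < C, 0 < r <= 1 &
    forall y, `|y - x| <= r -> u y <= C * enorm (y - x) `^ s].
Proof.
move=> al0 al2 Cu Bx u0 ux; have [r /andP[r0 r1] rB] := Bc_box Bx.
have [ga ga0] := Cu _ (@compact_box R d x r) rB; set K := [set y | _].
have Kx : K x by rewrite /K/= subrr normr0 ltW.
have cK : compact K by exact: compact_box.
rewrite /Cs; set s' := alpha + ga.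
have s'0 : 0 <= s' by rewrite addr_ge0// ltW.
case E : (Num.truncn s') => [|k].
  move=> [_ [C hC]]; exists (s' - 0%:R), (`|C| + 1), r; split.
  - by rewrite subr0 ltrDl.
  - by rewrite ltr_pwDr.
  - by rewrite r0.
  move=> y Ky; have := hC y x Ky Kx; rewrite ux subr0 ger0_norm// => /le_trans; apply.
  apply: ler_wpM2r; first exact: powR_ge0.
  by apply: le_trans (ler_norm _) _; rewrite lerDl.
move=> [_ hD].
have D0 i : 'D_(delta_mx 0 i) u x = 0.
  apply: (@derive_min0 _ _ u x r) => // [t tr|y]; last by rewrite ux.
  have [dK _] := hD i; apply: dK; rewrite /K/= addrC addKr.
  apply: norm_le_coord => [|j]; first exact: ltW.
  rewrite !mxE/= normrM; apply: le_trans (ltW tr).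
  by rewrite -[leRHS]mulr1 ler_wpM2l//; case: (j == i); rewrite ?normr1 ?normr0.
(* [tau] is the rate at which the gradient vanishes; the mean value bound over a box of half-side |y
   - x| adds 1 to it. *)
suff [tau [C [at1 tau0 C0 hC]]] : exists tau C, [/\ alpha < 1 + tau, 0 <= tau, 0 <= C &
    forall rho y, rho <= r -> `|y - x| <= rho -> forall i,
      `|'D_(delta_mx 0 i) u y| <= C * rho `^ tau].
  exists (1 + tau), (d%:R * C + 1), r; split => //.
  - by rewrite ltr_wpDl// mulr_ge0.
  - by rewrite r0.
  move=> y Ky; set rho := `|y - x|.
  have rho0 : 0 <= rho by exact: normr_ge0.
  have := @box_mean_value R d u x rho (C * rho `^ tau) rho0.
  have dh z : `|z - x| <= rho -> forall i, derivable u z (delta_mx 0 i) /\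
      `|'D_(delta_mx 0 i) u z| <= C * rho `^ tau.
    move=> zx i; split; last exact: hC.
    by have [dK _] := hD i; apply: dK; apply: le_trans zx _.
  move=> /(_ dh y (lexx _)); rewrite ux subr0 ger0_norm// => /le_trans; apply.
  have re : rho <= enorm (y - x) by exact: norm_le_enorm.
  apply: (@le_trans _ _ (d%:R * (C * enorm (y - x) `^ (1 + tau)))); last first.
    rewrite mulrA; apply: ler_wpM2r; first exact: powR_ge0.
    by rewrite lerDl.
  apply: ler_wpM2l => //; rewrite -mulrA; apply: ler_wpM2l => //.
  apply: (@le_trans _ _ (rho `^ (1 + tau))).
    have [/eqP rz|rp] := boolP (rho == 0); first by rewrite {2}rz mulr0 powR_ge0.
    have rp0 : 0 < rho by rewrite lt_neqAle eq_sym rp.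
    by rewrite (powR_addE rp0 erefl) (powRr1 rho0) mulrC.
  by apply: ge0_ler_powR; rewrite ?nnegrE ?enorm_ge0 ?addr_ge0.
have /andP[t1 t2] := truncn_itv s'0; rewrite E in t1 t2 hD.
case: k E hD t1 t2 => [|k] E hD t1 t2.
  have [] := @finite_bound 'I_d (fun i C => forall y, K y ->
      `|'D_(delta_mx 0 i) u y| <= C * enorm (y - x) `^ (s' - 1%:R)).
  - move=> i M N MN h y Ky; apply: le_trans (h y Ky) _.
    by apply: ler_wpM2r => //; exact: powR_ge0.
  - move=> i; have [_ [_ [C hC]]] := hD i; exists C => y Ky.
    by have := hC y x Ky Kx; rewrite D0 subr0.
  move=> C C0 hC; exists (s' - 1%:R), (C * d%:R `^ (s' - 1%:R)); split.
  - by rewrite addrC subrK ltrDl.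
  - by rewrite subr_ge0.
  - by rewrite mulr_ge0// powR_ge0.
  move=> rho y rr yx i; have rho0 : 0 <= rho by apply: le_trans yx.
  apply: le_trans (hC i y (le_trans yx rr)) _; rewrite -mulrA.
  apply: ler_wpM2l => //; rewrite -powRM//.
  apply: ge0_ler_powR; rewrite ?nnegrE ?enorm_ge0 ?mulr_ge0 ?subr_ge0//.
  by apply: le_trans (enorm_le_norm _) _; rewrite ler_wpM2l.
have [] := @finite_bound ('I_d * 'I_d)%type (fun ij C => forall y, K y ->
    `|'D_(delta_mx 0 ij.2) ('D_(delta_mx 0 ij.1) u) y| <= C).
- by move=> i M N MN h y Ky; apply: le_trans (h y Ky) _.
- move=> [i j]; have [_ [_ /(_ j)[_ /Ck_holder_continuous c]]] := hD i.
  by have [M _ hM] := continuous_box_bounded cK c; exists M.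
move=> C C0 hC; exists 1, (d%:R * C); split => //; first exact: mulr_ge0.
move=> rho y rr yx i; have rho0 : 0 <= rho by apply: le_trans yx.
have -> : rho `^ 1 = rho by rewrite powRr1.
rewrite -mulrA.
have := @box_mean_value R d ('D_(delta_mx 0 i) u) x rho C rho0.
rewrite D0; move=> /(_ _ y yx); rewrite subr0; apply => z zx j.
have Kz : K z by exact: le_trans zx rr.
by have [_ [_ /(_ j)[dK _]]] := hD i; split; [exact: dK|exact: (hC (i, j))].
Qed.

End growth.

Section strong_maximum.
Context {R : realType} {d : nat}.
Local Notation leb := (@lebesgue_measure R).
Local Notation mu := (lebesgue_rV R d).
Implicit Types (x y : 'rV[R]_d) (u : 'rV[R]_d -> R).

(** Local integrability of |x - z|^(-2s) for 2s < d. With the Gaussian cutoff, the Gamma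
    representation of the power and Tonelli reduce it to a convergent beta integral. *)
Lemma integrable_gauss_bub (s : R) x : 0 < s -> s < d%:R / 2 ->
  mu.-integrable setT (fun z => (expR (- enorm2 (x - z)) * bub s 0 (x - z))%:E).
Proof.
move=> s0 sD; have Gs := Gamma_gt0 s0.
have mh0 : measurable_fun [set: 'rV[R]_d] (fun z => expR (- enorm2 (x - z)) * bub s 0 (x - z)).
  apply: measurable_funM; last exact: measurable_bub.
  by apply: measurable_expR_comp; exact: measurable_enorm2B.
have h0 (z : 'rV[R]_d) : 0 <= expR (- enorm2 (x - z)) * bub s 0 (x - z).
  by apply: mulr_ge0; [exact: expR_ge0|exact: bub_ge0].
apply: ge0_integrable; [exact: mh0|exact: h0|].
pose h (z : 'rV[R]_d) (l : R) := pg s l * expR (- ((1 + l) * enorm2 (x - z))).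
have mh : measurable_fun setT (fun p : 'rV[R]_d * R => h p.1 p.2).
  apply: measurable_funM; first exact: measurable_pg_comp.
  apply: measurable_expR_comp; apply: measurable_funM; first exact: measurable_funD.
  exact: measurable_enorm2_comp.
have hge (z : 'rV[R]_d) (l : R) : 0 <= h z l by apply: mulr_ge0; [exact: pg_ge0|exact: expR_ge0].
have /integrableP[_] := integrable_pg_beta s0 sD ltr01 ltr01.
move=> Ifin.
have E : (\int[mu]_z \int[leb]_l (h z l)%:E =
    (pi `^ (d%:R / 2))%:E * \int[leb]_l (pg s l * (1 + 1 * l) `^ (- (d%:R / 2)))%:E)%E.
  rewrite tonelliR; [|exact: mh|exact: hge].
  rewrite -ge0_integralZR; last 3 first.
  - exact: powR_ge0.
  - apply: measurable_funM; first exact: measurable_pg_comp.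
    by apply: measurable_powR_comp; apply: measurable_funD => //; exact: measurable_funM.
  - by move=> l; apply: mulr_ge0; [exact: pg_ge0|exact: powR_ge0].
  apply: eq_integral => l _; rewrite /h.
  have [l0|l0] := leP l 0.
    rewrite (pg0 s l0) mul0r mulr0 integral0_eq// => z _.
    by rewrite mul0r.
  have l10 : 0 < 1 + l by rewrite addr_gt0.
  rewrite ge0_integralZR; last 3 first.
  - exact: pg_ge0.
  - apply: measurable_expR_comp; apply: measurable_funM => //.
    exact: measurable_enorm2B.
  - by move=> z; exact: expR_ge0.
  rewrite (integral_gauss_rV _ l10) -EFinM mul1r; apply: (congr1 EFin).
  rewrite (powRM _ (pi_ge0 R)) ?invr_ge0 ?(ltW l10)//.
  rewrite -(powR_inv1 (ltW l10)) -powRrM mulN1r.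
  by rewrite mulrCA.
have Ifin2 : (\int[mu]_z \int[leb]_l (h z l)%:E < +oo)%E.
  rewrite E; apply: lte_mul_pinfty; [by rewrite lee_fin powR_ge0|by []|].
  apply: le_lt_trans Ifin; apply: ge0_le_integral => //.
  - by move=> l _; rewrite lee_fin; apply: mulr_ge0; [exact: pg_ge0|exact: powR_ge0].
  - apply/measurable_EFinP; apply: measurable_funM; first exact: measurable_pg_comp.
    by apply: measurable_powR_comp; apply: measurable_funD => //; exact: measurable_funM.
  - apply: measurableT_comp => //; apply/measurable_EFinP; apply: measurable_funM; first exact: measurable_pg_comp.
    by apply: measurable_powR_comp; apply: measurable_funD => //; exact: measurable_funM.
  - by move=> l _; rewrite abse_EFin lee_fin; exact: ler_norm.
have L : ((Gamma s)%:E * \int[mu]_z (expR (- enorm2 (x - z)) * bub s 0 (x - z))%:E <=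
    \int[mu]_z \int[leb]_l (h z l)%:E)%E.
  rewrite -ge0_integralZR; [|exact: (ltW Gs)|exact: mh0|exact: h0].
  apply: ge0_le_integral => //.
  - by move=> z _; rewrite lee_fin; apply: mulr_ge0; [exact: (ltW Gs)|exact: h0].
  - by apply/measurable_EFinP; apply: measurable_funM => //; exact: mh0.
  - apply: (@measurable_fun_fubini_tonelli_F _ _ _ _ R leb (fun p : 'rV[R]_d * R => (h p.1 p.2)%:E)).
    + exact/measurable_EFinP.
    + by move=> p; rewrite lee_fin.
  (* At z = x the power takes the default value 0, so only the inequality is claimed there. *)
  - move=> z _; have [t0|t0] := leP (enorm2 (x - z)) 0.
      have t00 : enorm2 (x - z) = 0 by apply/le_anti; rewrite t0 enorm2_ge0.
      rewrite /bub t00 addr0 powR0 ?oppr_eq0 ?gt_eqF// !mulr0.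
      by apply: integral_ge0 => l _; rewrite lee_fin.
    under eq_integral do rewrite /h mulrDl mul1r opprD expRD mulrCA.
    rewrite ge0_integralZR; last 3 first.
    + exact: expR_ge0.
    + apply: measurable_funM; first exact: measurable_pg_comp.
      by apply: measurable_expR_comp; exact: measurable_funM.
    + by move=> l; apply: mulr_ge0; [exact: pg_ge0|exact: expR_ge0].
    by rewrite (integral_pg_Gamma s0 t0) -EFinM lee_fin mulrCA /bub add0r.
have lty (I : \bar R) : ((Gamma s)%:E * I < +oo -> I < +oo)%E.
  by case: I => [r|/=|//]; rewrite ?ltry// gt0_muley ?lte_fin.
by apply: lty; exact: le_lt_trans Ifin2.
Qed.

(** Dominated convergence: here the singular integrand is itself integrable and dominates all its
    truncations. *)
Lemma Itr_cvg (b : R) u x : 0 < b -> measurable_fun setT u ->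
  (forall nu, 0 < nu -> mu.-integrable setT (fun y => ((u x - u y) * bub b nu (x - y))%:E)) ->
  mu.-integrable setT (fun y => ((u x - u y) * bub b 0 (x - y))%:E) ->
  Itr b u x e @[e --> 0^'+] --> \int[mu]_y ((u x - u y) * bub b 0 (x - y)).
Proof.
move=> b0 mu_ iu iU; pose Uk (y : 'rV[R]_d) : R := (u x - u y) * bub b 0 (x - y).
have iU' : mu.-integrable setT (fun y => (Uk y)%:E) := iU.
apply/cvg_at_rightP => e [e0 ecv].
have E n : (Itr b u x (e n))%:E =
    (\int[mu]_y ((fun y => (Uk y)%:E) \_ [set y | (e n < enorm (x - y))%R]) y)%E.
  rewrite /Itr /Rintegral fineK; first by rewrite integral_mkcond.
  exact: (integrable_fin_num (measurable_far _ (ltW (e0 n))) (integrable_far b0 mu_ iu (e0 n))).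
have cv : (\int[mu]_y ((fun y => (Uk y)%:E) \_ [set y | (e n < enorm (x - y))%R]) y)%E @[n --> \oo]
    --> (\int[mu]_y (Uk y)%:E)%E.
  apply: (@dominated_cvg _ _ R mu setT measurableT _ _ (fun y => `|(Uk y)%:E|)%E).
  - move=> n; apply/(measurable_restrictT _ (measurable_far _ (ltW (e0 n)))).
    by apply: measurable_funTS; case/integrableP: iU'.
  - move=> y _; have := enorm_ge0 (x - y); rewrite le_eqVlt => /predU1P[z0|z0].
      have -> : y = x.
        apply/eqP; rewrite -subr_eq0 -[_ - _]opprB oppr_eq0; apply/eqP.
        by apply: enorm2_eq0; rewrite -sqr_enorm -z0 expr0n.
      have U0 : Uk x = 0 by rewrite /Uk subrr mul0r.
      rewrite U0 (_ : (fun n => _) = cst 0%E); first exact: cvg_cst.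
      by apply/funext => n; rewrite patchE U0; case: ifP.
    have [N _ hN] : \forall n \near \oo, e n < enorm (x - y).
      by move/cvgrPdist_lt : ecv => /(_ _ z0); apply: filterS => n;
        rewrite sub0r normrN gtr0_norm.
    apply: cvg_near_cst; exists N => // n Nn.
    by rewrite patchE mem_set//=; exact: hN.
  - by [].
  - exact: integrable_abse.
  - by move=> n y _; rewrite patchE; case: ifP => // _; rewrite abse0.
have fU := integrable_fin_num measurableT iU'.
move: cv; under eq_fun do rewrite -E.
by rewrite -[(\int[mu]_y (Uk y)%:E)%E]fineK// => /fine_cvgP[_].
Qed.

(** At a zero of [u] the principal value is minus the integral of u(y) |x - y|^(-2b), absolutely
    convergent by [C_plus_growth]. A nonnegative value makes this integral of a nonnegative function
    vanish. *)
Lemma strong_maximum (alpha : R) u x : (1 <= d)%N -> 0 < alpha -> alpha < 2 ->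
  classical alpha u -> (forall y, 0 <= u y) -> Bc x -> u x = 0 ->
  0 <= fraclap alpha u x -> forall y, u y = 0.
Proof.
move=> d1 al0 al2 [Cu cu L1u] u0 Bx ux fl.
pose b : R := d%:R / 2 + alpha / 2.
have d1R : 1 <= d%:R :> R by rewrite ler1n.
have b0 : 0 < b by rewrite /b; lra.
have mu_ : measurable_fun setT u by exact: L1_measurable L1u.
have iu := L1_Jint al0 L1u x.
have [s' [C [r [as' C0 /andP[r0 r1] hC]]]] := C_plus_growth al0 al2 Cu Bx u0 ux.
(* s > alpha gives be < d/2, that is local integrability; s <= alpha + 1/2 keeps [be] positive,
   since d >= 1. *)
pose s := Num.min s' (alpha + 2^-1).
have ss' : s <= s' by rewrite ge_min lexx.
have s_ub : s <= alpha + 2^-1 by rewrite ge_min lexx orbT.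
have s_lb : alpha < s by rewrite lt_min as'/= ltrDl invr_gt0.
pose be := b - s / 2.
have be0 : 0 < be by rewrite /be /b; lra.
have beD : be < d%:R / 2 by rewrite /be /b; lra.
pose f y := u y * bub b 0 (x - y).
have f0 y : 0 <= f y by apply: mulr_ge0 => //; exact: bub_ge0.
have Uf y : (u x - u y) * bub b 0 (x - y) = - f y by rewrite ux sub0r mulNr.
have mf : measurable_fun setT f by apply: measurable_funM => //; exact: measurable_bub.
(* The rate |x - y|^s lowers the singularity from exponent [b] to [be]; [expR 1] compensates the
   Gaussian factor on |x - y| <= 1. *)
have near y : enorm (x - y) <= r ->
    f y <= C * expR 1 * (expR (- enorm2 (x - y)) * bub be 0 (x - y)).
  move=> yr; have [T0|T0] := leP (enorm2 (x - y)) 0.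
    have -> : f y = 0.
      rewrite /f /bub (_ : enorm2 (x - y) = 0); last first.
        by apply/le_anti; rewrite T0 enorm2_ge0.
      by rewrite addr0 powR0 ?mulr0// oppr_eq0 gt_eqF.
    apply: mulr_ge0; first by rewrite mulr_ge0 ?expR_ge0// ltW.
    by apply: mulr_ge0; [exact: expR_ge0|exact: bub_ge0].
  have en1 : enorm (x - y) <= 1 by exact: le_trans r1.
  have e0 := enorm_ge0 (x - y).
  have uy : u y <= C * enorm (x - y) `^ s.
    apply: le_trans (hC y _) _.
      by rewrite distrC; apply: le_trans yr; exact: norm_le_enorm.
    rewrite (_ : enorm (y - x) = enorm (x - y)); last by rewrite enormE enorm2C.
    rewrite ler_pM2l//; apply: ger_powR => //.
    by rewrite en1 andbT enormE sqrtr_gt0.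
  have T1 : enorm2 (x - y) <= 1 by rewrite -sqr_enorm expr_le1.
  have E1 : 1 <= expR 1 * expR (- enorm2 (x - y)).
    by rewrite -expRD; apply: le_trans (expR_ge1Dx _); rewrite lerDl subr_ge0.
  have Es : enorm (x - y) `^ s * bub b 0 (x - y) = bub be 0 (x - y).
    rewrite enormE -(powR12_sqrt (enorm2_ge0 _)) -powRrM /bub add0r.
    rewrite -(powR_addE T0 erefl); congr (_ `^ _).
    by rewrite /be opprB [2^-1 * s]mulrC.
  apply: (@le_trans _ _ (C * bub be 0 (x - y))).
    by rewrite -Es mulrA; apply: ler_wpM2r => //; exact: bub_ge0.
  rewrite -mulrA; apply: ler_wpM2l; first exact: ltW.
  by rewrite mulrA; apply: ler_peMl => //; exact: bub_ge0.
have if_ : mu.-integrable setT (fun y => (f y)%:E).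
  pose far := [set y : 'rV[R]_d | r < enorm (x - y)].
  have mfar : measurable far by exact: measurable_far (ltW r0).
  have i1 : mu.-integrable setT ((fun y => (f y)%:E) \_ far).
    apply/(integrable_mkcond _ mfar).
    apply: eq_integrable (integrableN (integrable_far b0 mu_ iu r0)) => // y _.
    by rewrite /= Uf opprK.
  have i2 := integrableZl measurableT (C * expR 1) (integrable_gauss_bub x be0 beD).
  apply: le_integrable (integrableD measurableT i1 i2) => //; first exact/measurable_EFinP.
  move=> y _; rewrite abse_EFin (ger0_norm (f0 y)) patchE.
  have g0 : 0 <= C * expR 1 * (expR (- enorm2 (x - y)) * bub be 0 (x - y)).
    apply: mulr_ge0; first by rewrite mulr_ge0 ?expR_ge0// ltW.
    by apply: mulr_ge0; [exact: expR_ge0|exact: bub_ge0].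
  case: ifPn => hy.
    rewrite -EFinM -EFinD abse_EFin lee_fin ger0_norm ?addr_ge0//.
    by rewrite lerDl.
  rewrite add0e -EFinM abse_EFin lee_fin ger0_norm//; apply: near.
  by rewrite leNgt; apply: contra hy => h; rewrite inE.
have iU : mu.-integrable setT (fun y => ((u x - u y) * bub b 0 (x - y))%:E).
  by apply: eq_integrable (integrableN if_) => // y _; rewrite /= Uf.
have := Itr_cvg b0 mu_ iu iU.
move/cvg_lim => /(_ (@Rhausdorff R)) El.
move: fl; rewrite fraclapE El pmulr_rge0 ?fraclap_cst_gt0// => I0.
have {}I0 : (\int[mu]_y (f y)%:E <= 0)%E.
  move: I0; rewrite (eq_Rintegral _ (fun y _ => Uf y)) /Rintegral.
  rewrite (_ : \int[mu]_y (- f y)%:E = - \int[mu]_y (f y)%:E)%E; last first.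
    by rewrite -integralN//; apply: integrable_add_def.
  have := integrable_fin_num measurableT if_.
  by move=> /fineK <-; rewrite -EFinN /= oppr_ge0 lee_fin.
(* If u(y1) > 0, then u >= u(y1) / 2 on a small cube by continuity. There |x - y|^2 is at most [M],
   so the kernel is bounded below and the integral is positive. *)
move=> y1; apply/eqP; rewrite eq_le u0 andbT leNgt; apply/negP => uy1.
have /cvgrPdist_lt/(_ _ (divr_gt0 uy1 (@ltr0Sn R 1))) := cu y1.
move=> /nbhs_ballP[e /= e0 he].
have [q q0 qe] : exists2 q : R, 0 < q & q < e by exists (e / 2); [exact: divr_gt0|lra].
have uQ y : cube y1 q y -> u y1 / 2 <= u y.
  move=> /(cube_norm (ltW q0)) yq; have := he y.
  rewrite /= -ball_normE/= distrC => /(_ (le_lt_trans yq _)) H.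
  have {}H : `|u y1 - u y| < u y1 / 2 by exact: H.
  by move: H; rewrite ltr_norml => /andP[_]; lra.
pose M := 2 * enorm2 (x - y1) + 2 * (d%:R * q) ^+ 2.
have M0 : 0 < M.
  rewrite ltr_wpDl ?mulr_ge0 ?enorm2_ge0// mulr_gt0// exprn_gt0// mulr_gt0//; lra.
have fQ y : cube y1 q y -> u y1 / 2 * M `^ (- b) <= f y.
  move=> Qy; have uy := uQ y Qy.
  apply: ler_pM => //; [by rewrite divr_ge0|exact: powR_ge0|].
  rewrite /bub add0r !powRN lef_pV2 ?posrE ?powR_gt0//; last first.
    rewrite lt_neqAle enorm2_ge0 andbT eq_sym; apply/eqP => /enorm2_eq0/eqP.
    by rewrite subr_eq0 => /eqP xy; move: uy; rewrite -xy ux; lra.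
  apply: ge0_ler_powR; rewrite ?nnegrE ?enorm2_ge0 ?(ltW b0) ?(ltW M0)//.
  rewrite -(subrKA y1); apply: le_trans (enorm2D_le _ _) _; rewrite lerD2l ler_pM2l//.
  rewrite -sqr_enorm; apply: lerXn2r; rewrite ?nnegrE ?enorm_ge0 ?mulr_ge0 ?(ltW q0)//.
  apply: le_trans (enorm_le_norm _) _; rewrite ler_wpM2l// distrC.
  exact: cube_norm (ltW q0) Qy.
have : ((u y1 / 2 * M `^ (- b) * q ^+ d)%:E <= \int[mu]_y (f y)%:E)%E.
  apply: (@le_trans _ _ (\int[mu]_(y in cube y1 q) (f y)%:E)%E); last first.
    apply: ge0_subset_integral => //; [exact: measurable_cube|exact/measurable_EFinP|].
    by move=> y _; rewrite lee_fin.
  apply: (@le_trans _ _ (\int[mu]_(y in cube y1 q) (u y1 / 2 * M `^ (- b))%:E)%E).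
    rewrite integral_cst; last exact: measurable_cube.
    by rewrite EFinM -(lebesgue_rV_cube y1 q0).
  apply: ge0_le_integral => //.
  - exact: measurable_cube.
  - by move=> y _; rewrite lee_fin mulr_ge0 ?powR_ge0// divr_ge0// ltW.
  - by apply: measurable_funTS; exact/measurable_EFinP.
move=> /le_trans/(_ I0); rewrite lee_fin leNgt => /negP; apply.
by rewrite !mulr_gt0 ?powR_gt0 ?exprn_gt0// divr_gt0.
Qed.

End strong_maximum.

(** * Positive supersolutions *)

Section annulus.
Context {R : realType} {d : nat}.
Implicit Types (x y z : 'rV[R]_d).

(** Wide enough to contain the balls of radius r/2 centred on the sphere of radius [r]. *)
Definition annulus (r : R) : set 'rV[R]_d := [set x | r / 4 <= enorm x <= 2 * r].

Lemma annulusE (r : R) x : 0 <= r ->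
  annulus r x <-> r ^+ 2 / 16 <= enorm2 x <= 4 * r ^+ 2.
Proof.
move=> r0; rewrite /annulus/= le_enorm ?divr_ge0// exprMn.
have -> : 4^-1 ^+ 2 = 16^-1 :> R by rewrite exprVn -natrX.
have -> : (enorm x <= 2 * r) = (enorm2 x <= 4 * r ^+ 2); last by [].
rewrite -sqr_enorm -(_ : (2 * r) ^+ 2 = 4 * r ^+ 2); last by rewrite exprMn -natrX.
by rewrite ler_sqr ?nnegrE ?enorm_ge0 ?mulr_ge0.
Qed.

Lemma annulus_near (r : R) x y : 0 <= r -> enorm2 y = r ^+ 2 ->
  enorm2 (x - y) <= r ^+ 2 / 4 -> annulus r x.
Proof.
move=> r0 yr xy; apply/annulusE => //.
have h1 := enorm2D_le (y - x) x; rewrite subrK enorm2C yr in h1.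
have h2 := enorm2D_le (x - y) y; rewrite subrK yr in h2.
by have := sqr_ge0 r => h; lra.
Qed.

Lemma annulus_Bc (r : R) x : 8 <= r -> annulus r x -> Bc x.
Proof. by move=> r8 /andP[h _]; rewrite /Bc/=; lra. Qed.

Lemma compact_annulus (r : R) : compact (annulus r).
Proof.
rewrite (_ : annulus r = [set x | enorm x \in `[r / 4, 2 * r]]).
  apply: (@compact_enorm_itv _ _ _ (2 * r)); first exact: itv_closed.
  by move=> t; rewrite in_itv/= => /andP[].
by apply/seteqP; split => x /=; rewrite in_itv.
Qed.

Lemma exists_enorm (r : R) : (1 <= d)%N -> exists x : 'rV[R]_d, enorm2 x = r ^+ 2.
Proof.
move=> d1; exists (\row_i (if i == Ordinal d1 then r else 0)).
rewrite /enorm2 (bigD1 (Ordinal d1))//= big1 ?addr0 ?mxE ?eqxx// => i /negbTE h.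
by rewrite mxE h expr0n.
Qed.

Lemma annulus_neq0 (r : R) : (1 <= d)%N -> 0 <= r -> annulus r !=set0.
Proof.
move=> d1 r0; have [x xr] := exists_enorm r d1; exists x.
by apply: (annulus_near r0 xr); rewrite subrr (_ : enorm2 0 = 0) ?divr_ge0 ?sqr_ge0//;
  apply: big1 => i _; rewrite mxE expr0n.
Qed.

Lemma powR_antitone (s x y : R) : 0 <= s -> 0 < x -> x <= y -> y `^ (- s) <= x `^ (- s).
Proof.
move=> s0 x0 xy; have y0 := lt_le_trans x0 xy.
rewrite !powRN lef_pV2 ?posrE ?powR_gt0//.
by apply: ge0_ler_powR; rewrite ?nnegrE ?(ltW x0) ?(ltW y0).
Qed.

Lemma sqr_powR (r s : R) : 0 <= r -> (r ^+ 2) `^ s = r `^ (2 * s).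
Proof. by move=> r0; rewrite -powR_mulrn// -powRrM. Qed.

(** The factor 9 comes from t + L <= 3 r. *)
Lemma annulus_powR (s r L t : R) : 0 <= s -> 0 <= L -> L <= r -> 0 < t -> t <= 2 * r ->
  9 `^ (- s) * r `^ (- (2 * s)) <= ((t + L) ^+ 2) `^ (- s).
Proof.
move=> s0 L0 Lr t0 tr.
have r0 : 0 <= r by apply: le_trans Lr.
have -> : 9 `^ (- s) * r `^ (- (2 * s)) = (9 * r ^+ 2) `^ (- s).
  by rewrite powRM ?sqr_ge0// sqr_powR// mulrN.
apply: powR_antitone => //; first by rewrite exprn_gt0// ltr_wpDr.
rewrite -(_ : (3 * r) ^+ 2 = 9 * r ^+ 2); last by rewrite exprMn -natrX.
by apply: lerXn2r; rewrite ?nnegrE ?mulr_ge0 ?addr_ge0 ?(ltW t0)//; lra.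
Qed.

End annulus.

(** * Bounding integrals by finite covers *)

Section covering.
Context d (T : measurableType d) (R : realType) (mu : {measure set T -> \bar R}).

(* No measurability is needed since the integral is a supremum over simple functions. *)
Lemma ge0_le_integral_nonmeasurable (f g : T -> \bar R) :
  (forall x, 0 <= f x)%E -> (forall x, f x <= g x)%E ->
  (\int[mu]_x f x <= \int[mu]_x g x)%E.
Proof.
move=> f0 fg; rewrite !ge0_integralTE//; last by move=> x; exact: le_trans (fg x).
apply: ge_ereal_sup => _ [h hf <-]; apply: ereal_sup_ubound; exists h => //.
by move=> x; exact: le_trans (fg x).
Qed.

Lemma integral_le_cover (S : set T) (U : T -> R) (I : finType) (k : I -> R) (Q : I -> set T) :
  (forall i, measurable (Q i)) -> (forall i, 0 <= k i) -> (forall x, 0 <= U x) ->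
  (forall x, S x -> exists2 i, Q i x & U x <= k i) ->
  (\int[mu]_(x in S) (U x)%:E <= \sum_i (k i)%:E * mu (Q i))%E.
Proof.
move=> mQ k0 U0 cov; rewrite integral_mkcond.
apply: (@le_trans _ _ (\int[mu]_x \sum_i (k i * \1_(Q i) x)%:E)%E).
  apply: ge0_le_integral_nonmeasurable => x; rewrite patchE; case: ifPn => // xS.
  - by rewrite lee_fin.
  - have [i Qx Ux] := cov x (set_mem xS).
    rewrite sumEFin lee_fin; apply: le_trans Ux _; rewrite (bigD1 i)//=.
    rewrite indicE mem_set// mulr1 lerDl; apply: sumr_ge0 => j _.
    by rewrite mulr_ge0.
  - by apply: sume_ge0 => i _; rewrite lee_fin mulr_ge0.
rewrite ge0_integral_sum//; last 2 first.
- by move=> i; apply/measurable_EFinP; exact: measurable_funM.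
- by move=> i x _; rewrite lee_fin mulr_ge0.
apply: lee_sum => i _; rewrite ge0_integralZR//.
by rewrite integral_indic// setIT.
Qed.

End covering.

Section harnack.
Context {R : realType} {d : nat}.

(** Near each point of [K] the function varies by less than a quarter of its value, and compactness
    makes the scale uniform. The second point may leave [K], as the centre of a grid cell may leave
    the ball that the cell meets. *)
Lemma compact_uniform_doubling (K : set 'rV[R]_d) (F : 'rV[R]_d -> R) : compact K ->
  continuous F -> (forall x, K x -> 0 < F x) ->
  exists2 e : R, 0 < e & forall x y, K x -> `|x - y| <= e -> F y <= 2 * F x /\ F x <= 2 * F y.
Proof.
move=> /compact_near_coveringP cK cF F0.
pose P (e : R) x := forall y, `|x - y| <= e -> F y <= 2 * F x /\ F x <= 2 * F y.
have [e /= e0 he] : \forall e \near (0 : R)^'+, K `<=` P e.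
  apply: cK => x Kx.
  have Fx4 : 0 < F x / 4 by rewrite divr_gt0// F0.
  have /cvgrPdist_lt/(_ _ Fx4)/nbhs_ballP[e /= e0 he] := cF x.
  have e20 : 0 < e / 2 by rewrite divr_gt0.
  exists (ball x (e / 2), [set t | t < e / 2]).
    by split => /=; [exact: nbhsx_ballx|exact: nbhs_right_lt].
  move=> [x' t] [/= hx ht] y /= xy.
  have hx' : `|x - x'| < e / 2 by move: hx; rewrite -ball_normE.
  have h1 : `|F x - F x'| < F x / 4.
    by apply: he; rewrite -ball_normE /=; apply: lt_le_trans hx' _; lra.
  have h2 : `|F x - F y| < F x / 4.
    apply: he; rewrite -ball_normE /= -(subrKA x').
    apply: le_lt_trans (ler_normD _ _) _.
    by rewrite [ltRHS](splitr e) ltrD// (le_lt_trans xy ht).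
  by move: h1 h2; rewrite !ltr_norml => /andP[? ?] /andP[? ?]; split; lra.
exists (e / 2); first by rewrite divr_gt0.
move=> x y Kx; apply: (he (e / 2)) => //=; last by rewrite divr_gt0.
by rewrite sub0r normrN gtr0_norm ?divr_gt0//; lra.
Qed.

End harnack.

(** * Grids of half-open cubes *)

Section grid.
Context {R : realType} {d : nat}.
Variables (z : 'rV[R]_d) (r : R) (N : nat).
Hypothesis r0 : 0 < r.
Local Notation s := (r / N.+1%:R : R).

(** Lower corners of the (N+1)^d cells of side r / (N+1) that tile the cube of side [r] centred at
    [z]. *)
Definition grid (k : {ffun 'I_d -> 'I_N.+1}) : 'rV[R]_d :=
  \row_j (z ord0 j - r / 2 + s * (k j)%:R).

Lemma grid_cover y : enorm (y - z) < r / 2 -> exists k, cube (grid k) s y.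
Proof.
move=> yz; have s0 : 0 < s by rewrite divr_gt0.
pose t (j : 'I_d) := (y ord0 j - z ord0 j + r / 2) / s.
have yzj j : - (r / 2) < y ord0 j - z ord0 j < r / 2.
  rewrite -ltr_norml; apply: le_lt_trans yz.
  by have := coord_le_enorm (y - z) j; rewrite !mxE.
have t0 j : 0 <= t j.
  by rewrite divr_ge0 ?(ltW s0)//; have /andP[] := yzj j; lra.
have tN j : (Num.truncn (t j) < N.+1)%N.
  rewrite truncn_lt_nat// /t ltr_pdivrMr// mulrCA divff// mulr1.
  by have /andP[] := yzj j; lra.
exists [ffun j => Ordinal (tN j)] => j; rewrite mxE ffunE/= in_itv/=.
have /andP[h1 h2] := truncn_itv (t0 j).
have E : s * t j = y ord0 j - z ord0 j + r / 2.
  by rewrite /t mulrC divfK// gt_eqF.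
have g1 : s * (Num.truncn (t j))%:R <= s * t j by rewrite ler_pM2l.
have g2 : s * t j < s * (Num.truncn (t j))%:R + s.
  by move: h2; rewrite -natr1 -(ltr_pM2l s0) mulrDr mulr1.
move: g1 g2; rewrite E; move: (s * (Num.truncn (t j))%:R) s => p s' g1 g2.
by apply/andP; split; lra.
Qed.

Lemma grid_inj k k' y : cube (grid k) s y -> cube (grid k') s y -> k = k'.
Proof.
move=> h h'; apply/ffunP => j; apply/val_inj => /=.
have s0 : 0 < s by rewrite divr_gt0.
have := h j; have := h' j; rewrite !mxE !in_itv/= => /andP[a1 a2] /andP[b1 b2].
suff le (i i' : nat) (c : R) : c + s * i%:R <= y ord0 j -> y ord0 j < c + s * i'%:R + s -> (i <= i')%N.
  by apply/eqP; rewrite eqn_leq (le _ _ _ b1 a2) (le _ _ _ a1 b2).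
move=> e1 e2; have : s * i%:R < s * i'.+1%:R.
  rewrite -(addn1 i') natrD mulrDr mulr1; move: (s * i%:R) (s * i'%:R) s e1 e2.
  by move=> *; lra.
by rewrite ltr_pM2l// ltr_nat ltnS.
Qed.

Definition grid_center k : 'rV[R]_d := \row_j (grid k ord0 j + s / 2).

(** Puts the balls on which barriers act into disjoint cells, so that at most one of them contains a
    given point. *)
Lemma grid_center_ball k y : enorm (y - grid_center k) < s / 2 -> cube (grid k) s y.
Proof.
move=> h j; have : `|y ord0 j - (grid k ord0 j + s / 2)| < s / 2.
  apply: le_lt_trans h; have := coord_le_enorm (y - grid_center k) j.
  by rewrite !mxE.
rewrite ltr_norml in_itv/=; move: s => s' /andP[h1 h2].
by apply/andP; split; lra.
Qed.

Lemma grid_center_norm k y : cube (grid k) s y -> `|y - grid_center k| <= s.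
Proof.
have s0 : 0 < s by rewrite divr_gt0.
move=> h; apply: norm_le_coord => [|j]; first exact: ltW.
have := h j; rewrite in_itv/= => /andP[h1 h2].
rewrite !mxE in h1 h2 *; rewrite ler_norml; move: s s0 h1 h2 => s' s0 h1 h2.
by apply/andP; split; lra.
Qed.

End grid.

(** * Estimates for a positive supersolution *)

Section supersolution.
Context {R : realType}.
Variables (d : nat) (alpha : R) (u F : 'rV[R]_d -> R).
Hypotheses (d1 : (1 <= d)%N) (al0 : 0 < alpha) (al2 : alpha < 2) (ald : alpha < d%:R).
Hypotheses (u_cl : classical alpha u) (u_ge0 : forall x, 0 <= u x).
Hypothesis F_gt0 : forall x, Bc x -> 0 < F x.
Hypothesis F_le : forall x, Bc x -> F x <= fraclap alpha u x.
Hypothesis u_gt0 : forall x, Bc x -> 0 < u x.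
Local Notation D := (d%:R / 2 : R).
Local Notation b := (D + alpha / 2).
Local Notation m := (D - alpha / 2).

Let a0 : 0 < alpha / 2. Proof. exact: divr_gt0. Qed.
Let a1 : alpha / 2 < 1. Proof. by rewrite ltr_pdivrMr// mul1r. Qed.
Let aD : alpha / 2 < D. Proof. by rewrite ltr_pM2r// invr_gt0. Qed.
Let m0 : 0 <= m. Proof. by rewrite subr_ge0 ltW. Qed.
Let m2 : - (2 * m) = alpha - d%:R. Proof. by field. Qed.
Let cu : continuous u. Proof. by case: u_cl. Qed.

Lemma supersolution_Jlim x : Bc x ->
  exists L, [/\ Jlim b u x L, 0 < L & F x <= fraclap_cst d alpha * L].
Proof.
move=> Bx; have := F_le Bx => h.
have [L [L0 E] cv] := fraclap_gt0P al0 al2 (lt_le_trans (F_gt0 Bx) h).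
exists L; split => //; last by rewrite -E.
by case: u_cl => _ _ L1u; exact: L1_Jlim.
Qed.

(** One barrier, over a ball where u >= M. The mass A = M l^(2m) / C makes its peak equal to [M], so
    the first alternative holds inside the ball; outside, the barrier asks only for a positive value
    of the operator. *)
Let single : exists c C r0, [/\ 0 < c, 0 < C, 8 <= r0 &
  forall (y : 'rV[R]_d) (L l M : R), r0 <= L -> 0 < l -> l <= L -> 0 <= M ->
    L ^+ 2 / 16 <= enorm2 y <= 4 * L ^+ 2 ->
    (forall x, enorm (x - y) < l -> M <= u x) ->
    forall x, r0 <= enorm x ->
    c / C * M * (l ^+ 2) `^ m * ((enorm x + L) ^+ 2) `^ (- m) <= u x].
Proof.
have [c [C [r0 [c0 C0 r08 H]]]] := supersolution_lower a0 a1 aD.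
exists c, C, r0; split => // y L l M rL l0 lL M0 yL hM x rx.
have l20 : 0 < l ^+ 2 by rewrite exprn_gt0.
pose A := M * (l ^+ 2) `^ m / C.
have A0 : 0 <= A by rewrite divr_ge0 ?mulr_ge0 ?powR_ge0 ?(ltW C0).
have := H unit (fun=> A) (fun=> y) L l u rL l0 lL (fun=> A0) (fun=> yL) u_ge0 cu.
have E (G : unit -> R) : \sum_i G i = G tt by rewrite (big_pred1 tt)// => -[].
rewrite E => /(_ _ x rx).
rewrite (_ : c * A = c / C * M * (l ^+ 2) `^ m); last by rewrite /A; ring.
apply => z z1; rewrite E; have [zy|zy] := ltP (enorm (z - y)) l.
  left; rewrite /A mulrCA divff ?gt_eqF// mulr1 -mulrA -(powR_addE l20 erefl).
  by rewrite subrr powRr0 mulr1; exact: hM.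
right; have [L' [JL L'0 _]] := supersolution_Jlim z1.
by exists L'; split => //; rewrite !mulr0.
Qed.

(** [single] at the fixed scale [r0], with [M] the positive minimum of [u] on that annulus. The
    threshold 4 * r0 puts the later annuli in |x| >= r0. *)
Lemma supersolution_decay : exists c r1, [/\ 0 < c, 8 <= r1 &
  forall r x, r1 <= r -> annulus r x -> c * r `^ (alpha - d%:R) <= u x].
Proof.
have [c [C [r0 [c0 C0 r08 H]]]] := single.
have r00 : 0 < r0 by lra.
have [y yr] := exists_enorm r0 d1.
have [M M0 hM] : exists2 M : R, 0 < M & forall x, annulus r0 x -> M <= u x.
  have cA := @compact_annulus R d r0.
  have [x xA hx] := @EVT_min_rV R d u (annulus r0) (annulus_neq0 d1 (ltW r00)) cA
    (continuous_subspaceT cu).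
  exists (u x); last by move=> z zA; apply: hx; rewrite inE.
  by apply: u_gt0; apply: (annulus_Bc r08); rewrite inE in xA.
have := H y r0 (r0 / 2) M (lexx _) (divr_gt0 r00 (ltr0Sn _ _)).
have r02 : r0 / 2 <= r0 by lra.
have y2 : r0 ^+ 2 / 16 <= enorm2 y <= 4 * r0 ^+ 2.
  by rewrite yr; have := sqr_ge0 r0 => ?; apply/andP; split; lra.
move=> /(_ r02 (ltW M0) y2) {}H.
have {}H x : r0 <= enorm x -> c / C * M * ((r0 / 2) ^+ 2) `^ m * ((enorm x + r0) ^+ 2) `^ (- m) <= u x.
  apply: H => z zy; apply: hM; apply: (annulus_near (ltW r00) yr).
  rewrite -sqr_enorm -(_ : (r0 / 2) ^+ 2 = r0 ^+ 2 / 4); last by field.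
  by apply: lerXn2r; rewrite ?nnegrE ?enorm_ge0 ?divr_ge0 ?(ltW r00) ?(ltW zy).
exists (c / C * M * ((r0 / 2) ^+ 2) `^ m * 9 `^ (- m)), (4 * r0); split.
- by rewrite !mulr_gt0 ?invr_gt0 ?powR_gt0 ?exprn_gt0 ?divr_gt0.
- by lra.
move=> r x rr xr; have /andP[x1 x2] := xr.
apply: le_trans (H x _); last by lra.
rewrite -mulrA; apply: ler_wpM2l.
  by rewrite !mulr_ge0 ?invr_ge0 ?powR_ge0 ?(ltW c0) ?(ltW C0) ?(ltW M0).
by rewrite -m2; apply: annulus_powR => //; lra.
Qed.

(** Here [single] is used at scale [r] and read off at a fixed point [x0]: the factors r^(2m) and
    (r0 + r)^(-2m) compensate each other, leaving [mu] times a constant below u(x0). *)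
Lemma supersolution_bounded : exists M r1, [/\ 0 <= M, 8 <= r1 &
  forall r mu, r1 <= r -> 0 <= mu -> (forall x, annulus r x -> mu <= u x) -> mu <= M].
Proof.
have [c [C [r0 [c0 C0 r08 H]]]] := single.
have r00 : 0 < r0 by lra.
have [x0 xr] := exists_enorm r0 d1.
have ex0 : enorm x0 = r0 by rewrite enormE xr sqrtr_sqr ger0_norm// ltW.
pose k := c / C * (4^-1 `^ m * 4 `^ (- m)).
have p4 : 0 < 4^-1 `^ m * 4 `^ (- m) :> R by apply: mulr_gt0; apply: powR_gt0.
have k0 : 0 < k by rewrite mulr_gt0// divr_gt0.
exists (u x0 / k), r0; split => //; first by rewrite divr_ge0// ltW.
move=> r mu rr mu0 hmu; have rp : 0 < r by lra.
rewrite ler_pdivlMr//.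
have [y yr] := exists_enorm r d1.
have r2 : r / 2 <= r by lra.
have y2 : r ^+ 2 / 16 <= enorm2 y <= 4 * r ^+ 2.
  by rewrite yr; have := sqr_ge0 r => ?; apply/andP; split; lra.
have := H y r (r / 2) mu rr (divr_gt0 rp (ltr0Sn _ _)) r2 mu0 y2.
have hin x : enorm (x - y) < r / 2 -> mu <= u x.
  move=> zy; apply: hmu; apply: (annulus_near (ltW rp) yr).
  rewrite -sqr_enorm -(_ : (r / 2) ^+ 2 = r ^+ 2 / 4); last by field.
  by apply: lerXn2r; rewrite ?nnegrE ?enorm_ge0 ?divr_ge0 ?(ltW rp) ?(ltW zy).
move=> /(_ hin x0); rewrite ex0 lexx => /(_ isT); apply: le_trans.
have r20 : 0 < r ^+ 2 by exact: exprn_gt0.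
have E1 : (r / 2) ^+ 2 = 4^-1 * r ^+ 2 by field.
have p1 : ((r / 2) ^+ 2) `^ m = 4^-1 `^ m * (r ^+ 2) `^ m.
  by rewrite E1 powRM// ltW.
have p2 : 4 `^ (- m) * (r ^+ 2) `^ (- m) <= ((r0 + r) ^+ 2) `^ (- m).
  rewrite -(powRM _ _ (ltW r20))//; apply: powR_antitone => //.
    by rewrite exprn_gt0// addr_gt0.
  rewrite -(_ : (2 * r) ^+ 2 = 4 * r ^+ 2); last by rewrite exprMn -natrX.
  by apply: lerXn2r; rewrite ?nnegrE ?mulr_ge0 ?addr_ge0 ?(ltW rp) ?(ltW r00)//; lra.
rewrite p1; have E2 : (r ^+ 2) `^ m * (r ^+ 2) `^ (- m) = 1.
  by rewrite -(powR_addE r20 erefl) subrr powRr0.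
have -> : mu * k = c / C * mu * (4^-1 `^ m * (r ^+ 2) `^ m) * (4 `^ (- m) * (r ^+ 2) `^ (- m)).
  have E3 (p q s t : R) : s * t = 1 ->
      mu * (c / C * (p * q)) = c / C * mu * (p * s) * (q * t).
    move=> st; transitivity (mu * (c / C * (p * q)) * (s * t)); first by rewrite st mulr1.
    by ring.
  exact: E3.
apply: ler_wpM2l => //.
by rewrite !mulr_ge0 ?invr_ge0 ?powR_ge0 ?(ltW c0) ?(ltW C0).
Qed.

(** This identity and the next do the bookkeeping of [supersolution_flux], with t = th, t2 = 2^d and
    sd = s^d. *)
Let cover_weight (kp Fk sd t t2 : R) : kp != 0 -> t != 0 -> t2 != 0 ->
  kp^-1 * (2 * Fk) * sd = kp^-1 * (2 * t2) / t * (t * (sd / t2) * Fk).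
Proof. by move=> *; field; apply/and3P. Qed.

Let total_weight (c n9 rm kp S t t2 : R) : kp != 0 -> t != 0 -> t2 != 0 ->
  c * n9 * t / (2 * t2) * rm * kp * (kp^-1 * (2 * t2) / t * S) = c * S * (n9 * rm).
Proof. by move=> *; field; apply/and3P. Qed.

(** A ball of radius r/4 centred on the sphere of radius [r] is covered by cells so small that [F]
    is nearly constant on each. Every cell carries a barrier of mass proportional to [F] times its
    volume, so the total mass controls the integral of kap U, hence kap times Phi. *)
Lemma supersolution_flux : continuous F -> exists c r1, [/\ 0 < c, 8 <= r1 &
  forall r kap (U : 'rV[R]_d -> R), r1 <= r -> 0 <= kap -> (forall x, 0 <= U x) ->
    (forall x, annulus r x -> kap * U x <= F x) ->
    forall x, annulus r x ->
    ((c * r `^ (alpha - d%:R) * kap)%:E * Phi U r <= (u x)%:E)%E].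
Proof.
move=> cF; have [c [C [r0 [c0 C0 r08 H]]]] := supersolution_lower a0 a1 aD.
have K0 := @fraclap_cst_gt0 R d alpha al0 al2; set K := fraclap_cst d alpha in K0.
(* [F] at the centre of a cell is at most 4 times [F] at any point of the cell (two doublings), and
   F <= K lu; the remaining factor 2 makes the comparison strict. *)
pose th := (8 * K)^-1; have th0 : 0 < th by rewrite invr_gt0 mulr_gt0.
have n9 : 0 < 9 `^ (- m) :> R by exact: powR_gt0.
have n2 : 0 < 2 ^+ d :> R by exact: exprn_gt0.
exists (c * 9 `^ (- m) * th / (2 * 2 ^+ d)), (4 * r0); split.
- by rewrite !mulr_gt0// invr_gt0 mulr_gt0.
- by lra.
move=> r kap U rr kap0 U0 hF x xA.
have [k0|kp] := eqVneq kap 0; first by rewrite k0 mulr0 mul0e lee_fin.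
have {}kp : 0 < kap by rewrite lt_neqAle eq_sym kp.
have r8 : 8 <= r by lra.
have rp : 0 < r by lra.
have FA w : annulus r w -> 0 < F w by move=> /(annulus_Bc r8); exact: F_gt0.
have [e e0 he] := compact_uniform_doubling (@compact_annulus R d r) cF FA.
have [z zr] := exists_enorm r d1.
have d0R : 0 < d%:R :> R by rewrite ltr0n.
pose rho := r / 2; have rho0 : 0 < rho by rewrite divr_gt0.
(* Below [e] the doubling property applies; below r / (4 d) the centres of the cells that meet the
   ball stay in the annulus. *)
pose eta := Num.min e (r / (4 * d%:R)).
have eta0 : 0 < eta by rewrite lt_min e0 divr_gt0// mulr_gt0.
pose N := Num.truncn (rho / eta).
pose s := rho / N.+1%:R.
have s0 : 0 < s by rewrite divr_gt0.
have s_eta : s <= eta.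
  rewrite /s ler_pdivrMr// mulrC -ler_pdivrMr//.
  by have /andP[_ /ltW] := truncn_itv (ltW (divr_gt0 rho0 eta0)).
have se : s <= e by apply: le_trans s_eta _; rewrite ge_min lexx.
have sd : d%:R * s <= r / 4.
  rewrite mulrC -ler_pdivlMr// -mulrA -invfM.
  by apply: le_trans s_eta _; rewrite ge_min lexx orbT.

pose S := eball z (r / 4).
have SA w : S w -> annulus r w.
  move=> Sw; apply: (annulus_near (ltW rp) zr); rewrite -sqr_enorm.
  have : enorm (w - z) ^+ 2 <= (r / 4) ^+ 2.
    by apply: lerXn2r; rewrite ?nnegrE ?enorm_ge0 ?divr_ge0 ?(ltW rp) ?(ltW Sw).
  rewrite expr_div_n -natrX; have := sqr_ge0 r; lra.
pose meets (k : {ffun 'I_d -> 'I_N.+1}) := `[< exists2 w, S w & cube (grid z rho k) s w >].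
(* Cells that miss the ball get mass 0 and the dummy centre [z], which lies in the annulus as the
   barrier lemma demands. *)
pose yk k := if meets k then grid_center z rho k else z.
pose l := s / 2; have l0 : 0 < l by rewrite divr_gt0.
have l20 : 0 < l ^+ 2 by exact: exprn_gt0.
pose A k := if meets k then th * (l ^+ 2) `^ D * F (yk k) else 0.
have ykw k w : meets k -> cube (grid z rho k) s w -> `|w - yk k| <= s.
  by rewrite /yk => ->; exact: grid_center_norm.
have yk_F k : meets k -> 0 < F (yk k).
  move=> mk; have /asboolP[w Sw Qw] := mk.
  have [_ h] := he w _ (SA w Sw) (le_trans (ykw k w mk Qw) se).
  by have := FA w (SA w Sw); lra.
have A0 k : 0 <= A k.
  by rewrite /A; case: ifP => // mk; rewrite !mulr_ge0 ?powR_ge0 ?(ltW th0)// ltW// yk_F.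
have yk_ann k : r ^+ 2 / 16 <= enorm2 (yk k) <= 4 * r ^+ 2.
  have r2 := sqr_ge0 r.
  case mk : (meets k); last by rewrite /yk mk zr; apply/andP; split; lra.
  have /asboolP[w Sw Qw] := mk.
  apply/(annulusE _ (ltW rp)); apply: (annulus_near (ltW rp) zr).
  rewrite -(subrKA w); apply: le_trans (enorm2D_le _ _) _.
  have h1 : enorm2 (yk k - w) <= (r / 4) ^+ 2.
    rewrite enorm2C -sqr_enorm; apply: lerXn2r; rewrite ?nnegrE ?enorm_ge0 ?divr_ge0 ?(ltW rp)//.
    apply: le_trans (enorm_le_norm _) _; apply: le_trans sd.
    by rewrite ler_wpM2l// ykw.
  have h2 : enorm2 (w - z) <= (r / 4) ^+ 2.
    rewrite -sqr_enorm.
    by apply: lerXn2r; rewrite ?nnegrE ?enorm_ge0 ?divr_ge0 ?(ltW rp) ?(ltW Sw).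
  by move: h1 h2; rewrite expr_div_n -natrX; lra.
have lr : l <= r.
  have d1R : 1 <= d%:R :> R by rewrite ler1n.
  have : s <= d%:R * s by rewrite ler_peMl// ltW.
  by rewrite /l; lra.
have E1 : (l ^+ 2) `^ (- D) * (l ^+ 2) `^ D = 1.
  by rewrite -(powR_addE l20 erefl) addNr powRr0.
have := H _ A yk r l u _ l0 lr A0 yk_ann u_ge0 cu.
have r0r : r0 <= r by lra.
move=> /(_ r0r) {}H.
have {}H : forall y, r0 <= enorm y ->
    c * (\sum_i A i) * ((enorm y + r) ^+ 2) `^ (- m) <= u y.
  apply: H => y y1; right; have [lu [Jlu lu0 Flu]] := supersolution_Jlim y1.
  exists lu; split => //.
  (* At most one barrier ball contains [y]: with none the sum is 0, with one it reduces to th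
     F(y_k). *)
  have [[k /andP[mk yk1]]|none] := pselect (exists k, meets k && (enorm (y - yk k) < l)); last first.
    rewrite big1 ?mulr0// => k _; case: ifP => yk1; last by rewrite mulr0.
    have -> : A k = 0 by rewrite /A; case: ifP => // mk; exfalso; apply: none; exists k; rewrite mk.
    by rewrite mul0r.
  have Qy : cube (grid z rho k) s y by apply: grid_center_ball; move: yk1; rewrite /yk mk.
  rewrite (bigD1 k)//= yk1 mulr1 big1 ?addr0; last first.
    move=> k' k'k; rewrite /A; case: ifPn => mk'; last by rewrite mul0r.
    case: ifPn => yk1'; last by rewrite mulr0.
    have Qy' : cube (grid z rho k') s y by apply: grid_center_ball; move: yk1'; rewrite /yk mk'.
    by move: k'k; rewrite (grid_inj rho0 Qy' Qy) eqxx.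
  rewrite /A mk mulrA mulrCA E1 mulr1.
  have /asboolP[w Sw Qw] := mk.
  have [h1 _] := he w _ (SA w Sw) (le_trans (ykw k w mk Qw) se).
  have wy : `|w - y| <= e.
    apply: le_trans se; apply: norm_le_coord => [|j]; first exact: ltW.
    rewrite [X in `|X|]mxE [X in _ + X]mxE.
    have := Qw j; have := Qy j; rewrite !in_itv/=.
    move: (grid z rho k ord0 j) (s) => g s' /andP[q1 q2] /andP[q3 q4].
    by rewrite ler_norml; apply/andP; split; lra.
  have [_ h2] := he w y (SA w Sw) wy.
  rewrite /th mulrC ltr_pdivrMr; last exact: mulr_gt0.
  rewrite (mulrCA lu 8) (mulrC lu K).
  have := mulr_gt0 K0 lu0; rewrite -/K in Flu.
  move: (K * lu) (F y) (F w) (F (yk k)) Flu h1 h2.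
  by move=> ? ? ? ? *; lra.
(* On a cell that meets the ball, U <= F / kap <= 2 F(y_k) / kap at points of the ball. The cell
   volume s^d is 2^d l^d, which matches the mass [A k]. *)
have SU : (\int[lebesgue_rV R d]_(w in S) (U w)%:E <=
    (\sum_k kap^-1 * (2 * 2 ^+ d) / th * A k)%:E)%E.
  pose kk k := if meets k then kap^-1 * (2 * F (yk k)) else 0.
  apply: le_trans (@integral_le_cover _ _ R (lebesgue_rV R d) S U _ kk
    (fun k => cube (grid z rho k) s) _ _ U0 _) _.
  - by move=> k; exact: measurable_cube.
  - move=> k; rewrite /kk; case: ifP => // mk.
    by rewrite mulr_ge0 ?invr_ge0 ?(ltW kp)// mulr_ge0// ltW// yk_F.
  - move=> w Sw; have [k Qw] : exists k : {ffun 'I_d -> 'I_N.+1}, cube (grid z rho k) s w.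
      apply: (@grid_cover R d z rho N rho0); apply: lt_le_trans Sw _.
      by rewrite /rho; lra.
    have mk : meets k by apply/asboolP; exists w.
    exists k => //; rewrite /kk mk ler_pdivlMl//.
    apply: le_trans (hF w (SA w Sw)) _.
    by have [] := he w _ (SA w Sw) (le_trans (ykw k w mk Qw) se).
  - rewrite -sumEFin; apply: lee_sum => k _.
    apply: (@le_trans _ _ ((kk k)%:E * (s ^+ d)%:E)%E).
      by rewrite -(lebesgue_rV_cube (grid z rho k) s0).
    rewrite -EFinM lee_fin.
    rewrite /kk /A; case: ifP => mk; last by rewrite mul0r mulr0.
    have -> : (l ^+ 2) `^ D = s ^+ d / 2 ^+ d.
      rewrite sqr_powR ?(ltW l0)// mulrCA divff ?mulr1// powR_mulrn ?(ltW l0)//.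
      exact: expr_div_n.
    rewrite le_eqVlt; apply/orP; left; apply/eqP.
    by apply: cover_weight; rewrite gt_eqF.
have PhiS : (Phi U r <= \int[lebesgue_rV R d]_(w in S) (U w)%:E)%E.
  apply: ereal_inf_lbound; exists z => //=.
  rewrite enormE zr sqrtr_sqr gtr0_norm//; apply/andP; split; lra.
have /andP[x1 x2] := xA.
apply: le_trans (lee_wpmul2l _ (le_trans PhiS SU)) _.
  rewrite lee_fin; apply: mulr_ge0 => //; apply: mulr_ge0; last exact: powR_ge0.
  apply: divr_ge0; last by apply: mulr_ge0; [|exact: ltW].
  by apply: mulr_ge0; [apply: mulr_ge0|]; exact: ltW.
rewrite -EFinM lee_fin; apply: le_trans (H x _); last by lra.
rewrite -mulr_sumr; have SA0 : 0 <= \sum_k A k by exact: sumr_ge0.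
have := @annulus_powR R m r r (enorm x) m0 (ltW rp) (lexx _) _ x2.
rewrite m2 => hp.
have {}hp : 9 `^ (- m) * r `^ (alpha - d%:R) <= ((enorm x + r) ^+ 2) `^ (- m).
  by apply: hp; lra.
apply: le_trans (ler_wpM2l (mulr_ge0 (ltW c0) SA0) hp).
rewrite le_eqVlt; apply/orP; left; apply/eqP.
by apply: total_weight; rewrite gt_eqF.
Qed.

End supersolution.

(** * The system *)

Section growth_contradiction.
Context {R : realType}.
Variables (c K t1 p q al be dd : R).
Hypotheses (c0 : 0 < c) (K0 : 0 < K) (t10 : 0 < t1) (p0 : 0 < p) (q0 : 0 < q).

(* Above [T1] and [T2] the minima with [t1] are inactive; [T3] and [T4] then give the
   contradiction for [p * q <= 1] and [p * q > 1] respectively. *)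
Let T1 : R := K / (c * t1 `^ p).
Let T2 : R := K / (c * t1 `^ q).
Let T3 : R := K `^ (1 - q * p) / (c * c `^ p).
Let ga : R := c * c `^ p * c `^ (q * p - 1).
Let T4 : R := (2 / ga) `^ p^-1.

Let min_small (s a x y : R) : 0 <= s -> 0 < a -> K / (c * t1 `^ s) < a -> y <= K ->
  c * a * Num.min x t1 `^ s <= y -> Num.min x t1 = x.
Proof.
move=> s0 a0 Ka yK h; have [//|t1x] := leP x t1; exfalso.
have ts : 0 < t1 `^ s by exact: powR_gt0.
move: h; rewrite (min_r (ltW t1x)) => h.
move: Ka; rewrite ltr_pdivrMr ?mulr_gt0//; rewrite mulrCA mulrA.
by rewrite ltNge => /negP; apply; apply: le_trans h yK.
Qed.

(** The arithmetic at one large radius: [M] and [N] are the annulus minima of u and v, [A] and [B]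
    the values of Phi for U and V, [K] bounds both minima, and [t1] is the range of the power bounds
    on f and g. The threshold [T] depends on none of the quantities at radius [r]. *)
Lemma growth_contradiction : exists T : R, forall r M N A B : R,
  0 < r -> 0 < M -> 0 < N -> 0 < A -> 0 < B -> M <= K -> N <= K ->
  c * r `^ (al - dd) <= M ->
  c * (r `^ (al - dd) * A) * Num.min N t1 `^ p <= M ->
  c * (r `^ (be - dd) * B) * Num.min M t1 `^ q <= N ->
  T <= r `^ (al - dd) * A -> T <= r `^ (be - dd) * B ->
  p * q <= 1 \/ T <= 1 / r `^ ((q + 1) * dd - be - al * q) * A `^ (1 / p) * B ->
  False.
Proof.
have T10 : 0 <= T1 by rewrite divr_ge0 ?(ltW K0)// mulr_ge0 ?powR_ge0// ltW.
have T20 : 0 <= T2 by rewrite divr_ge0 ?(ltW K0)// mulr_ge0 ?powR_ge0// ltW.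
have cp0 : 0 < c `^ p by exact: powR_gt0.
have ccp0 : 0 < c * c `^ p by exact: mulr_gt0.
have T30 : 0 <= T3 by rewrite divr_ge0 ?powR_ge0// ltW.
have T40 : 0 <= T4 by exact: powR_ge0.
have ga0 : 0 < ga by rewrite mulr_gt0// powR_gt0.
exists (1 + T1 + T2 + T3 + T4) => r M N A B r0 M0 N0 A0 B0 MK NK HB H1 H2 Ta Tb Tc.
have ra0 : 0 < r `^ (al - dd) by exact: powR_gt0.
have rb0 : 0 < r `^ (be - dd) by exact: powR_gt0.
set a := r `^ (al - dd) * A in H1 Ta; set b := r `^ (be - dd) * B in H2 Tb.
have a0 : 0 < a by exact: mulr_gt0.
have b0 : 0 < b by exact: mulr_gt0.
have a1 : T1 < a by move: (T1) (T2) (T3) (T4) T10 T20 T30 T40 Ta => *; lra.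
have b1 : T2 < b by move: (T1) (T2) (T3) (T4) T10 T20 T30 T40 Tb => *; lra.
have a3 : T3 < a by move: (T1) (T2) (T3) (T4) T10 T20 T30 T40 Ta => *; lra.
have b2 : 1 <= b by move: (T1) (T2) (T3) (T4) T10 T20 T30 T40 Tb => *; lra.
have E1 := min_small (ltW p0) a0 a1 MK H1; rewrite E1 in H1.
have E2 := min_small (ltW q0) b0 b1 NK H2; rewrite E2 in H2.
have qp0 : 0 < q * p by exact: mulr_gt0.
have Mqp0 : 0 < M `^ (q * p) by exact: powR_gt0.
have bp1 : 1 <= b `^ p.
  have E : 1 `^ p = 1 :> R by rewrite powR1.
  by rewrite -[leLHS]E; apply: ge0_ler_powR; rewrite ?nnegrE ?(ltW p0) ?(ltW b0).
(* The second flux inequality is inserted into the first, with both minima inactive. *)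
have key : c * c `^ p * (a * b `^ p) * M `^ (q * p) <= M.
  apply: le_trans H1; have : (c * b * M `^ q) `^ p <= N `^ p.
    have cbM : 0 <= c * b * M `^ q.
      by apply: mulr_ge0; [exact: (ltW (mulr_gt0 c0 b0))|exact: powR_ge0].
    by apply: ge0_ler_powR => //; rewrite ?nnegrE ?(ltW p0) ?(ltW N0).
  rewrite (powRM _ (ltW (mulr_gt0 c0 b0)) (powR_ge0 _ _)) (powRM _ (ltW c0) (ltW b0)) -powRrM.
  move=> /(ler_wpM2l (ltW (mulr_gt0 c0 a0))); apply: le_trans.
  rewrite le_eqVlt; apply/orP; left; apply/eqP.
  by move: (c `^ p) (b `^ p) (M `^ (q * p)) => ? ? ?; ring.
(* For pq <= 1, dividing [key] by M^(qp) bounds a b^p by a power of [K], against a > T3 and b >= 1.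
   For pq > 1 a power of [M] remains on the left, bounded below by the decay rate. *)
have [pq|pq] := leP (p * q) 1.
  have M1 : M = M `^ (1 - q * p) * M `^ (q * p).
    by rewrite -(powR_addE M0 erefl) subrK powRr1// ltW.
  move: key; rewrite {2}M1 ler_pM2r// => key.
  have h : M `^ (1 - q * p) <= K `^ (1 - q * p).
    by apply: ge0_ler_powR; rewrite ?nnegrE ?(ltW M0) ?(ltW K0)// mulrC subr_ge0.
  have : K `^ (1 - q * p) < c * c `^ p * (a * b `^ p).
    rewrite [ltRHS]mulrC -ltr_pdivrMr//; apply: lt_le_trans a3 _.
    by rewrite ler_peMr// ltW.
  by rewrite ltNge => /negP; apply; apply: le_trans h.
case: Tc => [pq'|Tc]; first by rewrite leNgt pq in pq'.
have M1 : M `^ (q * p) = M `^ (q * p - 1) * M.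
  have M1' : M = M `^ 1 by rewrite powRr1// ltW.
  by rewrite {3}M1' -(powR_addE M0 erefl) subrK.
move: key; rewrite M1 mulrA -[leRHS]mul1r ler_pM2r// => key.
have qp1 : 0 <= q * p - 1 by rewrite subr_ge0 mulrC ltW.
have h : c `^ (q * p - 1) * r `^ ((al - dd) * (q * p - 1)) <= M `^ (q * p - 1).
  rewrite powRrM -powRM ?(ltW c0) ?powR_ge0//; apply: ge0_ler_powR => //.
    by rewrite nnegrE mulr_ge0 ?powR_ge0 ?(ltW c0).
  by rewrite nnegrE ltW.
set X := 1 / _ * _ * B in Tc.
have X0 : 0 < X by rewrite mulr_gt0// mulr_gt0 ?powR_gt0// divr_gt0// powR_gt0.
(* The exponent of [r] in the growth condition is the one for which this identity holds; [T4] then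
   gives ga X^p >= 2, while [key] gives ga X^p <= 1. *)
have EX : X `^ p = a * b `^ p * r `^ ((al - dd) * (q * p - 1)).
  rewrite /X div1r -powRN.
  rewrite powRM ?mulr_ge0 ?powR_ge0 ?(ltW B0)// powRM ?powR_ge0// -!powRrM.
  rewrite div1r mulVf ?gt_eqF// powRr1 ?(ltW A0)//.
  rewrite /b /a powRM ?powR_ge0 ?(ltW B0)// -powRrM.
  have E3 : r `^ (- ((q + 1) * dd - be - al * q) * p) =
      r `^ (al - dd) * r `^ ((be - dd) * p) * r `^ ((al - dd) * (q * p - 1)).
    rewrite -(powR_addE r0 erefl); apply: (powR_addE r0); ring.
  rewrite E3; move: (r `^ (al - dd)) (r `^ ((be - dd) * p)) (r `^ ((al - dd) * (q * p - 1))) (B `^ p).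
  by move=> ? ? ? ?; ring.
have T4X : 2 / ga <= X `^ p.
  have -> : 2 / ga = T4 `^ p.
    by rewrite /T4 -powRrM mulVf ?gt_eqF// powRr1// divr_ge0// ltW.
  apply: ge0_ler_powR; rewrite ?nnegrE ?(ltW p0) ?(ltW X0)//.
  by apply: le_trans Tc; move: (T1) (T2) (T3) (T4) T10 T20 T30 => *; lra.
have : ga * X `^ p <= 1.
  apply: le_trans key; rewrite EX /ga.
  have g0 : 0 <= c * c `^ p * (a * b `^ p).
    by apply: mulr_ge0; [exact: ltW|apply: mulr_ge0; [exact: ltW|exact: powR_ge0]].
  apply: le_trans (ler_wpM2l g0 h).
  rewrite le_eqVlt; apply/orP; left; apply/eqP.
  move: (c `^ p) (b `^ p) (c `^ (q * p - 1)) (r `^ ((al - dd) * (q * p - 1))).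
  by move=> ? ? ? ?; ring.
rewrite -ler_pdivlMl// mulr1 => /(le_trans T4X).
by rewrite ler_pdivrMr// mulVf ?gt_eqF// => ?; lra.
Qed.

End growth_contradiction.

(** * The zero pair is a solution *)

Section zero_solution.
Context {R : realType} {d : nat}.

Lemma fraclap_cst0 (alpha : R) (x : 'rV[R]_d) : fraclap alpha (fun=> 0) x = 0.
Proof.
rewrite /fraclap [X in lim (X @ _)](_ : _ = fun=> 0); last first.
  apply/funext => e; under eq_Rintegral do rewrite subrr mul0r.
  rewrite /Rintegral integral0_eq//.
by rewrite lim_cst// mulr0.
Qed.

Lemma Ck_holder_cst0 k (theta : R) K : Ck_holder k theta K (fun _ : 'rV[R]_d => 0).
Proof.
elim: k => [|k IH]; split; try exact: (continuous_subspaceT (@cst_continuous _ _ _)).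
  by exists 0 => x y _ _; rewrite subrr normr0 mul0r.
move=> i; split=> [x _|]; first exact: derivable_cst.
rewrite (_ : 'D_ _ _ = fun=> 0)//.
by apply/funext => x; exact: derive_cst.
Qed.

Lemma classical_cst0 (alpha : R) : classical alpha (fun _ : 'rV[R]_d => 0).
Proof.
split.
- by move=> K _ _; exists 1 => //; exact: Ck_holder_cst0.
- exact: cst_continuous.
- rewrite /L1_omega; under eq_fun do rewrite mul0r; exact: integrable0.
Qed.

Lemma solution_cst0 (alpha beta : R) f g (u v : 'rV[R]_d -> R) :
  nonlinearity f -> nonlinearity g -> (forall x, u x = 0 /\ v x = 0) ->
  solution alpha beta f g u v.
Proof.
move=> [_ _ f0 _] [_ _ g0 _] uv0.
have -> : u = fun=> 0 by apply/funext => x; case: (uv0 x).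
have -> : v = fun=> 0 by apply/funext => x; case: (uv0 x).
split=> [||x _|x _|x]; try exact: classical_cst0.
- by rewrite f0 fraclap_cst0.
- by rewrite g0 fraclap_cst0.
- by [].
Qed.

End zero_solution.

Section system.
Context {R : realType} {d : nat}.
Implicit Types (x y : 'rV[R]_d) (f g : 'rV[R]_d -> R -> R) (u v U V : 'rV[R]_d -> R).

(** The condition at 0 covers arguments s <= t1, and monotonicity carries the bound to every t >= s.
    The two variables allow [s] to be a minimum truncated at [t1]. *)
Lemma liminf_ratio_lower f U (p : R) : nonlinearity f -> (forall x, 0 < U x) ->
  0 < p -> (0 < liminf_ratio f U p)%E ->
  exists c t1 : R, [/\ 0 < c, 0 < t1 &
    forall x t s, 0 <= t -> s <= t -> 0 <= s -> s <= t1 -> c * s `^ p * U x <= f x t].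
Proof.
move=> [_ fge0 f0 fmono] U0 p0; rewrite /liminf_ratio limf_einfE => /ereal_sup_gt[_ [V Vr <-]].
move=> Vinf.
have [c c0 hc] : exists2 c : R, 0 < c & forall x t, V t -> c <= f x t / (U x * t `^ p).
  set I := ereal_inf _ in Vinf.
  have hI x t : V t -> (I <= (f x t / (U x * t `^ p))%:E)%E.
    move=> Vt; apply: le_trans (ereal_inf_lbound _) _; first by exists t.
    by apply: ereal_inf_lbound; exists x.
  case: I Vinf hI => [r| |//] r0 hI.
    by exists r => // x t Vt; rewrite -lee_fin; exact: hI.
  (* An infinite infimum would mean that no [t] lies in [V], the quotients being real; any constant
     then works. *)
  by exists 1 => // x t Vt; have := hI x t Vt.
move: Vr => [e /= e0 he].
exists c, (e / 2); split => //; first by rewrite divr_gt0.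
move=> x t s t0 st s0 se; have [->|sn0] := eqVneq s 0.
  by rewrite powR0 ?gt_eqF// mulr0 mul0r; exact: fge0.
have sp : 0 < s by rewrite lt_neqAle eq_sym sn0.
apply: le_trans (fmono x s t s0 st).
have Vs : V s.
  apply: he => //=; rewrite sub0r normrN gtr0_norm//; lra.
have := hc x s Vs; rewrite ler_pdivlMr; last by rewrite mulr_gt0// powR_gt0.
by rewrite mulrA (mulrAC c (U x)).
Qed.

(** Continuity of [f] on t >= 0 only is enough because the graph of [v] stays in that set. *)
Lemma nonlinearity_continuous f v : nonlinearity f -> continuous v ->
  (forall x, 0 <= v x) -> continuous (fun x => f x (v x)).
Proof.
move=> [/subspace_continuousP cf _ _ _] cv v0 x B /= nB.
have c1 : (fun y : 'rV[R]_d => (y, v y)) @ x --> (x, v x).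
  exact: (@cvg_pair _ _ _ (nbhs x) (nbhs x) (nbhs (v x)) (nbhs_filter x) (nbhs_filter x)
    (nbhs_filter (v x)) (fun y => y) v cvg_id (cv x)).
have := c1 _ (cf (x, v x) (v0 x) B nB).
by apply: (@filterS _ _ (nbhs_filter x)) => y /= /(_ (v0 y)).
Qed.

(** A zero of [u] outside B would make u vanish identically. A zero of [v] would make v vanish
    identically, with operator 0, against g(x, u) > 0. *)
Lemma solution_gt0 (alpha beta : R) f g u v : (1 <= d)%N ->
  0 < alpha -> alpha < 2 -> 0 < beta -> beta < 2 ->
  (forall x t, 0 <= t -> 0 <= f x t) -> (forall x t, 0 < t -> 0 < g x t) ->
  solution alpha beta f g u v -> (exists x, u x != 0) ->
  forall x, Bc x -> 0 < u x /\ 0 < v x.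
Proof.
move=> d1 al0 al2 be0 be2 f0 g0 [cu cv fu gv uv0] [x0 ux0].
have up x : Bc x -> 0 < u x.
  move=> Bx; have [ux vx] := uv0 x; rewrite lt_neqAle ux andbT eq_sym; apply/eqP => ux00.
  have h : 0 <= fraclap alpha u x by apply: le_trans (fu x Bx); exact: f0.
  have /(_ x0) := strong_maximum d1 al0 al2 cu (fun y => (uv0 y).1) Bx ux00 h.
  by move/eqP; rewrite (negbTE ux0).
move=> x Bx; split; first exact: up.
have [ux vx] := uv0 x; rewrite lt_neqAle vx andbT eq_sym; apply/eqP => vx00.
have h : 0 < fraclap beta v x by apply: lt_le_trans (gv x Bx); apply: g0; exact: up.
have vz := strong_maximum d1 be0 be2 cv (fun y => (uv0 y).2) Bx vx00 (ltW h).
by move: h; rewrite (_ : v = fun=> 0) ?fraclap_cst0 ?ltxx//; apply/funext.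
Qed.

Lemma annulus_min u (r : R) : (1 <= d)%N -> 0 <= r -> continuous u ->
  exists2 x, annulus r x & forall y, annulus r y -> u x <= u y.
Proof.
move=> d1 r0 cu; have [x xA hx] := @EVT_min_rV R d u (annulus r) (annulus_neq0 d1 r0)
  (@compact_annulus R d r) (continuous_subspaceT cu).
by exists x => [|y yA]; [rewrite inE in xA|apply: hx; rewrite inE].
Qed.

(** Rules out an infinite Phi: the flux estimate bounds a positive multiple of it by a real
    number. *)
Lemma mule_le_fin (k x y : R) (I : \bar R) : 0 < k -> (k%:E * I <= y%:E)%E ->
  (x%:E <= I)%E -> exists2 A : R, I = A%:E & k * A <= y /\ x <= A.
Proof.
move=> k0; case: I => [A| |//]; last by rewrite gt0_muley ?lte_fin.
by rewrite -EFinM !lee_fin; exists A.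
Qed.

(** The growth of Phi is stated as eventual lower bounds in product form, free of quotients of
    extended reals. All estimates are then taken at one large [r] and passed to
    [growth_contradiction]. *)
Lemma no_nontrivial_solution (alpha beta : R) f g (p q : R) U V u v : (1 <= d)%N ->
  0 < alpha -> alpha < 2 -> alpha < d%:R -> 0 < beta -> beta < 2 -> beta < d%:R ->
  nonlinearity f -> nonlinearity g -> 0 < p -> 0 < q ->
  (forall x, 0 < U x) -> (forall x, 0 < V x) ->
  (0 < liminf_ratio f U p)%E -> (0 < liminf_ratio g V q)%E ->
  (forall T : R, \forall r \near +oo, ((T * r `^ (d%:R - alpha))%:E <= Phi U r)%E) ->
  (forall T : R, \forall r \near +oo, ((T * r `^ (d%:R - beta))%:E <= Phi V r)%E) ->
  p * q <= 1 \/ (forall T : R, \forall r \near +oo,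
    (T%:E <= (1 / r `^ ((q + 1) * d%:R - beta - alpha * q))%:E *
       (Phi U r `^ (1 / p)) * Phi V r)%E) ->
  solution alpha beta f g u v -> ~ (forall x, Bc x -> 0 < u x /\ 0 < v x).
Proof.
move=> d1 al0 al2 ald be0 be2 bed fnl gnl p0 q0 U0 V0 fl gl HU HV Hc [clu clv fu gv uv0] pos.
have u0 x := (uv0 x).1; have v0 x := (uv0 x).2.
have up x (Bx : Bc x) := (pos x Bx).1; have vp x (Bx : Bc x) := (pos x Bx).2.
have cu : continuous u by case: clu.
have cv : continuous v by case: clv.
have [cf [tf [cf0 tf0 hf]]] := liminf_ratio_lower fnl U0 p0 fl.
have [cg [tg [cg0 tg0 hg]]] := liminf_ratio_lower gnl V0 q0 gl.
pose F x := f x (v x); pose G x := g x (u x).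
have cF : continuous F by exact: nonlinearity_continuous.
have cG : continuous G by exact: nonlinearity_continuous.
have F0 x : Bc x -> 0 < F x.
  move=> /vp vx; have sx : 0 < Num.min (v x) tf by rewrite lt_min vx.
  apply: lt_le_trans (hf x (v x) (Num.min (v x) tf) (v0 x) _ (ltW sx) _).
  - by rewrite !mulr_gt0// powR_gt0.
  - by rewrite ge_min lexx.
  - by rewrite ge_min lexx orbT.
have G0 x : Bc x -> 0 < G x.
  move=> /up ux; have sx : 0 < Num.min (u x) tg by rewrite lt_min ux.
  apply: lt_le_trans (hg x (u x) (Num.min (u x) tg) (u0 x) _ (ltW sx) _).
  - by rewrite !mulr_gt0// powR_gt0.
  - by rewrite ge_min lexx.
  - by rewrite ge_min lexx orbT.
have [c1 [r1 [c10 _ h1]]] := supersolution_decay d1 al0 al2 ald clu u0 F0 fu up.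
have [Ku [r2 [Ku0 _ h2]]] := supersolution_bounded d1 al0 al2 ald clu u0 F0 fu.
have [Kv [r3 [Kv0 _ h3]]] := supersolution_bounded d1 be0 be2 bed clv v0 G0 gv.
have [cu' [r4 [cu0 _ h4]]] := supersolution_flux d1 al0 al2 ald clu u0 F0 fu cF.
have [cv' [r5 [cv0 _ h5]]] := supersolution_flux d1 be0 be2 bed clv v0 G0 gv cG.
pose c := Num.min c1 (Num.min (cu' * cf) (cv' * cg)).
have c0 : 0 < c by rewrite !lt_min c10 !mulr_gt0.
have cc1 : c <= c1 by rewrite /c ge_min lexx.
have cc2 : c <= cu' * cf by rewrite /c !ge_min lexx orbT.
have cc3 : c <= cv' * cg by rewrite /c !ge_min lexx !orbT.
pose K := Ku + Kv + 1.
have K0 : 0 < K by rewrite ltr_pwDr// addr_ge0.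
have KuK : Ku <= K by rewrite /K -addrA lerDl addr_ge0.
have KvK : Kv <= K by rewrite /K (addrC Ku) -addrA lerDl addr_ge0.
pose t1 := Num.min tf tg; have t10 : 0 < t1 by rewrite lt_min tf0.
have [T HT] := growth_contradiction alpha beta d%:R c0 K0 t10 p0 q0.
(* Replaced by a positive number, so that the lower bounds also give A > 0 and B > 0. *)
pose T' := Num.max T 1; have TT' : T <= T' by rewrite le_max lexx.
have T'0 : 0 < T' by rewrite lt_max ltr01 orbT.
have {}Hc : \forall r \near +oo, p * q <= 1 \/
    (T%:E <= (1 / r `^ ((q + 1) * d%:R - beta - alpha * q))%:E *
       (Phi U r `^ (1 / p)) * Phi V r)%E.
  by case: Hc => [h|/(_ T)]; [apply: nearW; left|apply: filterS => r; right].
have nge (s : R) : \forall r \near +oo, s <= r by apply: nbhs_pinfty_ge; exact: num_real.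
near (pinfty_nbhs R) => r.
have rp : 0 < r by near: r; exact: nbhs_pinfty_gt.
have rr1 : r1 <= r by near: r; exact: nge.
have rr2 : r2 <= r by near: r; exact: nge.
have rr3 : r3 <= r by near: r; exact: nge.
have rr4 : r4 <= r by near: r; exact: nge.
have rr5 : r5 <= r by near: r; exact: nge.
have [xu xuA hxu] := annulus_min d1 (ltW rp) cu.
have [xv xvA hxv] := annulus_min d1 (ltW rp) cv.
have r8 : 8 <= r by near: r; exact: nge.
set M := u xu in hxu; set N := v xv in hxv.
have M0 : 0 < M by apply: up; exact: annulus_Bc xuA.
have N0 : 0 < N by apply: vp; exact: annulus_Bc xvA.
have ra0 : 0 < r `^ (alpha - d%:R) by exact: powR_gt0.
have rb0 : 0 < r `^ (beta - d%:R) by exact: powR_gt0.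
have sN0 : 0 < Num.min N t1 `^ p by rewrite powR_gt0// lt_min N0.
have sM0 : 0 < Num.min M t1 `^ q by rewrite powR_gt0// lt_min M0.
have hU : ((T' * r `^ (d%:R - alpha))%:E <= Phi U r)%E by near: r; exact: HU.
have hV : ((T' * r `^ (d%:R - beta))%:E <= Phi V r)%E by near: r; exact: HV.
(* The flux estimate with kap = cf * min(N, t1)^p: on the annulus v >= N, so f(x, v) >= kap U. *)
have fluxU : ((cu' * r `^ (alpha - d%:R) * (cf * Num.min N t1 `^ p))%:E * Phi U r <= M%:E)%E.
  apply: h4 => //.
  - by rewrite mulr_ge0// ltW.
  - by move=> x; exact: ltW.
  - move=> x xA; apply: hf => //; first by rewrite ge_min hxv.
      by rewrite le_min (ltW N0) ltW.
    by rewrite ge_min /t1 ge_min lexx orbT.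
have fluxV : ((cv' * r `^ (beta - d%:R) * (cg * Num.min M t1 `^ q))%:E * Phi V r <= N%:E)%E.
  apply: h5 => //.
  - by rewrite mulr_ge0// ltW.
  - by move=> x; exact: ltW.
  - move=> x xA; apply: hg => //; first by rewrite ge_min hxu.
      by rewrite le_min (ltW M0) ltW.
    by rewrite ge_min /t1 ge_min lexx !orbT.
have [A EA [HA TA]] := mule_le_fin (mulr_gt0 (mulr_gt0 cu0 ra0) (mulr_gt0 cf0 sN0)) fluxU hU.
have [B EB [HB TB]] := mule_le_fin (mulr_gt0 (mulr_gt0 cv0 rb0) (mulr_gt0 cg0 sM0)) fluxV hV.
have A0 : 0 < A by apply: lt_le_trans TA; rewrite mulr_gt0// powR_gt0.
have B0 : 0 < B by apply: lt_le_trans TB; rewrite mulr_gt0// powR_gt0.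
have cancel (s : R) : r `^ (s - d%:R) * r `^ (d%:R - s) = 1.
  by rewrite -(powR_addE rp erefl) addrC subrKA subrr powRr0.
apply: (HT r M N A B) => //.
- by apply: le_trans KuK; apply: (h2 r) => //; exact: ltW.
- by apply: le_trans KvK; apply: (h3 r) => //; exact: ltW.
- apply: le_trans (h1 r xu rr1 xuA).
  by rewrite ler_pM2r.
- apply: le_trans HA; move: (r `^ _) (_ `^ p) ra0 sN0 => ra sN ra0 sN0.
  have -> : cu' * ra * (cf * sN) * A = cu' * cf * (ra * A * sN) by ring.
  by rewrite -mulrA ler_pM2r// !mulr_gt0.
- apply: le_trans HB; move: (r `^ _) (_ `^ q) rb0 sM0 => rb sM rb0 sM0.
  have -> : cv' * rb * (cg * sM) * B = cv' * cg * (rb * B * sM) by ring.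
  by rewrite -mulrA ler_pM2r// !mulr_gt0.
- move: TA => /(ler_wpM2l (ltW ra0)); rewrite mulrCA cancel mulr1; exact: le_trans.
- move: TB => /(ler_wpM2l (ltW rb0)); rewrite mulrCA cancel mulr1; exact: le_trans.
- have [h|] : p * q <= 1 \/ (T%:E <= (1 / r `^ ((q + 1) * d%:R - beta - alpha * q))%:E *
       (Phi U r `^ (1 / p)) * Phi V r)%E by near: r; exact: Hc.
    by left.
  by rewrite EA EB poweR_EFin -!EFinM lee_fin; right.
Unshelve. all: by end_near.
Qed.

End system.

(** * Lower bounds for Phi *)

Section Phi_facts.
Context {R : realType} {d : nat}.
Implicit Types (x y : 'rV[R]_d) (U : 'rV[R]_d -> R).

Lemma Phi_ge0 U r : (forall x, 0 <= U x) -> (0 <= Phi U r)%E.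
Proof.
move=> U0; apply: le_ereal_inf_tmp => _ [x _ <-].
by apply: integral_ge0 => y _; rewrite lee_fin.
Qed.

(** The extended quotient is undone case by case: for Phi = 0 it is +oo, against the hypothesis, and
    for Phi = +oo the conclusion is trivial. *)
Lemma Phi_lower_of_ratio U (k r e : R) : (forall x, 0 <= U x) -> 0 < k -> 0 < e ->
  (k%:E / Phi U r < e%:E)%E -> ((e^-1 * k)%:E <= Phi U r)%E.
Proof.
move=> U0 k0 e0; have := Phi_ge0 r U0; case: (Phi U r) => [A| |//]; last by move=> *; rewrite leey.
rewrite !lee_fin /inve; case: eqVneq => [->|An0] A0.
  by rewrite gt0_muley ?lte_fin.
have A1 : 0 < A by rewrite lt_neqAle eq_sym An0.
by rewrite -EFinM lte_fin ltr_pdivrMr// => h; rewrite ler_pdivrMl// ltW.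
Qed.

(** A cube of side r / (8 d) fits into the ball of radius r/4, and for r > 4 that ball avoids B, as
    |y|^2 >= |x|^2 / 2 - |x - y|^2 >= r^2 / 16. *)
Lemma Phi_ge_scale U (c1 : R) : (1 <= d)%N -> (forall x, 0 <= U x) -> 0 <= c1 ->
  (forall x, Bc x -> c1 <= U x) ->
  forall r, 4 < r -> ((c1 * ((8 * d%:R)^-1 * r) ^+ d)%:E <= Phi U r)%E.
Proof.
move=> d1 U0 c10 hU r r4; have r0 : 0 < r by lra.
have d0R : 0 < d%:R :> R by rewrite ltr0n.
set s := (8 * d%:R)^-1 * r; have s0 : 0 < s by rewrite mulr_gt0// invr_gt0 mulr_gt0.
have ds : d%:R * s = r / 8.
  by rewrite /s invfM; field; rewrite gt_eqF.
apply: le_ereal_inf_tmp => _ [x /= /andP[x1 _] <-].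
have QS y : cube x s y -> eball x (r / 4) y.
  move=> Qy; apply: le_lt_trans (enorm_le_norm _) _.
  apply: (@le_lt_trans _ _ (d%:R * s)); last by rewrite ds; lra.
  by rewrite ler_wpM2l// cube_norm// ltW.
have UB y : eball x (r / 4) y -> c1 <= U y.
  move=> Sy; apply: hU; rewrite /Bc/= lt_enorm// expr1n.
  have h := enorm2D_le (x - y) y; rewrite subrK in h.
  have h1 : (r / 2) ^+ 2 <= enorm2 x.
    by rewrite -sqr_enorm; apply: lerXn2r; rewrite ?nnegrE ?enorm_ge0 ?divr_ge0 ?(ltW r0).
  have h2 : enorm2 (x - y) <= (r / 4) ^+ 2.
    rewrite enorm2C -sqr_enorm.
    by apply: lerXn2r; rewrite ?nnegrE ?enorm_ge0 ?divr_ge0 ?(ltW r0) ?(ltW Sy).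
  by nra.
apply: (@le_trans _ _ (\int[lebesgue_rV R d]_(y in cube x s) c1%:E)%E).
  rewrite integral_cst; last exact: measurable_cube.
  by rewrite EFinM -(lebesgue_rV_cube x s0).
rewrite [leLHS]integral_mkcond [leRHS]integral_mkcond.
apply: ge0_le_integral_nonmeasurable => y; rewrite !patchE.
  by case: ifP => _; rewrite lee_fin.
case: ifPn => [/set_mem Qy|_]; last by case: ifP => _; rewrite lee_fin.
by rewrite mem_set ?lee_fin; [exact/UB/QS|exact: QS].
Qed.

Lemma Phi_growth U (c1 al : R) : (1 <= d)%N -> 0 < al -> (forall x, 0 <= U x) -> 0 < c1 ->
  (forall x, Bc x -> c1 <= U x) -> forall T : R,
  \forall r \near +oo, ((T * r `^ (d%:R - al))%:E <= Phi U r)%E.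
Proof.
move=> d1 al0 U0 c10 hU T.
have d0R : 0 < d%:R :> R by rewrite ltr0n.
pose k := c1 * (8 * d%:R)^-1 ^+ d.
have k0 : 0 < k by rewrite mulr_gt0// exprn_gt0// invr_gt0 mulr_gt0.
have nge (s : R) : \forall r \near +oo, s < r by apply: nbhs_pinfty_gt; exact: num_real.
near=> r; have r4 : 4 < r by near: r; exact: nge.
(* From here on r^al is at least T / k, so k r^d = k r^al r^(d - al) wins. *)
have rT : `|k^-1 * T| `^ al^-1 < r by near: r; exact: nge.
have r0 : 0 < r by lra.
apply: le_trans (Phi_ge_scale d1 U0 (ltW c10) hU r4); rewrite lee_fin exprMn mulrA -/k.
have -> : r ^+ d = r `^ al * r `^ (d%:R - al).
  by rewrite -(powR_addE r0 erefl) addrC subrK powR_mulrn// ltW.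
rewrite mulrA; apply: ler_wpM2r; first exact: powR_ge0.
rewrite -ler_pdivrMl//.
apply: (@le_trans _ _ (`|k^-1 * T| `^ al^-1 `^ al)).
  by rewrite -powRrM mulVf ?gt_eqF// powRr1 ?ler_norm.
by apply: ge0_ler_powR; rewrite ?nnegrE ?powR_ge0 ?(ltW r0) ?(ltW al0) ?(ltW rT).
Unshelve. all: by end_near.
Qed.

End Phi_facts.

Section trivial_solution.
Context {R : realType} {d : nat}.
Implicit Types (f g : 'rV[R]_d -> R -> R) (u v U V : 'rV[R]_d -> R).

Lemma solution_swap (alpha beta : R) f g u v :
  solution alpha beta f g u v -> solution beta alpha g f v u.
Proof. by move=> [? ? ? ? h]; split => // x; have [] := h x. Qed.

(** A nonzero pair has a nonzero component, and [solution_gt0], applied to the system or to its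
    mirror image, makes both components positive outside B. *)
Lemma only_trivial_solution_of_growth (alpha beta : R) f g (p q : R) U V : (1 <= d)%N ->
  0 < alpha -> alpha < 2 -> alpha < d%:R -> 0 < beta -> beta < 2 -> beta < d%:R ->
  nonlinearity f -> nonlinearity g -> 0 < p -> 0 < q ->
  (forall x, 0 < U x) -> (forall x, 0 < V x) ->
  (0 < liminf_ratio f U p)%E -> (0 < liminf_ratio g V q)%E ->
  (forall T : R, \forall r \near +oo, ((T * r `^ (d%:R - alpha))%:E <= Phi U r)%E) ->
  (forall T : R, \forall r \near +oo, ((T * r `^ (d%:R - beta))%:E <= Phi V r)%E) ->
  [\/ p * q <= 1,
    forall T : R, \forall r \near +oo,
      (T%:E <= (1 / r `^ ((q + 1) * d%:R - beta - alpha * q))%:E *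
        (Phi U r `^ (1 / p)) * Phi V r)%E |
    forall T : R, \forall r \near +oo,
      (T%:E <= (1 / r `^ ((p + 1) * d%:R - beta * p - alpha))%:E *
        Phi U r * (Phi V r `^ (1 / q)))%E] ->
  only_trivial_solution alpha beta f g.
Proof.
move=> d1 al0 al2 ald be0 be2 bed fnl gnl p0 q0 U0 V0 fl gl HU HV Hc u v.
split; last exact: solution_cst0.
have pos (h : 'rV[R]_d -> R -> R) (W : 'rV[R]_d -> R) (s : R) : nonlinearity h -> (forall x, 0 < W x) -> 0 < s ->
    (0 < liminf_ratio h W s)%E -> forall x t, 0 < t -> 0 < h x t.
  move=> hnl W0 s0 hl x t t0; have [c [t1 [c0 t10 H]]] := liminf_ratio_lower hnl W0 s0 hl.
  have m0 : 0 < Num.min t t1 by rewrite lt_min t0.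
  apply: lt_le_trans (H x t (Num.min t t1) (ltW t0) _ (ltW m0) _).
  - by rewrite !mulr_gt0// powR_gt0.
  - by rewrite ge_min lexx.
  - by rewrite ge_min lexx orbT.
have fpos := pos _ _ _ fnl U0 p0 fl; have gpos := pos _ _ _ gnl V0 q0 gl.
move=> sol.
have N : ~ (forall x, Bc x -> 0 < u x /\ 0 < v x).
  case: Hc => [pq|H|H].
  - by apply: no_nontrivial_solution fl gl HU HV _ sol => //; left.
  - by apply: no_nontrivial_solution fl gl HU HV _ sol => //; right.
  (* The second growth condition is the first one for the system with the two equations
     exchanged. *)
  move=> uv; apply: (no_nontrivial_solution (alpha := beta) (beta := alpha) (p := q) (q := p)
    (U := V) (V := U) d1 be0 be2 bed al0 al2 ald gnl fnl q0 p0 V0 U0 gl fl HV HU _ (solution_swap sol)).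
    right => T; apply: filterS (H T) => r.
    by rewrite muleAC (_ : (p + 1) * d%:R - beta * p - alpha = (p + 1) * d%:R - alpha - beta * p)//; ring.
  by move=> x /uv[].
have fge0 x t : 0 <= t -> 0 <= f x t by case: fnl => _ h _ _; exact: h.
have gge0 x t : 0 <= t -> 0 <= g x t by case: gnl => _ h _ _; exact: h.
apply: contrapT => /existsNP[x nz]; apply: N.
have [ux|ux] := eqVneq (u x) 0; last first.
  by apply: (solution_gt0 d1 al0 al2 be0 be2 fge0 gpos sol); exists x.
have vx : v x != 0 by apply/eqP => vx; exact: nz.
move=> y By; have [] := solution_gt0 d1 be0 be2 al0 al2 gge0 fpos (solution_swap sol) _ By.
  by exists x.
by [].
Qed.

End trivial_solution.

Theorem theorem2p1 (R : realType) (d : nat) (d_ge1 : (1 <= d)%N)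
  (alpha beta : R)
  (alpha_range : 0 < alpha < Num.min 2 d%:R)
  (beta_range : 0 < beta < Num.min 2 d%:R)
  (f g : 'rV[R]_d -> R -> R) (f_nl : nonlinearity f) (g_nl : nonlinearity g)
  (p q : R) (p_gt0 : 0 < p) (q_gt0 : 0 < q)
  (U V : 'rV[R]_d -> R)
  (U_meas : lebesgue_measurable U) (V_meas : lebesgue_measurable V)
  (U_gt0 : forall x, 0 < U x) (V_gt0 : forall x, 0 < V x)
  (f_liminf : (0 < liminf_ratio f U p)%E)
  (g_liminf : (0 < liminf_ratio g V q)%E) :
  ((maxe ((r `^ (d%:R - alpha))%:E / Phi U r)
         ((r `^ (d%:R - beta))%:E / Phi V r))%E @[r --> +oo] --> 0%E ->
   (((1 / r `^ ((q + 1) * d%:R - beta - alpha * q))%:E *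
       (Phi U r `^ (1 / p)) * Phi V r)%E @[r --> +oo] --> +oo%E \/
    ((1 / r `^ ((p + 1) * d%:R - beta * p - alpha))%:E *
       Phi U r * (Phi V r `^ (1 / q)))%E @[r --> +oo] --> +oo%E) ->
   only_trivial_solution alpha beta f g) /\
  (p * q <= 1 ->
   (exists2 c1 : R, 0 < c1 & forall x, Bc x -> c1 <= Num.min (U x) (V x)) ->
   only_trivial_solution alpha beta f g).
Proof.
move: alpha_range beta_range; rewrite !lt_min => /and3P[al0 al2 ald] /and3P[be0 be2 bed].
have core := only_trivial_solution_of_growth d_ge1 al0 al2 ald be0 be2 bed f_nl g_nl
  p_gt0 q_gt0 U_gt0 V_gt0 f_liminf g_liminf.
have U0 x : 0 <= U x by exact: ltW.
have V0 x : 0 <= V x by exact: ltW.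
split=> [H0 Hc|pq [c1 c10 hc1]].
  have ev (T : R) : \forall r \near +oo, ((T * r `^ (d%:R - alpha))%:E <= Phi U r)%E /\
      ((T * r `^ (d%:R - beta))%:E <= Phi V r)%E.
    (* The maximum with 1 makes the tolerance positive for every [T]; a maximum below [e] bounds
       both quotients. *)
    pose e := (Num.max T 1)^-1; have m0 : 0 < Num.max T 1 by rewrite lt_max ltr01 orbT.
    have e0 : 0 < e by rewrite invr_gt0.
    have Tm : T <= e^-1 by rewrite invrK le_max lexx.
    have N : nbhs 0%E [set y : \bar R | (y < e%:E)%E].
      by apply: open_nbhs_nbhs; split; [exact: open_ereal_lt_ereal|rewrite /= lte_fin].
    have rp : \forall r \near +oo, (0 : R) < r by exact: nbhs_pinfty_gt.
    apply: filterS2 rp (H0 _ N) => r r0 /=; rewrite gt_max => /andP[h1 h2].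
    have p1 (s : R) : 0 < r `^ s by exact: powR_gt0.
    split; [apply: le_trans (Phi_lower_of_ratio U0 (p1 _) e0 h1)
           |apply: le_trans (Phi_lower_of_ratio V0 (p1 _) e0 h2)];
      by rewrite lee_fin ler_pM2r.
  apply: core.
  - by move=> T; apply: filterS (ev T) => r [].
  - by move=> T; apply: filterS (ev T) => r [].
  - by case: Hc => /cvgeyPge h; [constructor 2|constructor 3].
have hU x : Bc x -> c1 <= U x by move=> /hc1; rewrite le_min => /andP[].
have hV x : Bc x -> c1 <= V x by move=> /hc1; rewrite le_min => /andP[].
(* Constant lower bounds on U and V give Phi of order r^d, and pq <= 1 takes the place of the growth
   condition. *)
by apply: core; [exact: Phi_growth hU|exact: Phi_growth hV|constructor 1].
Qed.
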